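(* Let $(X_t)_{t\in\mathbb{Z}}$ be a strictly stationary $\mathbb{R}^d$-valued sequence which is regularly varying with index $\alpha>0$. Let $A\subset\overline{\mathbb{R}}^d_0$ be a Borel set bounded away from zero such that $A$ is a continuity set with respect to $\mu_0$ and, for every $h\ge 1$, the sets $A\times\overline{\mathbb{R}}^{dh}$ and $A\times\overline{\mathbb{R}}^{d(h-1)}\times A$ are continuity sets with respect to $\mu_h$; assume $\mu_0(A)>0$. Assume that conditions (M), (M1) and (M2) (defined in the context) and $\sum_{h\ge1}\rho_A(h)<\infty$ hold. Let $(s_n)$ be integers with $s_n\to\infty$ and $s_n/n\to0$, and let $w_n(j)\ge0$, $|j|\le s_n$, be weights with $$\sum_{|j|\le s_n}w_n(j)=1\quad\text{and}\quad\sum_{|j|\le s_n}w_n^2(j)\to0\quad\text{as }n\to\infty.$$ Then for every fixed frequency $\lambda\in(0,\pi)$, as $n\to\infty$, $$\widetilde f_{nA}(\lambda)\xrightarrow{L^2}\mu_0(A)f_A(\lambda)\quad\text{and}\quad\frac{\widetilde f_{nA}(\lambda)}{\widehat P_m(A)}\xrightarrow{P}f_A(\lambda),$$ where $\widetilde f_{nA}(\lambda)=\sum_{|j|\le s_n}w_n(j)I_{nA}(\lambda_j)$ is the smoothed periodogram, with $\lambda_0=\min\{2\pi j/n: j\in\mathbb{Z},\,2\pi j/n\ge\lambda\}$ and $\lambda_j=\lambda_0+2\pi j/n$, $|j|\le s_n$.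
   Context: Notation: $\overline{\mathbb{R}}=\mathbb{R}\cup\{\pm\infty\}$, $\overline{\mathbb{R}}^k_0=\overline{\mathbb{R}}^k\setminus\{\mathbf 0\}$. A set is bounded away from zero if its closure does not contain $\mathbf 0$. Regular variation: the strictly stationary sequence $(X_t)$ is regularly varying with index $\alpha>0$ if, with $(a_n)$ chosen such that $a_n\to\infty$ and $nP(|X_0|>a_n)\to1$, for every $h\ge0$ there is a non-null Radon measure $\mu_h$ on the Borel $\sigma$-field of $\overline{\mathbb{R}}^{d(h+1)}_0$ (where bounded sets are those bounded away from zero) such that, with $Y_h=(X_0,\ldots,X_h)$, $nP(a_n^{-1}Y_h\in\cdot)\to\mu_h(\cdot)$ vaguely, and $\mu_h(tC)=t^{-\alpha}\mu_h(C)$ for $t>0$ and Borel $C$ (equivalently $P(x^{-1}Y_h\in\cdot)/P(|X_0|>x)\to\mu_h(\cdot)$ vaguely as $x\to\infty$). Extremogram and spectral density: $\rho_A(h)=\lim_{x\to\infty}P(x^{-1}X_h\in A\mid x^{-1}X_0\in A)$, $h\ge0$ (the limit exists under the stated continuity conditions), $\rho_A(-h)=\rho_A(h)$, and $f_A(\lambda)=\sum_{h\in\mathbb{Z}}\rho_A(h)e^{-ih\lambda}$, $\lambda\in[0,\pi]$. Condition (M): $(X_t)$ is strongly mixing with rate function $(\xi_h)$, $\xi_h=\sup\{|P(C\cap D)-P(C)P(D)|: C\in\sigma(X_s,s\le0), D\in\sigma(X_s,s\ge h)\}\to0$. There exist integer sequences $m=m_n\to\infty$, $r_n\to\infty$ with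 $m_n/n\to0$, $r_n/m_n\to0$, $\lim_{n\to\infty}m_n\sum_{h=r_n}^\infty\xi_h=0$, and for all $\epsilon>0$, $\lim_{k\to\infty}\limsup_{n\to\infty}m_n\sum_{h=k}^{r_n}P(|X_h|>\epsilon a_m,|X_0|>\epsilon a_m)=0$, where $a_m=a_{m_n}$. These $(m_n),(r_n)$ are used throughout. Condition (M1): the sequences $(m_n),(r_n)$ from (M) and $k_n=[n/m_n]$ also satisfy $k_n\xi_{r_n}\to0$ and $m_n=o(n^{1/3})$. Condition (M2): the sequences $(m_n),(r_n)$ from (M) also satisfy $m_n^2\,n\sum_{h=r_n+1}^n\xi_h\to0$ and $m_nr_n^3/n\to0$. Set $I_t=\mathbf 1\{X_t/a_m\in A\}$, $p_0=P(a_m^{-1}X_0\in A)$, $\widetilde I_t=I_t-p_0$, $$I_{nA}(\lambda)=\frac{m_n}{n}\Big|\sum_{t=1}^n\widetilde I_te^{-it\lambda}\Big|^2,\qquad \widehat P_m(A)=\frac{m_n}{n}\sum_{t=1}^nI_t.$$ Ratios with denominator $\widehat P_m(A)$ are given an arbitrary value (e.g. $0$) when $\widehat P_m(A)=0$. *)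

(* Defs.v *)
From HB Require Import structures.
From mathcomp Require Export all_boot all_order all_algebra.
From mathcomp.real_closed Require Export complex.
From mathcomp Require Export all_classical all_reals all_analysis.

Set Implicit Arguments.
Unset Strict Implicit.
Unset Printing Implicit Defensive.

Export Order.TTheory GRing.Theory Num.Theory.
Export numFieldNormedType.Exports.

Global Open Scope classical_set_scope.
Global Open Scope ring_scope.

Notation borelType E := (g_sigma_algebraType (@open E)).

Definition boundary (E : topologicalType) (B : set E) : set E :=
  closure B `\` interior B.

Definition sym_sum (V : nmodType) (N : nat) (F : int -> V) : V :=
  \sum_(i < N.*2.+1) F (i%:Z - N%:Z).

(* exp(ix), by Euler's formula *)
Definition cexpi (R : realType) (x : R) : R[i] := (cos x +i* sin x)%C.

Definition cabs (R : realType) (z : R[i]) : R := Normc.normc z.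

Section PuncturedSpace.
Context {R : realType} {k d : nat}.

(* Points of \bar R^(k d), arranged in k rows of length d. *)
Local Notation E := 'M[\bar R]_(k, d).

Definition origin : E := const_mx 0%E.

Definition bounded_away0 (B : set E) : Prop := ~ closure B origin.

(* A Borel measure on E minus the origin is encoded as a Borel measure on E
   that does not charge the origin.  Bounded sets play the role of the relatively
   compact ones, and E minus the origin is locally compact with a countable base,
   so that a measure finite on bounded Borel sets is Radon. *)
Definition radon0 (mu : {measure set (borelType E) -> \bar R}) : Prop :=
  mu [set origin] = 0%E /\
  forall B : set (borelType E), measurable B -> bounded_away0 B ->
    (mu B < +oo)%E.

(* The test functions are those of C_K^+ of E minus the origin, extended by 0. *)
Definition vague_cvg (nu : nat -> set (borelType E) -> \bar R)
    (mu : set (borelType E) -> \bar R) : Prop :=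
  forall f : E -> R, continuous f -> (forall x, 0 <= f x) ->
    bounded_away0 [set x | f x != 0] ->
    (\int[nu n]_x (f x)%:E)%E @[n --> \oo] --> (\int[mu]_x (f x)%:E)%E.

Definition continuity_set (mu : set (borelType E) -> \bar R) (B : set E) : Prop :=
  mu (boundary B) = 0%E.

Definition dilate (t : R) (B : set E) : set E :=
  [set map_mx (fun y => t%:E * y)%E x | x in B].

Definition rescale (c : R) (x : 'M[R]_(k, d)) : E :=
  map_mx (fun y => (c^-1 * y)%:E) x.

End PuncturedSpace.

Definition enorm (R : realType) (d : nat) (x : 'rV[R]_d) : R :=
  Num.sqrt (\sum_(j < d) x 0 j ^+ 2).

(* Time runs over Z, and the rows of a matrix are indexed by time lags. *)
Section Process.
Context {dT : measure_display} {T : measurableType dT} {R : realType}.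
Variables (P : probability T R) (d : nat).
Variable X : int -> {RV P >-> borelType 'rV[R]_d}.

Definition pr (C : set T) : R := fine (P C).

Definition cond_pr (C D : set T) : R := pr (C `&` D) / pr D.

Definition stack (k : nat) (ts : 'I_k -> int) (w : T) : 'M[R]_(k, d) :=
  \matrix_(i, j) (X (ts i) w : 'rV[R]_d) 0 j.

Definition strictly_stationary : Prop :=
  forall (k : nat) (ts : 'I_k -> int) (u : int) (B : set (borelType 'M[R]_(k, d))),
    measurable B ->
    P (stack (fun i => ts i + u) @^-1` B) = P (stack ts @^-1` B).

Definition Y (h : nat) : T -> 'M[R]_(h.+1, d) :=
  stack (fun i : 'I_h.+1 => i%:Z).

Definition exceeds (t : int) (c : R) : set T := [set w | enorm (X t w) > c].

Record regularly_varying (alpha : R) (a : nat -> R)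
    (mu : forall h, {measure set (borelType 'M[\bar R]_(h.+1, d)) -> \bar R}) :
    Prop := {
  rv_a_pinfty : a n @[n --> \oo] --> +oo ;
  rv_a_tail : n%:R * pr (exceeds 0 (a n)) @[n --> \oo] --> (1 : R) ;
  rv_radon : forall h, radon0 (mu h) ;
  rv_nonnull : forall h, mu h setT <> 0%E ;
  rv_vague : forall h,
    vague_cvg (fun n B => n%:R%:E * P ((rescale (a n) \o @Y h) @^-1` B))%E (mu h) ;
  rv_homogeneous : forall h (t : R) (C : set (borelType 'M[\bar R]_(h.+1, d))),
    0 < t -> measurable C -> mu h (dilate t C) = ((t `^ (- alpha))%:E * mu h C)%E
}.

(* The event X_t / c \in A *)
Definition hits (A : set 'rV[\bar R]_d) (c : R) (t : int) : set T :=
  [set w | A (rescale c (X t w))].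

Definition extremogram (A : set 'rV[\bar R]_d) (h : nat) : R :=
  lim (cond_pr (hits A x h%:Z) (hits A x 0) @[x --> +oo]).

Definition spectral_density (A : set 'rV[\bar R]_d) (lambda : R) : R[i] :=
  lim ((sym_sum N (fun h : int =>
    (extremogram A `|h|%N)%:C%C * cexpi (- (h%:~R * lambda))) : R[i]^o)
    @[N --> \oo]).

(* The sigma-field generated by the X_s, s in S *)
Definition sigma_field (S : set int) : set (set T) :=
  <<s \bigcup_(s in S) preimage_set_system setT (X s) measurable >>.

Definition mixing_rate (h : nat) : R :=
  sup [set x | exists C D : set T,
    [/\ sigma_field [set s : int | s <= 0] C,
        sigma_field [set s : int | h%:Z <= s] D &
        x = `|pr (C `&` D) - pr C * pr D| ]].

Record condition_M (a : nat -> R) (m r : nat -> nat) : Prop := {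
  M_mixing : mixing_rate h @[h --> \oo] --> (0 : R) ;
  M_m_infty : m n @[n --> \oo] --> \oo ;
  M_r_infty : r n @[n --> \oo] --> \oo ;
  M_m_n : (m n)%:R / n%:R @[n --> \oo] --> (0 : R) ;
  M_r_m : (r n)%:R / (m n)%:R @[n --> \oo] --> (0 : R) ;
  M_mixing_sum :
    ((m n)%:R%:E * \sum_(r n <= h <oo) (mixing_rate h)%:E)%E
      @[n --> \oo] --> 0%E ;
  M_anticlustering : forall eps : R, 0 < eps ->
    limn_esup (fun n => ((m n)%:R%:E * \sum_(k <= h < (r n).+1)
      P (exceeds h%:Z (eps * a (m n)) `&` exceeds 0 (eps * a (m n))))%E)
      @[k --> \oo] --> 0%E
}.

Record condition_M1 (m r : nat -> nat) : Prop := {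
  M1_mixing : (n %/ m n)%N%:R * mixing_rate (r n) @[n --> \oo] --> (0 : R) ;
  M1_m : (m n)%:R / (n%:R `^ 3^-1) @[n --> \oo] --> (0 : R)
}.

Record condition_M2 (m r : nat -> nat) : Prop := {
  M2_mixing :
    (m n)%:R ^+ 2 * n%:R * \sum_((r n).+1 <= h < n.+1) mixing_rate h
      @[n --> \oo] --> (0 : R) ;
  M2_m_r : (m n)%:R * (r n)%:R ^+ 3 / n%:R @[n --> \oo] --> (0 : R)
}.

Section Periodogram.
Variables (A : set 'rV[\bar R]_d) (a : nat -> R) (m : nat -> nat) (n : nat).

Definition ind (t : int) (w : T) : R := \1_(hits A (a (m n)) t) w.

Definition ind_centered (t : int) (w : T) : R :=
  ind t w - pr (hits A (a (m n)) 0).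

Definition periodogram (lambda : R) (w : T) : R :=
  (m n)%:R / n%:R *
  cabs (\sum_(1 <= t < n.+1)
    (ind_centered t%:Z w)%:C%C * cexpi (- (t%:R * lambda))) ^+ 2.

Definition Phat (w : T) : R :=
  (m n)%:R / n%:R * \sum_(1 <= t < n.+1) ind t%:Z w.

(* For 0 < n the infimum is attained. *)
Definition fourier_freq0 (lambda : R) : R :=
  inf [set x | lambda <= x /\ exists j : int, x = 2 * pi * j%:~R / n%:R].

Definition fourier_freq (lambda : R) (j : int) : R :=
  fourier_freq0 lambda + 2 * pi * j%:~R / n%:R.

Definition smoothed_periodogram (s : nat -> nat) (wt : nat -> int -> R)
    (lambda : R) (w : T) : R :=
  sym_sum (s n) (fun j => wt n j * periodogram (fourier_freq lambda j) w).

End Periodogram.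

Definition cvg_L2 (Z : nat -> T -> R[i]) (c : R[i]) : Prop :=
  (\int[P]_w (cabs (Z n w - c) ^+ 2)%:E)%E @[n --> \oo] --> 0%E.

Definition cvg_in_probability (Z : nat -> T -> R[i]) (c : R[i]) : Prop :=
  forall eps : R, 0 < eps ->
    P [set w | eps < cabs (Z n w - c)] @[n --> \oo] --> 0%E.

End Process.

(* Main.v *)
From HB Require Import structures.
Require Import Defs.
From mathcomp Require Import measurable_realfun ring lra zify.

(** Let I_t be the indicator of the event that X_t / a_m lies in A, p its
mean, J_t = I_t - p, gamma(h) the covariance of J_0 and J_h, and
K(x) = sum_j w_j cos(x lambda_j).  Expanding the squared moduli turns the
smoothed periodogram into the quadratic form (m/n) sum_(s,t) K(s-t) J_s J_t
([smoothed_periodogramE]).  It converges in mean square because its mean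
converges and its variance vanishes ([smoothed_L2]).

Mean ([mean_cvg]).  It equals m gamma(0) + 2 sum_h (1 - h/n) m gamma(h) K(h).
For a fixed lag h, vague convergence on a continuity set gives
m gamma(h) -> tau_h, the limit mass of the set where both the first and the last
row lie in A, while K(h) -> cos(h lambda) because the frequencies lambda_j shrink
to lambda.  The lags h >= k contribute m sum_(h >= k) |gamma(h)|, which is small
uniformly in n once k is large: up to r_n by the anti-clustering condition,
beyond r_n by mixing ([acov_tail]).

Variance ([smoothed_variance_cvg0]).  A fourth moment of the J_t is the sum of
three products of covariances and a cumulant.  The first product cancels with
the square of the mean.  The two others contribute at most
2 (m sum_h |gamma(h)|)^2 times n^-2 sum_(s,t) K(s-t)^2 ([gaussian_bound]); since
the frequencies lambda_j are spaced by 2 pi / n, orthogonality over a full period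
bounds the last factor by sum_j w_j^2 ([parseval]), which tends to 0.  As for the
cumulant, if some gap g between the four ordered times exceeds r_n, mixing across
that gap bounds it by a multiple of xi_g; otherwise it is at most 5 p, and this
concerns O(n r_n^3) quadruples only ([cumulant_bound]).  In total this is of order
m^2 n sum_(h > r_n) xi_h + m r_n^3 / n, and both terms tend to 0
([sum_cumulant_bound]).

Extremogram ([extremogramE]).  It is a limit over all real levels, whereas regular
variation is stated along the sequence a_n, which need not be monotone.
Homogeneity of the limit measure forbids jumps of a_n by a fixed factor
([tail_ratio]), so that every large level is within a factor close to 1 of some
a_n ([scale_approx]), and the portmanteau inequalities are proved uniformly under
such small changes of level ([portmanteau_closed], [portmanteau_open]).  Hence the
extremogram at lag h is tau_h / tau_0.

Finally the normalised number of hits converges in mean square to tau_0 > 0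
([Phat_L2]), and Chebyshev's inequality gives the convergence in probability of
the ratio ([ratio_cvg_in_probability]). *)

Set Implicit Arguments.
Unset Strict Implicit.
Unset Printing Implicit Defensive.

(** * Test functions on a pseudometric space *)

Section Clamp.
Context {R : realType}.
Implicit Types x y : R.

Definition clamp (x : R) : R := Num.max 0 (Num.min 1 x).

Lemma clamp_ge0 x : 0 <= clamp x.
Proof. by rewrite le_max lexx. Qed.
Lemma clamp_le1 x : clamp x <= 1.
Proof. by rewrite ge_max ler01 ge_min lexx. Qed.
Lemma clamp1 x : 1 <= x -> clamp x = 1.
Proof. by move=> x1; rewrite /clamp (min_idPl x1); exact/max_idPr. Qed.
Lemma clamp0 x : x <= 0 -> clamp x = 0.
Proof. by move=> x0; apply/max_idPl; rewrite ge_min x0 orbT. Qed.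

Lemma clamp_lip x y : `|clamp x - clamp y| <= `|x - y|.
Proof.
wlog xy : x y / x <= y.
  move=> h; have [/h//|/ltW/h] := leP x y.
  by rewrite distrC (distrC y).
rewrite distrC (distrC x) (@ger0_norm _ (y - x)) ?subr_ge0//.
have h z : clamp z = if 1 <= z then 1 else if 0 <= z then z else 0.
  case: ifPn => [/clamp1//|]; rewrite -ltNge => z1.
  case: ifPn => [z0|]; last by rewrite -ltNge => /ltW/clamp0.
  by rewrite /clamp (min_idPr (ltW z1)); exact/max_idPr.
rewrite !h ler_norml; apply/andP.
by case: (leP 1 x) => h1; case: (leP 1 y) => h2; case: (leP 0 x) => h3; case: (leP 0 y) => h4; split; lra.
Qed.

Lemma clamp_continuous : continuous clamp.
Proof.
move=> x; apply/cvgrPdist_lt => e e0; apply/nbhs_ballP; exists e => //= y xy.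
exact: le_lt_trans (clamp_lip _ _) xy.
Qed.

End Clamp.

Section TruncatedDistance.
Context {R : realType} {E : pseudoMetricType R}.
Implicit Types (F : set E) (y z : E) (e : R).

(** The element 1 makes the infimum meaningful for an empty [F] and, the distance
being at most 1, avoids extended reals. *)
Definition trunc_dist F y : R :=
  inf ([set e | 0 < e /\ exists2 z, F z & ball y e z] `|` [set 1]).

Let S F y := [set e : R | 0 < e /\ exists2 z, F z & ball y e z] `|` [set 1].

Let S_lb F y : lbound (S F y) 0.
Proof. by move=> e [[/ltW]|->//]. Qed.

Lemma trunc_dist_ge0 F y : 0 <= trunc_dist F y.
Proof. by apply: lb_le_inf; [exists 1; right|exact: S_lb]. Qed.

Lemma trunc_dist_le1 F y : trunc_dist F y <= 1.
Proof. by apply: ge_inf; [exists 0; exact: S_lb|right]. Qed.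

Lemma trunc_dist_le F y z e : 0 < e -> F z -> ball y e z -> trunc_dist F y <= e.
Proof.
by move=> e0 Fz yz; apply: ge_inf; [exists 0; exact: S_lb|left; split=> //; exists z].
Qed.

Lemma trunc_dist_lt F y e : trunc_dist F y < e -> e <= 1 -> exists2 z, F z & ball y e z.
Proof.
move=> de e1.
have [e' [[e'0 [z Fz yz]]|->] e'e] := inf_lt (ex_intro _ 1 (or_intror erefl)) de.
  by exists z => //; apply: le_ball yz; exact: ltW.
by move: (lt_le_trans e'e e1); rewrite ltxx.
Qed.

(** Stated with a ball around [y] rather than a distance between points, which is
all that a pseudometric given by its balls provides; continuity follows. *)
Lemma trunc_dist_triangle F y y' e : 0 < e -> ball y e y' ->
  trunc_dist F y <= e + trunc_dist F y'.
Proof.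
move=> e0 yy'; rewrite -lerBlDl; apply: lb_le_inf; first by exists 1; right.
move=> e' [[e'0 [z Fz y'z]]|->]; rewrite lerBlDl.
  by apply: trunc_dist_le Fz _; [exact: addr_gt0|exact: ball_triangle y'z].
by apply: le_trans (trunc_dist_le1 _ _) _; rewrite lerDr ltW.
Qed.

Lemma trunc_dist_continuous F : continuous (trunc_dist F).
Proof.
move=> y; apply/cvgrPdist_lt => e e0.
have e20 : 0 < e / 2 by rewrite divr_gt0.
apply/nbhs_ballP; exists (e / 2) => //= y' yy'.
have h1 := @trunc_dist_triangle F _ _ _ e20 yy'.
have h2 := @trunc_dist_triangle F _ _ _ e20 (ball_sym yy').
rewrite ltr_norml; apply/andP; split; lra.
Qed.

Lemma closure_trunc_dist F y : trunc_dist F y = 0 -> closure F y.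
Proof.
move=> d0 U /nbhs_ballP[e /= e0 eU].
have [z Fz yz] : exists2 z, F z & ball y (Num.min e 1) z.
  by apply: trunc_dist_lt; rewrite ?d0 ?lt_min ?e0 ?ltr01// ge_min lexx orbT.
by exists z; split=> //; apply: eU; apply: le_ball yz; rewrite ge_min lexx.
Qed.

Lemma trunc_dist_mem F y : F y -> trunc_dist F y = 0.
Proof.
move=> Fy; apply/eqP; rewrite eq_le trunc_dist_ge0 andbT; apply/ler_addgt0Pl => e e0.
by rewrite addr0; apply: trunc_dist_le Fy _ => //; exact: ballxx.
Qed.

(** Equal to 1 within distance 1/k of [F] and to 0 beyond 2/k.  The margin where it
equals 1 absorbs a small perturbation of the argument. *)
Definition outer_test F (k : R) y : R := clamp (2 - k * trunc_dist F y).
(** Equal to 0 within distance 1/k of the complement of [F] and to 1 beyond 2/k. *)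
Definition inner_test F (k : R) y : R := clamp (k * trunc_dist (~` F) y - 1).

Lemma outer_test_continuous F k : continuous (outer_test F k).
Proof.
move=> y; apply: (@continuous_comp _ _ _ (fun y => 2 - k * trunc_dist F y)); last exact: clamp_continuous.
by apply: cvgB; [exact: cvg_cst|apply: cvgMr; exact: trunc_dist_continuous].
Qed.

Lemma inner_test_continuous F k : continuous (inner_test F k).
Proof.
move=> y; apply: (@continuous_comp _ _ _ (fun y => k * trunc_dist (~`F) y - 1)); last exact: clamp_continuous.
by apply: cvgB; [apply: cvgMr; exact: trunc_dist_continuous|exact: cvg_cst].
Qed.

End TruncatedDistance.

(** The distance on the extended line is measured through [contract], and multiplying
by a constant close to 1 is close to the identity for it, uniformly in [u]: the
difference is (1 - c) u divided by (1 + |u|)(1 + |c u|), and the denominator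
absorbs [u]. *)
Lemma contract_scale {R : realType} (u c : R) : 0 < c ->
  `|contract u%:E - contract (c * u)%:E| <= `|c - 1|.
Proof.
move=> c0 /=.
have a0 : 0 < 1 + `|u| by rewrite ltr_pwDl.
have b0 : 0 < 1 + `|c * u| by rewrite ltr_pwDl.
have -> : u / (1 + `|u|) - c * u / (1 + `|c * u|) =
    (1 - c) * (u / ((1 + `|u|) * (1 + `|c * u|))).
  rewrite normrM (gtr0_norm c0) in b0 *; field.
  by rewrite !gt_eqF.
rewrite normrM distrC ler_piMr// normrM normfV.
rewrite ler_pdivrMr ?normr_gt0 ?mulf_neq0 ?gt_eqF// mul1r (gtr0_norm (mulr_gt0 a0 b0)).
apply: (@le_trans _ _ (1 + `|u|)); first by lra.
by rewrite ler_peMr ?(ltW a0)// lerDl.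
Qed.

(** * Rescaling, and Borel sets of matrix spaces *)

Section Rescale.
Context {R : realType} {k d : nat}.
Local Notation E := 'M[\bar R]_(k, d).

(** Changing the level from [a] to [x] moves every rescaled point by less than a
bound on |a/x - 1|, uniformly over the whole space. *)
Lemma ball_rescale (a x e : R) (y : 'M[R]_(k, d)) : a != 0 -> e <= 1 ->
  `|a / x - 1| < e -> ball (rescale a y) e (rescale x y).
Proof.
move=> a0 e1 axe.
have ax0 : 0 < a / x by move: axe; rewrite ltr_norml => /andP[]; lra.
have x0 : x != 0 by apply: contraTneq ax0 => ->; rewrite invr0 mulr0 ltxx.
split=> [|i j]; first exact: le_lt_trans (normr_ge0 _) axe.
rewrite !mxE /ball /= /ereal_ball.
have -> : x^-1 * y i j = a / x * (a^-1 * y i j) by field; rewrite x0 a0.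
by apply: (@le_lt_trans _ _ `|a / x - 1|) => //; exact: (contract_scale _ ax0).
Qed.

Lemma rescale_continuous (c : R) : continuous (@rescale R k d c).
Proof.
move=> y U /nbhs_ballP[e /= e0 eU].
have cont (i : 'I_k) (j : 'I_d) :
    \forall z \near y, ball (rescale c y i j) e (rescale c z i j).
  have : (EFin \o (fun z : 'M[R]_(k, d) => c^-1 * z i j)) z @[z --> y] --> (c^-1 * y i j)%:E.
    apply/(@fine_cvgP _ _ (nbhs y) (nbhs_filter y)); split; first by apply: nearW.
    by apply: cvgMr; exact: (@coord_continuous R k d i j y).
  move=> h; have : nbhs (rescale c y i j) (ball (rescale c y i j) e) by apply/nbhs_ballP; exists e.
  rewrite {1}mxE => /h; apply: (@filterS _ (nbhs y) (nbhs_filter y)) => z /=; by rewrite !mxE.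
have : \forall z \near y, forall ij : 'I_k * 'I_d, ball (rescale c y ij.1 ij.2) e (rescale c z ij.1 ij.2).
  by apply: (@filter_forall _ _ _ (nbhs y) (nbhs_filter y)) => -[i j]; exact: cont.
apply: (@filterS _ (nbhs y) (nbhs_filter y)) => z h; apply: eU; split=> // i j; exact: (h (i, j)).
Qed.

End Rescale.

Section BorelMeasurability.
Context {dT : measure_display} {T : measurableType dT}.

Lemma continuous_measurable (E F : ptopologicalType) (f : E -> F) : continuous f ->
  measurable_fun setT (f : borelType E -> borelType F).
Proof.
move=> /continuousP cf.
apply: (@measurability _ _ (borelType E) (borelType F) setT f open erefl) => _ [B oB <-].
by rewrite setTI; apply: sub_gen_smallest; exact: cf.
Qed.

(** An open set of matrices is a countable union of balls with rational centre and
radius 1/(n+1), and such a ball is a finite intersection of conditions on entries. *)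
Lemma measurable_fun_mx (R : realType) (k d : nat)
    (f : T -> 'M[R]_(k, d)) :
  (forall i j, measurable_fun setT (fun w => f w i j)) ->
  measurable_fun setT (f : T -> borelType 'M[R]_(k, d)).
Proof.
move=> mf; apply: (@measurability _ _ _ (borelType 'M[R]_(k, d)) setT f open erefl) => _ [B oB <-].
rewrite setTI.
pose ratm (q : 'M[rat]_(k, d)) : 'M[R]_(k, d) := map_mx ratr q.
pose D := [set qn : 'M[rat]_(k, d) * nat | ball (ratm qn.1) qn.2.+1%:R^-1 `<=` B].
have -> : f @^-1` B =
    \bigcup_(qn in D) f @^-1` (ball (ratm qn.1) qn.2.+1%:R^-1).
  apply/seteqP; split=> w; last by move=> [qn Dqn]; exact: Dqn.
  move=> Bw; have /nbhs_ballP[e /= e0 eB] : nbhs (f w) B by exact: open_nbhs_nbhs.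
  have [n ne] : exists n : nat, n.+1%:R^-1 < e / 2.
    exists (Num.truncn ((e / 2)^-1)); rewrite invf_plt ?posrE ?divr_gt0//.
    exact: truncnS_gt.
  have n0 : 0 < n.+1%:R^-1 :> R by rewrite invr_gt0.
  have hq (i : 'I_k) (j : 'I_d) : exists q : rat, `|f w i j - ratr q| < n.+1%:R^-1.
    have lt : f w i j - n.+1%:R^-1 < f w i j + n.+1%:R^-1.
      by rewrite ltrBlDr -addrA ltrDl addr_gt0.
    have [q] := rat_in_itvoo lt.
    rewrite in_itv /= => /andP[h1 h2]; by exists q; rewrite distrC ltr_distl h1 h2.
  pose q : 'M[rat]_(k, d) := \matrix_(i, j) projT1 (cid (hq i j)).
  have qw : ball (f w) n.+1%:R^-1 (ratm q).
    by split=> // i j; rewrite !mxE /ball /=; case: cid.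
  exists (q, n) => /=; last exact: ball_sym.
  move=> z qz; apply: eB; apply: le_ball (ball_triangle qw qz); by rewrite -mulr2n -[X in X <= _]mulr_natr -ler_pdivlMr// ltW.
rewrite bigcup_mkcond; apply: countable_bigcupT_measurable => [|[q n]]; first exact: countableP.
case: ifPn => // _.
have -> : f @^-1` ball (ratm q) n.+1%:R^-1 =
   \bigcap_(ij in [set: 'I_k * 'I_d]) ((fun w => f w ij.1 ij.2) @^-1` ball (ratm q ij.1 ij.2) n.+1%:R^-1).
  apply/seteqP; split=> w /=.
    by move=> [_ h] [i j] _; exact: h.
  by move=> h; split; [rewrite invr_gt0|move=> i j; exact: (h (i, j))].
apply: fin_bigcap_measurable => // -[i j] _.
rewrite -[X in measurable X]setTI; apply: mf => //=.
exact: measurable_ball.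
Qed.

Lemma open_borel (E : ptopologicalType) (B : set E) :
  open B -> (measurable : set (set (borelType E))) B.
Proof. exact: sub_gen_smallest. Qed.

Lemma closed_borel (E : ptopologicalType) (B : set E) :
  closed B -> (measurable : set (set (borelType E))) B.
Proof.
by move=> cB; rewrite -(setCK B); apply: measurableC; apply: open_borel; exact: closed_openC.
Qed.

Lemma continuous_measurable_real (R : realType) (E : ptopologicalType) (f : E -> R) :
  continuous f -> measurable_fun setT (f : borelType E -> R).
Proof.
move=> /continuousP cf.
apply: (@measurability _ _ (borelType E) R setT f _ (RGenOpens.measurableE R)).
move=> _ [_ [x [y ->]] <-]; rewrite setTI; apply: open_borel; apply: cf.
exact: interval_open.
Qed.

End BorelMeasurability.

(** * Portmanteau inequalities for vague limits *)

Section IndicatorBounds.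
Context {dT : measure_display} {T : measurableType dT} {R : realType}.
Variable m : {measure set T -> \bar R}.
Implicit Types (f : T -> R) (B : set T).

Lemma integral_le_measure f B : measurable_fun setT f -> measurable B ->
  (forall x, 0 <= f x <= 1) -> (forall x, f x != 0 -> B x) ->
  (\int[m]_x (f x)%:E <= m B)%E.
Proof.
move=> mf mB f01 fB; rewrite -[X in (_ <= m X)%E](setIT B) -integral_indic//.
apply: ge0_le_integral => //.
- by move=> x _; rewrite lee_fin; case/andP: (f01 x).
- exact/measurable_EFinP.
- exact/measurable_EFinP/measurable_indic.
- move=> x _; rewrite lee_fin indicE.
  have [->|/fB Bx] := eqVneq (f x) 0; first by rewrite ler0n.
  by rewrite mem_set//; case/andP: (f01 x).
Qed.

Lemma measure_le_integral f B : measurable_fun setT f -> measurable B ->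
  (forall x, 0 <= f x) -> (forall x, B x -> 1 <= f x) ->
  (m B <= \int[m]_x (f x)%:E)%E.
Proof.
move=> mf mB f0 fB; rewrite -[X in (m X <= _)%E](setIT B) -integral_indic//.
apply: ge0_le_integral => //.
- exact/measurable_EFinP/measurable_indic.
- exact/measurable_EFinP.
- move=> x _; rewrite lee_fin indicE.
  by case: (boolP (x \in B)) => [xB|_]; [apply: fB; exact: set_mem|exact: f0].
Qed.

End IndicatorBounds.

Section BoundedAway.
Context {R : realType} {k d : nat}.
Local Notation E := 'M[\bar R]_(k, d).

Lemma bounded_away0S (B C : set E) : B `<=` C -> bounded_away0 C -> bounded_away0 B.
Proof. by move=> BC; apply: contra_not; exact: closureS. Qed.

Lemma bounded_away0_closure (B : set E) : bounded_away0 B -> bounded_away0 (closure B).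
Proof. by rewrite /bounded_away0 -(closure_id (closure B)).1//; exact: closed_closure. Qed.

Lemma bounded_away0P (B : set E) : bounded_away0 B <->
  exists2 e : R, 0 < e & forall y, ball (origin : E) e y -> ~ B y.
Proof.
split=> [nB|[e e0 eB] /(_ _ (nbhsx_ballx _ _ e0))[y [By /eB]]//].
apply: contrapT => h; apply: nB => U /nbhs_ballP[e /= e0 eU].
apply: contrapT => h'; apply: h; exists e => // y /eU Uy By.
by apply: h'; exists y.
Qed.

End BoundedAway.

Section Portmanteau.
Context {dT : measure_display} {T : measurableType dT} {R : realType}.
Variables (P : probability T R) (k d : nat).
Local Notation E := 'M[\bar R]_(k, d).
Variables (Yv : T -> 'M[R]_(k, d)) (a : nat -> R).
Variable mu : {measure set (borelType E) -> \bar R}.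
Hypothesis mY : measurable_fun setT (Yv : T -> borelType 'M[R]_(k, d)).
Hypothesis a_pinfty : a n @[n --> \oo] --> +oo.
Hypothesis mu_radon : radon0 mu.
Hypothesis mu_vague :
  vague_cvg (fun n B => n%:R%:E * P ((rescale (a n) \o Yv) @^-1` B))%E mu.

Lemma radon0_fin (B : set E) : (measurable : set (set (borelType E))) B ->
  bounded_away0 B -> mu B \is a fin_num.
Proof. by move=> mB Bb; rewrite ge0_fin_numE//; exact: mu_radon.2. Qed.

Lemma measurable_rescale (c : R) :
  measurable_fun setT (rescale c \o Yv : T -> borelType E).
Proof.
have h := continuous_measurable (@rescale_continuous R k d c).
exact: (measurableT_comp h mY).
Qed.

(** The set functions in the definition of vague convergence are multiples of image
measures, so a change of variables applies. *)
Lemma integral_rescale n (f : E -> R) : continuous f -> (forall x, 0 <= f x) ->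
  (\int[fun B : set (borelType E) => n%:R%:E * P ((rescale (a n) \o Yv) @^-1` B)]_x (f x)%:E =
   n%:R%:E * \int[P]_w (f (rescale (a n) (Yv w)))%:E)%E.
Proof.
move=> cf f0; have mf := continuous_measurable_real cf.
(* The measure structure on an image measure is found through bundled functions. *)
pose mix := isMeasurableFun.Build _ _ _ _ _ (measurable_rescale (a n)).
pose phi : {mfun T >-> borelType E} := HB.pack (rescale (a n) \o Yv : T -> borelType E) mix.
have -> : (fun B : set (borelType E) => n%:R%:E * P ((rescale (a n) \o Yv) @^-1` B))%E =
    mscale n%:R%:nng (distribution P phi) by apply/funext => B; rewrite /mscale.
rewrite ge0_integral_mscale//=; last first.
  - by move=> x _; rewrite lee_fin.
  - exact/measurable_EFinP.
congr (_ * _)%E; rewrite ge0_integral_pushforward//.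
- exact/measurable_EFinP.
- by move=> x _; rewrite lee_fin.
Qed.

(** The mass of the 2/k-neighbourhoods of [F] decreases to that of its closure, so one
of them exceeds it by less than [eta / 2]; vague convergence is applied to the
corresponding [outer_test].  That function equals 1 on a whole neighbourhood of
[F], which makes the bound uniform over the levels [x] with [a n / x] close to 1. *)
Lemma portmanteau_closed (F : set E) (eta : R) : bounded_away0 F -> 0 < eta ->
  exists2 kappa : R, 0 < kappa <= 1 & \forall n \near \oo, forall x (S : set T),
    measurable S -> `|a n / x - 1| < kappa ->
    (forall w, S w -> F (rescale x (Yv w))) ->
    n%:R * pr P S <= fine (mu (closure F)) + eta.
Proof.
move=> F0 eta0.
pose U (j : nat) : set E := [set y | trunc_dist F y < 2 * j.+1%:R^-1].
have oU j : open (U j).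
  have /continuousP := @trunc_dist_continuous R E F.
  by move=> /(_ [set x | x < 2 * j.+1%:R^-1]); apply; exact: open_lt.
have mU j : (measurable : set (set (borelType E))) (U j) by exact: open_borel.
have d0 : 0 < trunc_dist F origin.
  rewrite lt_neqAle trunc_dist_ge0 andbT eq_sym; apply/eqP => /closure_trunc_dist.
  exact: F0.
have [J Jd] : exists J : nat, 2 * J.+1%:R^-1 < trunc_dist F origin / 2.
  exists (Num.truncn ((trunc_dist F origin / 2 / 2)^-1)).
  rewrite mulrC -ltr_pdivlMr// invf_plt ?posrE ?divr_gt0//.
  exact: truncnS_gt.
have U0 j : (J <= j)%N -> bounded_away0 (U j).
  move=> Jj /(_ (ball origin (trunc_dist F origin / 2))) [].
    by apply: nbhsx_ballx; rewrite divr_gt0.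
  move=> y [Uy oy]; have d20 : 0 < trunc_dist F origin / 2 by rewrite divr_gt0.
  have := trunc_dist_triangle F d20 oy.
  have : 2 * j.+1%:R^-1 <= 2 * J.+1%:R^-1 :> R.
    by rewrite ler_pM2l// lef_pV2 ?posrE// ler_nat.
  move: Uy Jd; rewrite /U /=; move: (2 * j.+1%:R^-1) (2 * J.+1%:R^-1) => cj cJ.
  by move=> *; lra.
have [i Ji mui] : exists2 i, (J <= i)%N & (mu (U i) < mu (closure F) + (eta / 2)%:E)%E.
  have : mu \o (fun i => U (J + i)%N) @ \oo --> mu (\bigcap_i U (J + i)%N).
    apply: nonincreasing_cvg_mu => //.
    - by apply: mu_radon.2 => //; apply: U0; rewrite addn0.
    - exact: bigcapT_measurable.
    - move=> p q pq; apply/subsetPset => y; rewrite /U /= => /lt_le_trans; apply.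
      by rewrite ler_pM2l// lef_pV2 ?posrE// ler_nat ltnS leq_add2l.
  have sub : \bigcap_i U (J + i)%N `<=` closure F.
    move=> y Uy; apply: closure_trunc_dist; apply/eqP; rewrite eq_le trunc_dist_ge0 andbT.
    apply/ler_addgt0Pl => e e0; rewrite addr0.
    have := Uy (Num.truncn ((e / 2)^-1)) I; rewrite /U /= => /ltW /le_trans; apply.
    rewrite mulrC -ler_pdivlMr// invf_ple ?posrE ?divr_gt0//.
    apply: (le_trans (ltW (truncnS_gt _))).
    by rewrite ler_nat ltnS leq_addl.
  have fin : mu (closure F) \is a fin_num.
    apply: radon0_fin; first by apply: closed_borel; exact: closed_closure.
    exact: bounded_away0_closure.
  have lt : (mu (\bigcap_i U (J + i)%N) < mu (closure F) + (eta / 2)%:E)%E.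
    apply: (@le_lt_trans _ _ (mu (closure F))).
      apply: le_measure => //; rewrite inE; first exact: bigcapT_measurable.
      by apply: closed_borel; exact: closed_closure.
    by rewrite lteDl// lte_fin divr_gt0.
  move=> /(_ _ (open_ereal_lt' lt)) [N _ /(_ N (leqnn N)) /= h].
  by exists (J + N)%N => //; exact: leq_addr.
pose K : R := i.+1%:R.
have K0 : 0 < K by rewrite ltr0n.
have Ki : 1 <= K by rewrite ler1n.
pose f := outer_test F K.
have fU y : f y != 0 -> U i y.
  move=> fy; apply: contrapT => /negP; rewrite -leNgt => h.
  by move/eqP: fy; apply; apply: clamp0; rewrite subr_le0 -ler_pdivrMl// mulrC.
have f0 y : 0 <= f y by exact: clamp_ge0.
have cf : continuous f by exact: outer_test_continuous.
have fb : bounded_away0 [set y | f y != 0] by apply: bounded_away0S (U0 _ Ji).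
have intf : (\int[mu]_x (f x)%:E <= mu (U i))%E.
  apply: integral_le_measure => //; first exact: continuous_measurable_real.
  by move=> y; rewrite f0 clamp_le1.
have fin : mu (closure F) \is a fin_num.
  apply: radon0_fin; first by apply: closed_borel; exact: closed_closure.
  exact: bounded_away0_closure.
have lim := mu_vague cf f0 fb.
have lt : (\int[mu]_x (f x)%:E < (fine (mu (closure F)) + eta)%:E)%E.
  rewrite EFinD fineK//; apply: le_lt_trans intf (lt_le_trans mui _).
  by rewrite leeD2l// lee_fin; lra.
exists K^-1; first by rewrite invr_gt0 K0 invf_le1.
have := lim _ (open_ereal_lt' lt); apply: filterS2 (cvgry_gt a_pinfty 0) => n an0.
rewrite /= integral_rescale// => ltn x S mS ax SF.
rewrite -lee_fin; apply: le_trans (ltW ltn).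
rewrite EFinM fineK ?fin_num_measure//; apply: lee_wpmul2l; first by rewrite lee_fin.
apply: measure_le_integral => //.
  exact: (measurableT_comp (continuous_measurable_real cf) (measurable_rescale (a n))).
move=> w Sw; rewrite /f /outer_test clamp1// lerBrDr -lerBrDl.
rewrite (_ : 2 - 1 = 1); last by lra.
rewrite -ler_pdivlMl// mulr1.
apply: (trunc_dist_le _ (SF _ Sw)); first by rewrite invr_gt0.
by apply: ball_rescale ax; [rewrite gt_eqF|rewrite invf_le1].
Qed.

(** The counterpart from inside: the points at distance at least 2/k from the complement
exhaust the interior of [F]. *)
Lemma portmanteau_open (F : set E) (eta : R) : bounded_away0 F -> 0 < eta ->
  exists2 kappa : R, 0 < kappa <= 1 & \forall n \near \oo, forall x (S : set T),
    measurable S -> `|a n / x - 1| < kappa ->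
    (forall w, F (rescale x (Yv w)) -> S w) ->
    fine (mu (interior F)) - eta <= n%:R * pr P S.
Proof.
move=> F0 eta0.
pose G (j : nat) : set E := [set y | 2 * j.+1%:R^-1 <= trunc_dist (~` F) y].
have mG j : (measurable : set (set (borelType E))) (G j).
  apply: closed_borel.
  have /continuous_closedP := @trunc_dist_continuous R E (~` F).
  by move=> /(_ [set x | 2 * j.+1%:R^-1 <= x]); apply; exact: closed_ge.
have mI : (measurable : set (set (borelType E))) (interior F).
  by apply: open_borel; exact: open_interior.
have fin : mu (interior F) \is a fin_num.
  by apply: radon0_fin => //; apply: bounded_away0S F0; exact: interior_subset.
have mU : (measurable : set (set (borelType E))) (\bigcup_i G i).
  exact: bigcupT_measurable.
have [i mui] : exists i, (mu (interior F) - (eta / 2)%:E < mu (G i))%E.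
  have : mu \o G @ \oo --> mu (\bigcup_i G i).
    apply: nondecreasing_cvg_mu => //.
    move=> p q pq; apply/subsetPset => y; rewrite /G /=; apply: le_trans.
    by rewrite ler_pM2l// lef_pV2 ?posrE// ler_nat ltnS.
  have sub : interior F `<=` \bigcup_i G i.
    move=> y Fy; have d0 : 0 < trunc_dist (~` F) y.
      rewrite lt_neqAle trunc_dist_ge0 andbT eq_sym; apply/eqP => /closure_trunc_dist.
      by rewrite closure_setC; exact.
    exists (Num.truncn ((trunc_dist (~` F) y / 2)^-1)) => //; rewrite /G /=.
    rewrite mulrC -ler_pdivlMr// invf_ple ?posrE ?divr_gt0//.
    exact: (ltW (truncnS_gt _)).
  have lt : (mu (interior F) - (eta / 2)%:E < mu (\bigcup_i G i))%E.
    apply: (@lt_le_trans _ _ (mu (interior F))).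
      by rewrite gteDl// oppe_lt0 lte_fin divr_gt0.
    by apply: le_measure => //; rewrite inE.
  move=> /(_ _ (open_ereal_gt' lt)) [N _ /(_ N (leqnn N)) /= h].
  by exists N.
pose K : R := i.+1%:R.
have K0 : 0 < K by rewrite ltr0n.
have Ki : 1 <= K by rewrite ler1n.
pose f := inner_test F K.
have fF y : f y != 0 -> F y.
  move=> fy; apply: contrapT => nF.
  move/eqP: fy; apply; apply: clamp0.
  by rewrite (@trunc_dist_mem _ _ (~` F))// mulr0 sub0r oppr_le0.
have f0 y : 0 <= f y by exact: clamp_ge0.
have cf : continuous f by exact: inner_test_continuous.
have fb : bounded_away0 [set y | f y != 0] by apply: bounded_away0S F0.
have intf : (mu (G i) <= \int[mu]_x (f x)%:E)%E.
  apply: measure_le_integral => //; first exact: continuous_measurable_real.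
  move=> y Gy; rewrite /f /inner_test clamp1// lerBrDr (_ : 1 + 1 = 2)//.
  by rewrite -ler_pdivrMl// mulrC.
have lim := mu_vague cf f0 fb.
have lt : ((fine (mu (interior F)) - eta)%:E < \int[mu]_x (f x)%:E)%E.
  rewrite EFinB fineK//; apply: le_lt_trans (lt_le_trans mui intf).
  by rewrite leeB// lee_fin; lra.
exists K^-1; first by rewrite invr_gt0 K0 invf_le1.
have := lim _ (open_ereal_gt' lt); apply: filterS2 (cvgry_gt a_pinfty 0) => n an0.
rewrite /= integral_rescale// => ltn x S mS ax SF.
rewrite -lee_fin; apply: le_trans (ltW ltn) _.
rewrite EFinM fineK ?fin_num_measure//.
apply: lee_wpmul2l; first by rewrite lee_fin.
apply: integral_le_measure => //.
- exact: (measurableT_comp (continuous_measurable_real cf) (measurable_rescale (a n))).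
- by move=> w; rewrite f0 clamp_le1.
move=> w fw; apply: contrapT => nS; move/eqP: fw; apply; apply: clamp0.
rewrite subr_le0 -ler_pdivlMl// mulr1.
apply: (@trunc_dist_le _ _ _ _ (rescale x (Yv w))); first by rewrite invr_gt0.
- by move/SF.
- by apply: ball_rescale ax; [rewrite gt_eqF|rewrite invf_le1].
Qed.

End Portmanteau.

(** * The Euclidean norm on extended vectors, and measurability of the process *)

Section ExtendedNorm.
Context {R : realType} {d : nat}.
Local Notation E := 'rV[\bar R]_d.

(** A sum of extended reals, infinite as soon as one coordinate is; its level sets are
therefore exact dilations of each other. *)
Definition sqnorm (x : E) : \bar R := (\sum_(j < d) x ord0 j * x ord0 j)%E.

Lemma ecoord_continuous (j : 'I_d) : continuous (fun x : E => x ord0 j).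
Proof.
move=> x U /nbhs_ballP[e /= e0 eU]; apply/nbhs_ballP; exists e => //= y [_ xy].
by apply: eU; exact: xy.
Qed.

Lemma sqre_ge0 (y : \bar R) : (0 <= y * y)%E.
Proof. by have [y0|/ltW y0] := leP y 0%E; [exact: mule_le0|exact: mule_ge0]. Qed.

Lemma sqnorm_continuous : continuous sqnorm.
Proof.
move=> x; rewrite /continuous_at /sqnorm.
apply: (@cvg_nnesum E (nbhs x) (nbhs_pfilter x) R _ _ (fun j y => y ord0 j * y ord0 j)%E
  (fun j => x ord0 j * x ord0 j)%E) => j _.
  by apply: nearW => y; exact: sqre_ge0.
apply: cvgeM; try exact: ecoord_continuous.
by rewrite mule_defE; case: (x ord0 j) => [r| |] //=; rewrite andbF.
Qed.

Lemma sqnorm_gt_open (t : R) : open [set x : E | (t%:E < sqnorm x)%E].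
Proof.
have /continuousP := sqnorm_continuous.
by move=> /(_ [set y | (t%:E < y)%E]); apply; exact: open_ereal_gt_ereal.
Qed.

Lemma sqnorm_ge_closed (t : R) : closed [set x : E | (t%:E <= sqnorm x)%E].
Proof.
have /continuous_closedP := sqnorm_continuous.
move=> /(_ [set y | (t%:E <= y)%E]); apply; exact: closed_ereal_le_ereal.
Qed.

(** This is what makes homogeneity of the limit measure applicable to exceedances of
the norm. *)
Lemma dilate_sqnorm (s : R) : 0 < s ->
  dilate s [set x : E | (1%:E < sqnorm x)%E] = [set x : E | ((s ^+ 2)%:E < sqnorm x)%E].
Proof.
move=> s0.
have scale (c : R) (x : E) : sqnorm (map_mx (fun y => c%:E * y)%E x) = ((c ^+ 2)%:E * sqnorm x)%E.
  rewrite /sqnorm ge0_sume_distrr; last by move=> j _; exact: sqre_ge0.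
  by apply: eq_bigr => j _; rewrite !mxE expr2 EFinM muleACA.
have s20 : 0 < s ^+ 2 by rewrite exprn_gt0.
apply/seteqP; split=> [_ [x /= x1 <-]|x /= xs].
  by rewrite scale -[X in (X < _)%E]mule1 lte_pmul2l.
exists (map_mx (fun y => s^-1%:E * y)%E x) => /=.
  by rewrite scale exprVn -(@lte_pmul2l _ (s ^+ 2)%:E)// mule1 muleA -EFinM divff ?gt_eqF// mul1e.
apply/matrixP => i j; rewrite !mxE muleA -EFinM divff ?gt_eqF// mul1e //.
Qed.

Lemma sqnorm_rescale (c t : R) (x : 'rV[R]_d) : 0 < c -> 0 <= t ->
  ((t ^+ 2)%:E < sqnorm (rescale c x))%E = (t * c < enorm x).
Proof.
move=> c0 t0; rewrite /sqnorm /enorm.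
under eq_bigr do rewrite mxE -EFinM mulrACA -expr2 -[X in _ * X]expr2.
rewrite sumEFin lte_fin -mulr_sumr exprVn ltr_pdivlMl ?exprn_gt0//.
rewrite mulrC -exprMn -[X in _ = (X < _)](@ger0_norm _ (t * c)) ?mulr_ge0 ?(ltW c0)//.
by rewrite -sqrtr_sqr !ltNge ler_sqrt ?sqr_ge0// mulrC.
Qed.

Lemma sqnorm_bounded_away0 (t : R) : 0 < t ->
  bounded_away0 [set x : E | (t%:E < sqnorm x)%E].
Proof.
move=> t0 /(_ [set y | (sqnorm y < t%:E)%E]) [].
  apply: open_nbhs_nbhs; split=> /=.
    have /continuousP := sqnorm_continuous.
    by move=> /(_ [set y | (y < t%:E)%E]); apply; exact: open_ereal_lt_ereal.
  by rewrite /sqnorm big1 ?lte_fin// => j _; rewrite !mxE mule0.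
by move=> y /= [ty /(lt_trans ty)]; rewrite ltxx.
Qed.

End ExtendedNorm.

Section ProcessMeasurability.
Context {dT : measure_display} {T : measurableType dT} {R : realType}.
Variables (P : probability T R) (d : nat).
Variable X : int -> {RV P >-> borelType 'rV[R]_d}.

Lemma measurable_coord t (j : 'I_d) : measurable_fun setT (fun w => (X t w : 'rV[R]_d) ord0 j).
Proof.
have h : continuous (fun x : 'rV[R]_d => x ord0 j) by move=> x; exact: coord_continuous.
exact: (measurableT_comp (continuous_measurable_real h) (measurable_funP (X t))).
Qed.

(** The rows are measurable separately, and a matrix-valued map is measurable as soon as
its entries are. *)
Lemma measurable_stack k (ts : 'I_k -> int) :
  measurable_fun setT (stack X ts : T -> borelType 'M[R]_(k, d)).
Proof.
apply: measurable_fun_mx => i j; rewrite /stack.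
under eq_fun do rewrite mxE; exact: measurable_coord.
Qed.

Lemma measurable_exceeds t c : measurable (exceeds X t c).
Proof.
have : measurable_fun setT (fun w => enorm (X t w : 'rV[R]_d)).
  rewrite /enorm.
  apply: (@measurableT_comp _ _ _ _ _ _ (@Num.sqrt R)).
    by apply: continuous_measurable_fun; exact: sqrt_continuous.
  apply: measurable_sum => j; apply: measurable_funX; exact: measurable_coord.
move=> /(_ measurableT `]c, +oo[%classic (measurable_itv _)); rewrite setTI.
congr measurable; apply/seteqP; split=> w; by rewrite /exceeds /= in_itv /= andbT.
Qed.

Lemma measurable_hits (A : set 'rV[\bar R]_d) c t :
  (measurable : set (set (borelType 'rV[\bar R]_d))) A -> measurable (hits X A c t).
Proof.
move=> mA; have := @measurable_rescale _ _ _ _ _ (X t) (measurable_funP (X t)) c.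
by move=> /(_ measurableT A mA); rewrite setTI.
Qed.

Lemma row_rescale_stack k (ts : 'I_k -> int) c i w :
  row i (rescale c (stack X ts w)) = rescale c (X (ts i) w).
Proof. by apply/matrixP => a b; rewrite !mxE (ord1 a). Qed.

End ProcessMeasurability.

(** * Regular variation along the reals *)

Section RegularVariation.
Context {dT : measure_display} {T : measurableType dT} {R : realType}.
Variables (P : probability T R) (d : nat).
Variable X : int -> {RV P >-> borelType 'rV[R]_d}.
Variables (alpha : R) (a : nat -> R).
Variable mu : forall h : nat, {measure set (borelType 'M[\bar R]_(h.+1, d)) -> \bar R}.
Hypothesis alpha_gt0 : 0 < alpha.
Hypothesis rv : regularly_varying X alpha a mu.

Lemma pr_ge0 (S : set T) : 0 <= pr P S.
Proof. by rewrite fine_ge0. Qed.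

Lemma pr_le1 (S : set T) : measurable S -> pr P S <= 1.
Proof.
by move=> mS; rewrite -lee_fin /pr fineK ?fin_num_measure//; exact: probability_le1.
Qed.

Lemma le_pr (S S' : set T) : measurable S -> measurable S' -> S `<=` S' -> pr P S <= pr P S'.
Proof.
by move=> mS mS' SS'; rewrite fine_le ?fin_num_measure// le_measure ?inE.
Qed.

Lemma row_Y0 c w : rescale c (Y X 0 w) = rescale c (X 0 w).
Proof.
by rewrite -[LHS](row_id ord0) /Y row_rescale_stack.
Qed.

(** Let [U u] be the set of points of norm above [u].  Since n P(|X_0| > a_n) -> 1, the
limit mass of [U 1] is at most 1, so by homogeneity that of the closure of [U t],
which is inside [U s] for 1 < s < t, is at most [s `^ (- alpha)] < 1.  If a_(n+1)
were at least t a_n, then P(|X_0| > t a_n) would be at least P(|X_0| > a_(n+1)),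
which is equivalent to 1/n: a contradiction for large [n]. *)
Lemma tail_ratio (kappa : R) : 0 < kappa ->
  \forall n \near \oo, a n.+1 < (1 + kappa) * a n.
Proof.
move=> k0.
(* [s] lies strictly between 1 and [t], which leaves room for a closure. *)
pose s : R := 1 + kappa / 2; pose t : R := 1 + kappa.
have s0 : 0 < s by rewrite /s; lra.
have s1 : 1 < s by rewrite /s; lra.
have st : s < t by rewrite /s /t; lra.
have t0 : 0 < t by lra.
pose U (t : R) := [set x : 'rV[\bar R]_d | ((t ^+ 2)%:E < sqnorm x)%E].
have U0 u : 0 < u -> bounded_away0 (U u) by move=> u0; apply: sqnorm_bounded_away0; rewrite exprn_gt0.
have oU u : open (U u) by exact: sqnorm_gt_open.
have mY := measurable_stack X (fun i : 'I_1 => i%:Z).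
have hU c u w : 0 < c -> 0 <= u -> U u (rescale c (Y X 0 w)) = exceeds X 0 (u * c) w.
  by move=> c0 u0; rewrite /U /= row_Y0 sqnorm_rescale.
have mu1 : fine (mu 0 (U 1)) <= 1.
  apply/ler_addgt0Pr => e e0.
  have [kp /andP[kp0 _] H] := portmanteau_open mY (rv_a_pinfty rv) (rv_radon rv 0) (rv_vague rv (h := 0)) (U0 _ ltr01) (divr_gt0 e0 (ltr0n _ 2)).
  have e1 : 1 < 1 + e / 2 by rewrite ltrDl divr_gt0.
  have [n [[H1 an0] H2]] := filter_ex (filterI (filterI H (cvgry_gt (rv_a_pinfty rv) 0))
    (cvgr_lt _ (rv_a_tail rv) _ e1)).
  have := H1 (a n) _ (measurable_exceeds X 0 (a n)).
  rewrite divff ?gt_eqF// subrr normr0 => /(_ kp0).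
  have sub w : U 1 (rescale (a n) (Y X 0 w)) -> exceeds X 0 (a n) w by rewrite hU// mul1r.
  by move=> /(_ sub); rewrite (interior_id (U 1)).1//; move: H2; rewrite /=; lra.
pose q := s `^ (- alpha).
have q1 : q < 1.
  rewrite /q powRN invf_lt1 ?powR_gt0//.
  have one : 1 `^ alpha = 1 :> R by rewrite powR1.
  rewrite -[X in X < _]one.
  by apply: gt0_ltr_powR => //; rewrite nnegrE ltW.
have q0 : 0 < q by exact: powR_gt0.
have muclo : fine (mu 0 (closure (U t))) <= q.
  have sub : closure (U t) `<=` U s.
    apply: (@subset_trans _ [set x | ((t ^+ 2)%:E <= sqnorm x)%E]).
      rewrite (closure_id [set x | _]).1; last exact: sqnorm_ge_closed.
      by apply: closureS => x /ltW.
    move=> x; apply: lt_le_trans; rewrite lte_fin.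
    by rewrite ltr_pXn2r// nnegrE ltW.
  have mUs := open_borel (oU s).
  have finUs := radon0_fin (rv_radon rv 0) mUs (U0 _ s0).
  have mclo : (measurable : set (set (borelType 'rV[\bar R]_d))) (closure (U t)).
    by apply: closed_borel; exact: closed_closure.
  apply: (@le_trans _ _ (fine (mu 0 (U s)))).
    apply: fine_le => //; last by apply: le_measure; rewrite ?inE.
    by apply: radon0_fin => //; [exact: rv_radon rv 0|exact: bounded_away0_closure (U0 _ t0)].
  have -> : U s = dilate s (U 1) by rewrite /U expr1n dilate_sqnorm.
  have mU1 := open_borel (oU 1).
  have finU1 := radon0_fin (rv_radon rv 0) mU1 (U0 _ ltr01).
  rewrite (rv_homogeneous rv s0 mU1) fineM//.
  by rewrite /= -[leRHS]mulr1 ler_wpM2l// ltW.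
(* Small enough that q + e < 1 - 2 e, as the contradiction requires. *)
pose e := (1 - q) / 4.
have e0 : 0 < e by rewrite /e; lra.
have [kp /andP[kp0 _] H] := portmanteau_closed mY (rv_a_pinfty rv) (rv_radon rv 0) (rv_vague rv (h := 0)) (U0 _ t0) e0.
have H2 : \forall n \near \oo, 1 - e < n.+1%:R * pr P (exceeds X 0 (a n.+1)).
  have lt1 : 1 - e < 1 by rewrite ltrBlDr ltrDl.
  have := cvgr_gt _ (rv_a_tail rv) _ lt1.
  by move=> [N _ HN]; exists N => // n Nn; apply: (HN n.+1); exact: leqW.
have H3 : \forall n \near \oo, n.+1%:R * pr P (exceeds X 0 (a n.+1)) < 2.
  have lt2 : 1 < 2 :> R by rewrite ltr1n.
  have := cvgr_lt _ (rv_a_tail rv) _ lt2.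
  by move=> [N _ HN]; exists N => // n Nn; apply: (HN n.+1); exact: leqW.
have H4 : \forall n \near \oo, 2 / e < (n.+1%:R : R).
  exists (Num.truncn (2 / e)) => // n /= Nn.
  by apply: lt_le_trans (truncnS_gt _) _; rewrite ler_nat ltnS.
apply: filterS (filterI (filterI H (cvgry_gt (rv_a_pinfty rv) 0)) (filterI H2 (filterI H3 H4))).
move=> n [[H1 an0] [h2 [h3 h4]]].
rewrite ltNge; apply/negP => le.
have mon : pr P (exceeds X 0 (a n.+1)) <= pr P (exceeds X 0 (t * a n)).
  apply: le_pr; try exact: measurable_exceeds.
  by move=> w; rewrite /exceeds /=; exact: le_lt_trans.
have := H1 (a n) _ (measurable_exceeds X 0 (t * a n)).
rewrite divff ?gt_eqF// subrr normr0 => /(_ kp0).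
have sub w : exceeds X 0 (t * a n) w -> U t (rescale (a n) (Y X 0 w)) by rewrite hU// ltW.
move=> /(_ sub); apply/negP; rewrite -ltNge.
set p := pr P (exceeds X 0 (a n.+1)) in h2 h3 mon.
have pe : p < e.
  have p0 : 0 <= p by exact: pr_ge0.
  rewrite -(@ltr_pM2l _ n.+1%:R)//; apply: lt_trans h3 _.
  by rewrite mulrC -ltr_pdivrMl// mulrC.
have h5 : n%:R * p <= n%:R * pr P (exceeds X 0 (t * a n)) by rewrite ler_wpM2l.
apply: lt_le_trans h5.
move: h2; rewrite -natr1 mulrDl mul1r.
have : q = 1 - 4 * e by rewrite /e; lra.
move: muclo; move: (n%:R * p) => np; lra.
Qed.

(** If [p] is the first index past a threshold with [a p > x], then [a p.-1 <= x], and
[a p < (1 + kappa) * a p.-1] leaves no room for [x] to be far from [a p.-1]. *)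
Lemma scale_approx (kappa : R) N : 0 < kappa ->
  \forall x \near +oo, exists2 n, (N <= n)%N & `|a n / x - 1| < kappa.
Proof.
move=> k0.
have := filterI (filterI (tail_ratio k0) (cvgry_gt (rv_a_pinfty rv) 0)) (nbhs_infty_ge N).
move=> [N1 _ HN].
have N1N : (N <= N1)%N by have [] := HN N1 (leqnn _).
near=> x.
have xa : a N1 < x by near: x; apply: nbhs_pinfty_gt; rewrite num_real.
have x0 : 0 < x by near: x; apply: nbhs_pinfty_gt; rewrite num_real.
have ex : exists p, a (N1 + p)%N > x.
  have := cvgry_gt (rv_a_pinfty rv) x => -[M _ HM]; exists M; apply: HM => /=.
  by rewrite leq_addl.
have [[|p] xp minp] := ex_minnP ex.
  by move: xp; rewrite addn0 => /(lt_trans xa); rewrite ltxx.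
exists (N1 + p)%N; first by rewrite (leq_trans N1N)// leq_addr.
have apx : a (N1 + p)%N <= x.
  by rewrite leNgt; apply/negP => /minp; rewrite ltnn.
have [[/= h1 h2] _] := HN (N1 + p)%N (leq_addr _ _).
rewrite addnS in xp.
have h3 := lt_trans xp h1.
rewrite -(@ltr_pM2r _ x)// -[X in _ * X < _](gtr0_norm x0) -normrM mulrBl mul1r divfK ?gt_eqF//.
rewrite ltr_norml; apply/andP; split; last first.
  by apply: (@le_lt_trans _ _ 0); [rewrite subr_le0|rewrite mulr_gt0].
have := ler_wpM2l (ltW k0) apx; lra.
Unshelve. all: by end_near. Qed.

End RegularVariation.

Section Extremogram.
Context {dT : measure_display} {T : measurableType dT} {R : realType}.
Variables (P : probability T R) (d : nat).
Variable X : int -> {RV P >-> borelType 'rV[R]_d}.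
Variables (alpha : R) (a : nat -> R).
Variable mu : forall h : nat, {measure set (borelType 'M[\bar R]_(h.+1, d)) -> \bar R}.
Hypothesis alpha_gt0 : 0 < alpha.
Hypothesis rv : regularly_varying X alpha a mu.
Variable A : set 'rV[\bar R]_d.
Hypothesis mA : (measurable : set (set (borelType 'rV[\bar R]_d))) A.
Hypothesis A_away : bounded_away0 A.
Hypothesis A_cont : continuity_set (mu 0%N) A.
Hypothesis AA_cont : forall h : nat, (1 <= h)%N ->
  continuity_set (mu h) [set x | A (row ord0 x) /\ A (row ord_max x)].

Definition both_ends h : set 'M[\bar R]_(h.+1, d) :=
  [set x | A (row ord0 x) /\ A (row ord_max x)].

Arguments both_ends h : clear implicits.

(** Taken on the interior, which is a Borel set without further argument; by continuity
the closure has the same mass. *)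
Definition tail_mass h : R := fine (mu h (interior (both_ends h))).

Lemma both_ends0 : both_ends 0 = A.
Proof.
have row1 (x : 'rV[\bar R]_d) i : row i x = x by rewrite (ord1 i) row_id.
by apply/seteqP; split=> x; rewrite /both_ends /= !row1 => // -[].
Qed.

Lemma both_ends_cont h : continuity_set (mu h) (both_ends h).
Proof. by case: h => [|h]; [rewrite both_ends0|exact: AA_cont]. Qed.

Lemma both_ends_away h : bounded_away0 (both_ends h).
Proof.
have [e e0 eA] := (bounded_away0P A).1 A_away.
apply/bounded_away0P; exists e => // y [_ oy] [Ay _]; apply: eA Ay; split=> // i j.
by have := oy ord0 j; rewrite !mxE.
Qed.

Lemma fine_closure_both_ends h : fine (mu h (closure (both_ends h))) = tail_mass h.
Proof.
have sub : interior (both_ends h) `<=` closure (both_ends h).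
  by apply: subset_trans (@subset_closure _ _); exact: interior_subset.
have mI := open_borel (@open_interior _ (both_ends h)).
have mC := closed_borel (@closed_closure _ (both_ends h)).
rewrite -(setDUK sub) measureU//; last 2 first.
- exact: measurableD.
- by rewrite setDE setICA setICr setI0.
congr fine; rewrite -[RHS]adde0; congr (_ + _)%E; exact: both_ends_cont.
Qed.

Lemma tail_mass0 : tail_mass 0 = fine (mu 0 A).
Proof.
have mI := open_borel (@open_interior _ A).
have mC := closed_borel (@closed_closure _ A).
have fC := radon0_fin (rv_radon rv 0) mC (bounded_away0_closure A_away).
have fA := radon0_fin (rv_radon rv 0) mA A_away.
have fI := radon0_fin (rv_radon rv 0) mI (bounded_away0S (@interior_subset _ A) A_away).
apply/eqP; rewrite eq_le; apply/andP; split.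
  rewrite /tail_mass both_ends0; apply: fine_le => //; apply: le_measure; rewrite ?inE//.
  exact: interior_subset.
rewrite -fine_closure_both_ends both_ends0; apply: fine_le => //; apply: le_measure; rewrite ?inE//.
exact: subset_closure.
Qed.

Definition joint_hits h x : set T := hits X A x h%:Z `&` hits X A x 0.

Lemma measurable_joint_hits h x : measurable (joint_hits h x).
Proof. by apply: measurableI; exact: measurable_hits. Qed.

Lemma joint_hitsE h x w : joint_hits h x w <-> both_ends h (rescale x (Y X h w)).
Proof.
by rewrite /joint_hits /both_ends /hits /Y /= !row_rescale_stack /=; split=> -[].
Qed.

(** Uniform over the levels [x] close to [a n], so that one [n] serves both the numerator
and the denominator of the conditional probability. *)
Lemma joint_tail h (eta : R) : 0 < eta -> exists2 kappa : R, 0 < kappa &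
  \forall n \near \oo, forall x, `|a n / x - 1| < kappa ->
    `|n%:R * pr P (joint_hits h x) - tail_mass h| <= eta.
Proof.
move=> eta0; have mY := measurable_stack X (fun i : 'I_h.+1 => i%:Z).
have [k1 /andP[k10 _] H1] := portmanteau_closed mY (rv_a_pinfty rv) (rv_radon rv h) (rv_vague rv (h := h)) (@both_ends_away h) eta0.
have [k2 /andP[k20 _] H2] := portmanteau_open mY (rv_a_pinfty rv) (rv_radon rv h) (rv_vague rv (h := h)) (@both_ends_away h) eta0.
exists (Num.min k1 k2); first by rewrite lt_min k10.
apply: filterS2 H1 H2 => n H1 H2 x; rewrite lt_min => /andP[x1 x2].
have mJ := measurable_joint_hits h x.
have := H1 x _ mJ x1 (fun w => (joint_hitsE h x w).1).
have := H2 x _ mJ x2 (fun w => (joint_hitsE h x w).2).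
rewrite fine_closure_both_ends -/(tail_mass h) ler_norml => h1 h2.
by apply/andP; split; lra.
Qed.

Lemma tail_mass_ge0 h : 0 <= tail_mass h.
Proof. by rewrite fine_ge0. Qed.

Lemma joint_hits_cvg h (m : nat -> nat) : m n @[n --> \oo] --> \oo ->
  (m n)%:R * pr P (joint_hits h (a (m n))) @[n --> \oo] --> tail_mass h.
Proof.
move=> m_infty.
have H : n%:R * pr P (joint_hits h (a n)) @[n --> \oo] --> tail_mass h.
  apply/cvgrPdist_le => e e0; have [k k0 H] := joint_tail h e0.
  apply: filterS2 H (cvgry_gt (rv_a_pinfty rv) 0) => n H an0.
  by rewrite distrC; apply: H; rewrite divff ?gt_eqF// subrr normr0.
exact: (cvg_comp _ _ m_infty H).
Qed.

Hypothesis A_gt0 : (0 < mu 0%N A)%E.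

Lemma tail_mass0_gt0 : 0 < tail_mass 0.
Proof.
rewrite tail_mass0; apply: fine_gt0; rewrite A_gt0 /=.
by have := radon0_fin (rv_radon rv 0) mA A_away; rewrite ge0_fin_numE.
Qed.

(** For a large level [x], pick [n] with [a n] close to [x]: multiplying the numerator and
the denominator by [n] brings both within [eta] of the limit masses. *)
Lemma cond_pr_cvg h :
  cond_pr P (hits X A x h%:Z) (hits X A x 0) @[x --> +oo] --> tail_mass h / tail_mass 0.
Proof.
have t0 := tail_mass0_gt0; have th := tail_mass_ge0 h.
apply/cvgrPdist_le => e e0.
pose c := tail_mass h + tail_mass 0.
have c0 : 0 < c by rewrite /c; lra.
pose eta := Num.min (tail_mass 0 / 2) (e * (tail_mass 0 / 2 * tail_mass 0) / c).
have eta0 : 0 < eta by rewrite lt_min !divr_gt0 ?mulr_gt0 ?divr_gt0.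
have [k1 k10 [N1 _ H1]] := joint_tail h eta0.
have [k2 k20 [N2 _ H2]] := joint_tail 0 eta0.
have k0 : 0 < Num.min k1 k2 by rewrite lt_min k10.
have := scale_approx alpha_gt0 rv (maxn N1 N2) k0; apply: filterS => x [n].
rewrite geq_max => /andP[n1 n2]; rewrite lt_min => /andP[x1 x2].
have := H1 n n1 x x1; have := H2 n n2 x x2.
rewrite /cond_pr -/(joint_hits h x).
have -> : joint_hits 0 x = hits X A x 0 by rewrite /joint_hits setIid.
set u := pr P (joint_hits h x); set v := pr P _.
have [n0|n0] := eqVneq (n%:R : R) 0.
  rewrite n0 !mul0r !sub0r !normrN (ger0_norm (ltW t0)) le_min => /andP[].
  by rewrite leNgt ltr_pdivrMr// ltr_pMr// ltr1n.
move=> Hv Hu.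
have n0' : 0 < (n%:R : R) by rewrite lt_neqAle eq_sym n0 ler0n.
have eta1 : eta <= tail_mass 0 / 2 by rewrite ge_min lexx.
have eta2 : eta * c <= e * (tail_mass 0 / 2 * tail_mass 0).
  by rewrite -ler_pdivlMr// ge_min lexx orbT.
have -> : u / v = (n%:R * u) / (n%:R * v) by rewrite -mulf_div divff// mul1r.
move: (n%:R * u) (n%:R * v) Hu Hv => U V Hu Hv.
have V0 : tail_mass 0 / 2 <= V by move: Hv; rewrite ler_norml => /andP[]; lra.
have Vp : 0 < V by lra.
have -> : tail_mass h / tail_mass 0 - U / V =
  (tail_mass h * (V - tail_mass 0) - tail_mass 0 * (U - tail_mass h)) / (V * tail_mass 0).
  by field; rewrite !gt_eqF.
rewrite normrM normfV (gtr0_norm (mulr_gt0 Vp t0)) ler_pdivrMr ?mulr_gt0//.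
apply: (le_trans (ler_normB _ _)); rewrite !normrM (ger0_norm th) (gtr0_norm t0).
have s1 : tail_mass h * `|V - tail_mass 0| + tail_mass 0 * `|U - tail_mass h| <= eta * c.
  by rewrite /c mulrDr; apply: lerD; rewrite [leRHS]mulrC ler_wpM2l// ltW.
apply: (le_trans s1); apply: (le_trans eta2).
by apply: ler_wpM2l; [exact: ltW|apply: ler_wpM2r => //; exact: ltW].
Qed.

Lemma extremogramE h : extremogram X A h = tail_mass h / tail_mass 0.
Proof. by apply: cvg_lim => //; exact: cond_pr_cvg. Qed.

End Extremogram.

(** * Expectations and covariances of bounded functions *)

Section BoundedExpectation.
Context {dT : measure_display} {T : measurableType dT} {R : realType}.
Variable P : probability T R.
Implicit Types (f g : T -> R).

Definition bounded_mfun f : Prop :=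
  measurable_fun setT f /\ exists M, forall w, `|f w| <= M.

Definition Ex f : R := \int[P]_w f w.

Lemma bounded_mfun_integrable f : bounded_mfun f -> P.-integrable setT (EFin \o f).
Proof.
move=> [mf [M fM]]; apply: measurable_bounded_integrable => //.
  by apply: le_lt_trans (probability_le1 P measurableT) _; rewrite ltry.
exists M; split; first exact: num_real.
by move=> N MN w _ /=; apply: le_trans (fM w) (ltW MN).
Qed.

Lemma bounded_mfun_cst r : bounded_mfun (fun=> r).
Proof. by split=> //; exists `|r|. Qed.

Lemma bounded_mfunD f g : bounded_mfun f -> bounded_mfun g -> bounded_mfun (fun w => f w + g w).
Proof.
move=> [mf [M fM]] [mg [N gN]]; split; first exact: measurable_funD.
by exists (M + N) => w; apply: le_trans (ler_normD _ _) (lerD _ _).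
Qed.

Lemma bounded_mfunM f g : bounded_mfun f -> bounded_mfun g -> bounded_mfun (fun w => f w * g w).
Proof.
move=> [mf [M fM]] [mg [N gN]]; split; first exact: measurable_funM.
by exists (M * N) => w; rewrite normrM ler_pM.
Qed.

Lemma bounded_mfunZ r f : bounded_mfun f -> bounded_mfun (fun w => r * f w).
Proof. by move=> bf; apply: bounded_mfunM => //; exact: bounded_mfun_cst. Qed.

Lemma bounded_mfunB f g : bounded_mfun f -> bounded_mfun g -> bounded_mfun (fun w => f w - g w).
Proof.
move=> bf bg; apply: bounded_mfunD => //.
by under eq_fun do rewrite -mulN1r; exact: bounded_mfunZ.
Qed.

Lemma bounded_mfunX f n : bounded_mfun f -> bounded_mfun (fun w => f w ^+ n).
Proof.
move=> bf; elim: n => [|n IHn]; first exact: bounded_mfun_cst.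
by under eq_fun do rewrite exprS; exact: bounded_mfunM.
Qed.

Lemma bounded_mfun_norm f : bounded_mfun f -> bounded_mfun (fun w => `|f w|).
Proof.
move=> [mf [M fM]]; split; first exact: measurableT_comp.
by exists M => w; rewrite normr_id.
Qed.

Lemma bounded_mfun_sum I (s : seq I) (Q : pred I) (F : I -> T -> R) :
  (forall i, bounded_mfun (F i)) -> bounded_mfun (fun w => \sum_(i <- s | Q i) F i w).
Proof.
move=> bF; elim: s => [|i s IHs].
  by under eq_fun do rewrite big_nil; exact: bounded_mfun_cst.
under eq_fun do rewrite big_cons; case: (Q i) => //; exact: bounded_mfunD.
Qed.

Lemma bounded_mfun_prod I (s : seq I) (F : I -> T -> R) :
  (forall i, bounded_mfun (F i)) -> bounded_mfun (fun w => \prod_(i <- s) F i w).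
Proof.
move=> bF; elim: s => [|i s IHs].
  by under eq_fun do rewrite big_nil; exact: bounded_mfun_cst.
under eq_fun do rewrite big_cons; exact: bounded_mfunM.
Qed.

Lemma bounded_mfun_indic (S : set T) : measurable S -> bounded_mfun (\1_S : T -> R).
Proof.
move=> mS; split; first exact: measurable_indic.
by exists 1 => w; rewrite indicE; case: (_ \in _); rewrite ?normr1 ?normr0.
Qed.

Lemma ExD f g : bounded_mfun f -> bounded_mfun g -> Ex (fun w => f w + g w) = Ex f + Ex g.
Proof. by move=> bf bg; apply: RintegralD => //; exact: bounded_mfun_integrable. Qed.

Lemma ExZ r f : bounded_mfun f -> Ex (fun w => r * f w) = r * Ex f.
Proof. by move=> bf; apply: RintegralZl => //; exact: bounded_mfun_integrable. Qed.

Lemma ExB f g : bounded_mfun f -> bounded_mfun g -> Ex (fun w => f w - g w) = Ex f - Ex g.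
Proof. by move=> bf bg; apply: RintegralB => //; exact: bounded_mfun_integrable. Qed.

Lemma Ex_cst r : Ex (fun=> r) = r.
Proof. by rewrite /Ex Rintegral_cst// [X in fine X](probability_setT P) mulr1. Qed.

Lemma Ex_sum I (s : seq I) (Q : pred I) (F : I -> T -> R) : (forall i, bounded_mfun (F i)) ->
  Ex (fun w => \sum_(i <- s | Q i) F i w) = \sum_(i <- s | Q i) Ex (F i).
Proof.
move=> bF; elim: s => [|i s IHs].
  by under eq_fun do rewrite big_nil; rewrite big_nil Ex_cst.
under eq_fun do rewrite big_cons; rewrite big_cons; case: (Q i) => //.
by rewrite ExD ?IHs//; exact: bounded_mfun_sum.
Qed.

Lemma le_Ex f g : bounded_mfun f -> bounded_mfun g -> (forall w, f w <= g w) -> Ex f <= Ex g.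
Proof. by move=> bf bg fg; apply: le_Rintegral => //; exact: bounded_mfun_integrable. Qed.

Lemma Ex_ge0 f : (forall w, 0 <= f w) -> 0 <= Ex f.
Proof. by move=> f0; exact: Rintegral_ge0. Qed.

Lemma normr_Ex f : bounded_mfun f -> `|Ex f| <= Ex (fun w => `|f w|).
Proof. by move=> bf; apply: le_normr_Rintegral => //; exact: bounded_mfun_integrable. Qed.

Lemma Ex_indic (S : set T) : measurable S -> Ex (\1_S : T -> R) = pr P S.
Proof. by move=> mS; rewrite /Ex /Rintegral integral_indic// setIT. Qed.

Definition cov f g : R := Ex (fun w => f w * g w) - Ex f * Ex g.

Lemma covC f g : cov f g = cov g f.
Proof. by rewrite /cov mulrC; congr (Ex _ - _); apply/funext => w; rewrite mulrC. Qed.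

Lemma cov_subZl f1 f2 g r : bounded_mfun f1 -> bounded_mfun f2 -> bounded_mfun g ->
  cov (fun w => f1 w - r * f2 w) g = cov f1 g - r * cov f2 g.
Proof.
move=> b1 b2 bg; rewrite /cov ExB//; last exact: bounded_mfunZ.
under eq_fun do rewrite mulrBl -mulrA.
rewrite ExB; last 2 first.
- exact: bounded_mfunM.
- by apply: bounded_mfunZ; exact: bounded_mfunM.
rewrite !ExZ//; last exact: bounded_mfunM.
by ring.
Qed.

End BoundedExpectation.

(** * Mixing for products of centred indicators *)

Section HittingEvents.
Context {dT : measure_display} {T : measurableType dT} {R : realType}.
Variables (P : probability T R) (d : nat).
Variable X : int -> {RV P >-> borelType 'rV[R]_d}.
Variable A : set 'rV[\bar R]_d.
Hypothesis mA : (measurable : set (set (borelType 'rV[\bar R]_d))) A.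
Variable c : R.

Definition hit_all (L : seq int) : set T := [set w | forall t, t \in L -> hits X A c t w].

Lemma hit_all_cons t L : hit_all (t :: L) = hits X A c t `&` hit_all L.
Proof.
apply/seteqP; split=> w /=.
  by move=> h; split=> [|u uL]; apply: h; rewrite inE ?eqxx// uL orbT.
by move=> [ht hL] u; rewrite inE => /predU1P[->//|/hL].
Qed.

Lemma hit_all_nil : hit_all [::] = setT.
Proof. by apply/seteqP; split. Qed.

Lemma measurable_hit_all L : measurable (hit_all L).
Proof.
elim: L => [|t L IH]; first by rewrite hit_all_nil.
by rewrite hit_all_cons; apply: measurableI => //; exact: measurable_hits.
Qed.

Lemma hit_all_cat L L' : hit_all (L ++ L') = hit_all L `&` hit_all L'.
Proof.
elim: L => [|t L IH]; first by rewrite hit_all_nil setTI.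
by rewrite cat_cons !hit_all_cons IH setIA.
Qed.

Lemma row_continuous k (i : 'I_k) : continuous (row i : 'M[R]_(k, d) -> 'rV[R]_d).
Proof.
move=> x U /nbhs_ballP[e /= e0 eU]; apply/nbhs_ballP; exists e => //= y [_ xy].
by apply: eU; split=> // a j; rewrite !mxE; exact: xy.
Qed.

(** Stationarity speaks of Borel sets of stacked rows; hitting [A] at all the times of a
list is one of them. *)
Lemma hit_all_shift (u : int) L : strictly_stationary X ->
  P (hit_all [seq t + u | t <- L]) = P (hit_all L).
Proof.
move=> st.
pose ts (i : 'I_(size L)) := nth 0 L i.
pose B : set 'M[R]_(size L, d) := [set x | forall i, A (rescale c (row i x))].
have mB : (measurable : set (set (borelType 'M[R]_(size L, d)))) B.
  have -> : B = \bigcap_(i in [set: 'I_(size L)]) ((rescale c \o row i) @^-1` A).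
    by apply/seteqP; split=> x /= h i; [move=> _; exact: h|exact: h].
  apply: fin_bigcap_measurable => // i _.
  have mr := continuous_measurable (@row_continuous _ i).
  have ms := continuous_measurable (@rescale_continuous R 1 d c).
  by have := measurableT_comp ms mr measurableT mA; rewrite setTI.
have stackE v : stack X (fun i => ts i + v) @^-1` B = hit_all [seq t + v | t <- L].
  apply/seteqP; split=> w /=.
    move=> h t /mapP[t' /(nthP 0)[i iL <-] ->].
    have := h (Ordinal iL); rewrite /hits /= /ts /=.
    by congr (A (rescale c _)); apply/matrixP => a b; rewrite !mxE (ord1 a).
  move=> h i; have tL : ts i + v \in [seq t + v | t <- L].
    by apply: map_f; exact: mem_nth.
  have := h _ tL; rewrite /hits /=.
  by congr (A (rescale c _)); apply/matrixP => a b; rewrite !mxE (ord1 a).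
have := st _ ts u _ mB; rewrite stackE => ->.
have := stackE 0.
have -> : (fun i => ts i + 0) = ts by apply/funext => i; rewrite addr0.
by move=> ->; congr (P (hit_all _)); rewrite -[RHS]map_id; apply: eq_map => t; rewrite addr0.
Qed.

(** The generated sigma-field is closed under the finite intersection over [L]. *)
Lemma sigma_field_hit_all (S : set int) L : (forall t, t \in L -> S t) ->
  sigma_field X S (hit_all L).
Proof.
move=> LS; pose GT := g_sigma_algebraType
  (\bigcup_(s in S) preimage_set_system setT (X s) measurable).
change ((measurable : set (set GT)) (hit_all L)).
elim: L LS => [|t L IH] LS; first by rewrite hit_all_nil; exact: measurableT.
rewrite hit_all_cons; apply: measurableI; last first.
  by apply: IH => u uL; apply: LS; rewrite inE uL orbT.
apply: sub_gen_smallest; exists t; first by apply: LS; rewrite inE eqxx.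
exists (rescale c @^-1` A); last by rewrite setTI.
have ms := continuous_measurable (@rescale_continuous R 1 d c).
by have := ms measurableT _ mA; rewrite setTI.
Qed.

Lemma sigma_field_measurable (S : set int) (C : set T) : sigma_field X S C -> measurable C.
Proof.
move: C; apply: smallest_sub; first exact: sigma_algebra_measurable.
move=> C [s Ss [B mB <-]]; exact: (measurable_funP (X s)).
Qed.

Lemma mixing_rate_bound g (C D : set T) :
  sigma_field X [set s : int | s <= 0] C -> sigma_field X [set s : int | g%:Z <= s] D ->
  `|pr P (C `&` D) - pr P C * pr P D| <= mixing_rate X g.
Proof.
move=> sC sD; apply: ub_le_sup; last by exists C, D.
exists 1 => _ [C' [D' [/sigma_field_measurable mC /sigma_field_measurable mD ->]]].
have mI := measurableI _ _ mC mD.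
have := pr_ge0 P (C' `&` D'); have := pr_le1 P mI.
have : 0 <= pr P C' * pr P D' by rewrite mulr_ge0// pr_ge0.
have : pr P C' * pr P D' <= 1 by rewrite mulr_ile1// ?pr_ge0// pr_le1.
by move=> *; rewrite ler_norml; apply/andP; split; lra.
Qed.

Lemma mixing_rate_ge0 g : 0 <= mixing_rate X g.
Proof.
have s0 (S : set int) : sigma_field X S set0.
  exact: (@measurable0 _ (g_sigma_algebraType
    (\bigcup_(s in S) preimage_set_system setT (X s) measurable))).
exact: le_trans (normr_ge0 _) (mixing_rate_bound (s0 _) (s0 _)).
Qed.

Hypothesis stat : strictly_stationary X.

(** A shift by [- v] brings one event into the past of 0 and the other beyond [g], where
the mixing rate is defined. *)
Lemma cov_hit_all (v : int) g L L' : (forall t, t \in L -> t <= v) ->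
  (forall t, t \in L' -> v + g%:Z <= t) ->
  `|cov P (\1_(hit_all L)) (\1_(hit_all L'))| <= mixing_rate X g.
Proof.
move=> Lv L'v.
have E M : Ex P (\1_(hit_all M)) = pr P (hit_all [seq t - v | t <- M]).
  by rewrite Ex_indic; [rewrite /pr hit_all_shift|exact: measurable_hit_all].
have -> : cov P (\1_(hit_all L)) (\1_(hit_all L')) =
   Ex P (\1_(hit_all (L ++ L'))) - Ex P (\1_(hit_all L)) * Ex P (\1_(hit_all L')).
  by rewrite /cov hit_all_cat indicI.
rewrite !E map_cat hit_all_cat; apply: mixing_rate_bound.
  apply: sigma_field_hit_all => _ /mapP[t tL ->] /=; rewrite subr_le0; exact: Lv.
apply: sigma_field_hit_all => _ /mapP[t tL ->] /=; rewrite lerBrDl; exact: L'v.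
Qed.

Definition centered_hit (t : int) (w : T) : R := \1_(hits X A c t) w - pr P (hits X A c 0).

(** Keeping plain indicators as well makes the class stable under the expansion of one
centred factor, which is the induction step of [cov_mixed_prod]. *)
Definition mixed_prod (K L : seq int) (w : T) : R := \prod_(t <- K) centered_hit t w * \1_(hit_all L) w.

Lemma bounded_indic_hits t : bounded_mfun (\1_(hits X A c t) : T -> R).
Proof. by apply: bounded_mfun_indic; exact: measurable_hits. Qed.

Lemma bounded_centered_hit t : bounded_mfun (centered_hit t).
Proof. by apply: bounded_mfunB; [exact: bounded_indic_hits|exact: bounded_mfun_cst]. Qed.

Lemma bounded_mixed_prod K L : bounded_mfun (mixed_prod K L).
Proof.
apply: bounded_mfunM; first by apply: bounded_mfun_prod; exact: bounded_centered_hit.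
by apply: bounded_mfun_indic; exact: measurable_hit_all.
Qed.

Lemma mixed_prod_cons t K L :
  mixed_prod (t :: K) L = (fun w => mixed_prod K (t :: L) w - pr P (hits X A c 0) * mixed_prod K L w).
Proof.
apply/funext => w; rewrite /mixed_prod big_cons hit_all_cons indicI /centered_hit /=; ring.
Qed.

(** Each centred factor is a difference of two terms with coefficients at most 1, so its
expansion doubles the bound valid for plain indicators. *)
Lemma cov_mixed_prod (v : int) g K L K' L' : (forall t, t \in K ++ L -> t <= v) ->
  (forall t, t \in K' ++ L' -> v + g%:Z <= t) ->
  `|cov P (mixed_prod K L) (mixed_prod K' L')| <= 2 ^+ (size K + size K') * mixing_rate X g.
Proof.
have p0 : 0 <= pr P (hits X A c 0) by exact: pr_ge0.
have p1 : pr P (hits X A c 0) <= 1 by apply: pr_le1; exact: measurable_hits.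
have step n (x y : R) : `|x| <= 2 ^+ n * mixing_rate X g -> `|y| <= 2 ^+ n * mixing_rate X g ->
    `|x - pr P (hits X A c 0) * y| <= 2 ^+ n.+1 * mixing_rate X g.
  move=> hx hy; apply: (le_trans (ler_normB _ _)).
  rewrite exprS -mulrA mulr_natl mulr2n; apply: lerD => //.
  by rewrite normrM (ger0_norm p0); apply: le_trans hy; rewrite ler_piMl.
elim: K L => [|t K IH] L hL hL'; last first.
  rewrite mixed_prod_cons cov_subZl; try exact: bounded_mixed_prod.
  rewrite addSn; apply: step; apply: IH => // u.
    by rewrite mem_cat inE orbCA -mem_cat => uL; apply: hL; rewrite inE.
  by move=> uL; apply: hL; rewrite inE uL orbT.
rewrite add0n; elim: K' L' hL' => [|t K' IH] L' hL'; last first.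
  rewrite covC mixed_prod_cons cov_subZl; try exact: bounded_mixed_prod.
  rewrite ![cov P _ (mixed_prod [::] L)]covC; apply: step; apply: IH => // u.
    by rewrite mem_cat inE orbCA -mem_cat => uL; apply: hL'; rewrite inE.
  by move=> uL; apply: hL'; rewrite inE uL orbT.
rewrite expr0 mul1r.
have Z0 M : mixed_prod [::] M = \1_(hit_all M) by apply/funext => w; rewrite /mixed_prod big_nil mul1r.
by rewrite !Z0; exact: (@cov_hit_all v).
Qed.

End HittingEvents.

(** * Sums over time lags *)

Section LagSums.
Context {R : realType}.
Implicit Types (g : nat -> R) (n s t h : nat).

Definition lag s t : nat := (s - t + (t - s))%N.

Lemma lagC s t : lag s t = lag t s. Proof. by rewrite /lag addnC. Qed.
Lemma lagss s : lag s s = 0%N. Proof. by rewrite /lag subnn. Qed.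

(** Adjacent transpositions suffice to sort: insertion sort. *)
Lemma wlog_sorted4 (Pr : nat -> nat -> nat -> nat -> Prop) :
  (forall s t u v, Pr s t u v -> Pr t s u v) ->
  (forall s t u v, Pr s t u v -> Pr s u t v) ->
  (forall s t u v, Pr s t u v -> Pr s t v u) ->
  (forall s t u v, (s <= t)%N -> (t <= u)%N -> (u <= v)%N -> Pr s t u v) ->
  forall s t u v, Pr s t u v.
Proof.
move=> sw1 sw2 sw3 srt.
have ins1 s t u v : (t <= u)%N -> (u <= v)%N -> Pr s t u v.
  move=> tu uv; have [st|/ltnW ts] := leqP s t; first exact: srt.
  apply: sw1; have [su|/ltnW us] := leqP s u; first exact: srt.
  apply: sw2; have [sv|/ltnW vs] := leqP s v; first exact: srt.
  by apply: sw3; exact: srt.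
have ins2 s t u v : (u <= v)%N -> Pr s t u v.
  move=> uv; have [tu|/ltnW ut] := leqP t u; first exact: ins1.
  apply: sw2; have [tv|/ltnW vt] := leqP t v; first exact: ins1.
  by apply: sw3; exact: ins1.
move=> s t u v; have [uv|/ltnW vu] := leqP u v; first exact: ins2.
by apply: sw3; exact: ins2.
Qed.

(** Each lag h >= 1 occurs at most twice, once on each side of [s]. *)
Lemma sum_lag_row g n s : (forall h, 0 <= g h) -> (1 <= s <= n)%N ->
  \sum_(1 <= t < n.+1) g (lag s t) <= g 0%N + (\sum_(1 <= h < n) g h) *+ 2.
Proof.
move=> g0 /andP[s1 sn].
have mono m : (m <= n)%N -> \sum_(1 <= h < m) g h <= \sum_(1 <= h < n) g h.
  move=> mn; case: m mn => [|m] mn; first by rewrite big_geq// sumr_ge0.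
  by rewrite (big_cat_nat _ mn)//= lerDl sumr_ge0.
rewrite (@big_cat_nat _ _ _ s)//=; last exact: leqW.
rewrite [X in _ + X]big_ltn ?ltnS// lagss addrCA lerD2l mulr2n; apply: lerD.
  apply: le_trans (mono s sn); rewrite big_nat_rev /=.
  by rewrite le_eqVlt; apply/orP; left; apply/eqP; apply: eq_big_nat => h hs; congr g; rewrite /lag; lia.
rewrite -add1n big_addn; apply: le_trans (mono (n.+1 - s)%N _); last by lia.
by rewrite le_eqVlt; apply/orP; left; apply/eqP; apply: eq_big_nat => h hs; congr g; rewrite /lag; lia.
Qed.

(** Lag h occurs n - h times on each side of the diagonal. *)
Lemma sum_lag_square g n : \sum_(1 <= s < n.+1) \sum_(1 <= t < n.+1) g (lag s t) =
  n%:R * g 0%N + (\sum_(1 <= h < n) (n%:R - h%:R) * g h) *+ 2.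
Proof.
elim: n => [|n IH]; first by rewrite !big_geq// mul0r mul0rn addr0.
rewrite big_nat_recr//= [X in _ + X]big_nat_recr//= lagss.
under eq_big_nat do rewrite big_nat_recr//=.
rewrite big_split /= IH.
have rowE : \sum_(1 <= i < n.+1) g (lag i n.+1) = \sum_(1 <= h < n.+1) g h.
  by rewrite big_nat_rev /=; apply: eq_big_nat => h hn; congr g; rewrite /lag; lia.
have -> : \sum_(1 <= i < n.+1) g (lag n.+1 i) = \sum_(1 <= h < n.+1) g h.
  by rewrite -rowE; apply: eq_bigr => i _; rewrite lagC.
rewrite rowE.
have -> : \sum_(1 <= h < n.+1) (n.+1%:R - h%:R) * g h =
    \sum_(1 <= h < n) (n%:R - h%:R) * g h + \sum_(1 <= h < n.+1) g h.
  have -> : \sum_(1 <= h < n) (n%:R - h%:R) * g h = \sum_(1 <= h < n.+1) (n%:R - h%:R) * g h.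
    case: n {IH rowE} => [|n]; first by rewrite !big_geq.
    by rewrite [RHS]big_nat_recr//= subrr mul0r addr0.
  by rewrite -big_split /=; apply: eq_bigr => h _; rewrite -natr1; ring.
by rewrite -natr1 !mulr2n; ring.
Qed.

End LagSums.

(** * Covariances and fourth cumulants *)

Section FourthMoments.
Context {dT : measure_display} {T : measurableType dT} {R : realType}.
Variables (P : probability T R) (d : nat).
Variable X : int -> {RV P >-> borelType 'rV[R]_d}.
Variable A : set 'rV[\bar R]_d.
Hypothesis mA : (measurable : set (set (borelType 'rV[\bar R]_d))) A.
Hypothesis stat : strictly_stationary X.
Variable c : R.

Let p : R := pr P (hits X A c 0).
Let J (t : nat) (w : T) : R := centered_hit X A c t%:Z w.

Definition acov h : R := pr P (hit_all X A c [:: h%:Z; 0]) - p ^+ 2.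

Lemma hit_prob_ge0 : 0 <= p. Proof. exact: pr_ge0. Qed.
Lemma hit_prob_le1 : p <= 1. Proof. by apply: pr_le1; exact: measurable_hits. Qed.

Lemma hit_all1 t : hit_all X A c [:: t] = hits X A c t.
Proof. by rewrite hit_all_cons hit_all_nil setIT. Qed.

Lemma pr_hits t : pr P (hits X A c t) = p.
Proof.
have := @hit_all_shift _ _ _ _ _ X _ mA c t [:: 0] stat.
by rewrite /= add0r !hit_all1 /p /pr => ->.
Qed.

Lemma bounded_J t : bounded_mfun (J t). Proof. exact: bounded_centered_hit. Qed.

Lemma Ex_J t : Ex P (J t) = 0.
Proof.
rewrite /J /centered_hit ExB; last exact: bounded_mfun_cst.
  by rewrite Ex_indic ?pr_hits ?Ex_cst ?subrr//; exact: measurable_hits.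
exact: bounded_indic_hits.
Qed.

Lemma normJ_le1 t w : `|J t w| <= 1.
Proof.
have p0 := hit_prob_ge0; have p1 := hit_prob_le1.
rewrite /J /centered_hit -/p indicE ler_norml; case: (_ \in _) => /=; apply/andP; split; lra.
Qed.

Lemma Ex_JJ s t : Ex P (fun w => J s w * J t w) = acov (lag s t).
Proof.
wlog st : s t / (s <= t)%N.
  move=> h; have [/h//|/ltnW/h ts] := leqP s t.
  by rewrite lagC -ts; congr Ex; apply/funext => w; rewrite mulrC.
have mh u := @measurable_hits _ _ _ _ _ X A c u mA.
have bh u := @bounded_indic_hits _ _ _ _ _ X A mA c u.
have -> : (fun w => J s w * J t w) = (fun w => (\1_(hit_all X A c [:: t%:Z; s%:Z]) w -
    p * \1_(hits X A c s%:Z) w) - p * J t w).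
  apply/funext => w; rewrite !hit_all_cons hit_all_nil setIT indicI /J /centered_hit -/p /=; ring.
rewrite ExB; last 2 first.
- apply: bounded_mfunB; last exact: bounded_mfunZ.
  by apply: bounded_mfun_indic; exact: measurable_hit_all.
- by apply: bounded_mfunZ; exact: bounded_J.
rewrite ExB; last 2 first.
- by apply: bounded_mfun_indic; exact: measurable_hit_all.
- exact: bounded_mfunZ.
rewrite !ExZ ?Ex_J ?mulr0 ?subr0//; last exact: bounded_J.
rewrite !Ex_indic//; last exact: measurable_hit_all.
rewrite pr_hits -expr2 /acov; congr (_ - _).
have := @hit_all_shift _ _ _ _ _ X _ mA c s%:Z [:: (lag s t)%:Z; 0] stat.
rewrite /= add0r (_ : (lag s t)%:Z + s%:Z = t%:Z) ?/pr; last by rewrite /lag; lia.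
by rewrite /pr => ->.
Qed.

Lemma acov_le_hit_prob h : `|acov h| <= p.
Proof.
have p0 := hit_prob_ge0; have p1 := hit_prob_le1.
rewrite /acov; have := pr_ge0 P (hit_all X A c [:: h%:Z; 0]).
have : pr P (hit_all X A c [:: h%:Z; 0]) <= p.
  rewrite hit_all_cons hit_all1; apply: le_pr.
  - by apply: measurableI; exact: measurable_hits.
  - exact: measurable_hits.
  - by move=> w [].
have : p ^+ 2 <= p by rewrite expr2 ler_piMl.
have : 0 <= p ^+ 2 by exact: sqr_ge0.
by move=> *; rewrite ler_norml; apply/andP; split; lra.
Qed.

Lemma acov_le_joint h : `|acov h| <= pr P (hits X A c h%:Z `&` hits X A c 0) + p ^+ 2.
Proof.
rewrite /acov hit_all_cons hit_all1; apply: (le_trans (ler_normB _ _)).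
by rewrite ger0_norm ?pr_ge0// lerD2l ger0_norm// sqr_ge0.
Qed.

Lemma mixed_prod_J (K : seq nat) : mixed_prod X A c [seq t%:Z | t <- K] [::] =
  (fun w => \prod_(t <- K) J t w).
Proof. by apply/funext => w; rewrite /mixed_prod hit_all_nil indicT mulr1 big_map. Qed.

Lemma cov_prodJ (v g : nat) (K K' : seq nat) :
  (forall t, t \in K -> (t <= v)%N) -> (forall t, t \in K' -> (v + g <= t)%N) ->
  `|cov P (fun w => \prod_(t <- K) J t w) (fun w => \prod_(t <- K') J t w)| <=
  2 ^+ (size K + size K') * mixing_rate X g.
Proof.
move=> hK hK'; rewrite -!mixed_prod_J.
have := @cov_mixed_prod _ _ _ _ _ X A mA c stat v%:Z g [seq t%:Z | t <- K] [::] [seq t%:Z | t <- K'] [::].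
rewrite !size_map !cats0; apply.
- by move=> _ /mapP[t tK ->]; rewrite lez_nat; exact: hK.
- by move=> _ /mapP[t tK ->]; rewrite -PoszD lez_nat; exact: hK'.
Qed.

(** The factor 4 = 2^2 comes from the two centred factors. *)
Lemma mixing_acov_le g h : (g <= h)%N -> `|acov h| <= 4 * mixing_rate X g.
Proof.
move=> gh; have := @cov_prodJ 0 g [:: 0%N] [:: h] _ _.
have h1 : forall t, t \in [:: 0%N] -> (t <= 0)%N by move=> t; rewrite inE => /eqP ->.
have h2 : forall t, t \in [:: h] -> (0 + g <= t)%N by move=> t; rewrite inE => /eqP ->.
move=> /(_ h1 h2).
have J1 t : (fun w => \prod_(u <- [:: t]) J u w) = J t.
  by apply/funext => w; rewrite big_seq1.
rewrite !J1 /cov !Ex_J mulr0 subr0 Ex_JJ (_ : lag 0 h = h) /=; last by rewrite /lag; lia.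
by rewrite (_ : 2 ^+ 2 = 4 :> R)//; ring.
Qed.

Definition moment4 s t u v : R := Ex P (fun w => J s w * J t w * (J u w * J v w)).

(** The variables being centred, removing the three products of covariances from the
fourth moment leaves the joint cumulant, which is small as soon as one of the times
is far from the others or the times split into two distant pairs. *)
Definition cumulant s t u v : R := moment4 s t u v
  - acov (lag s t) * acov (lag u v)
  - acov (lag s u) * acov (lag t v)
  - acov (lag s v) * acov (lag t u).

(** The mixing rate, cut to lags above [r]: summing it over all pairs of times is then
harmless, and no largest gap has to be singled out. *)
Definition far_mixing (r h : nat) : R := if (r < h)%N then mixing_rate X h else 0.
Definition close_lag (r h : nat) : bool := (h <= 3 * r)%N.

Lemma far_mixing_ge0 r h : 0 <= far_mixing r h.
Proof. by rewrite /far_mixing; case: ifP => // _; exact: mixing_rate_ge0. Qed.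

(** By symmetry the times may be taken in increasing order.  If a gap exceeds [r], split
the four factors there.  When the gap isolates one time, its factor has mean 0, and
the moment as well as the three products of covariances are controlled by mixing
across the gap: 16 + 3 * 4 = 28.  When it separates two pairs, the moment minus the
product of the covariances within the pairs is such a covariance, and the other two
products straddle the gap.  If no gap exceeds [r], all lags are at most 3 r, and one
factor bounded in mean by 2 p, plus three products at most p, gives 5 p. *)
Lemma cumulant_bound r s t u v : `|cumulant s t u v| <=
  28 * (far_mixing r (lag s t) + far_mixing r (lag u v) + far_mixing r (lag s u) + far_mixing r (lag t v) +
        far_mixing r (lag s v) + far_mixing r (lag t u)) +
  5 * p * [&& close_lag r (lag s t), close_lag r (lag s u), close_lag r (lag s v),
     close_lag r (lag t u), close_lag r (lag t v) & close_lag r (lag u v)]%:R.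
Proof.
have p0 := hit_prob_ge0; have p1 := hit_prob_le1.
move: s t u v; apply: wlog_sorted4 => s t u v.
- rewrite /cumulant (_ : moment4 t s u v = moment4 s t u v); last first.
    by congr Ex; apply/funext => w; ring.
  rewrite (lagC t s) => H; rewrite [X in `|X|](_ : _ = moment4 s t u v
    - acov (lag s t) * acov (lag u v)
    - acov (lag s u) * acov (lag t v)
    - acov (lag s v) * acov (lag t u)); last by ring.
  apply: (le_trans H); rewrite le_eqVlt; apply/orP; left; apply/eqP.
  congr (28 * _ + _ * (nat_of_bool _)%:R); first by ring.
  by do 6 case: (close_lag r _).
- rewrite /cumulant (_ : moment4 s u t v = moment4 s t u v); last first.
    by congr Ex; apply/funext => w; ring.
  rewrite (lagC u t) => H; rewrite [X in `|X|](_ : _ = moment4 s t u v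
    - acov (lag s t) * acov (lag u v)
    - acov (lag s u) * acov (lag t v)
    - acov (lag s v) * acov (lag t u)); last by ring.
  apply: (le_trans H); rewrite le_eqVlt; apply/orP; left; apply/eqP.
  congr (28 * _ + _ * (nat_of_bool _)%:R); first by ring.
  by do 6 case: (close_lag r _).
- rewrite /cumulant (_ : moment4 s t v u = moment4 s t u v); last first.
    by congr Ex; apply/funext => w; ring.
  rewrite (lagC v u) => H; rewrite [X in `|X|](_ : _ = moment4 s t u v
    - acov (lag s t) * acov (lag u v)
    - acov (lag s u) * acov (lag t v)
    - acov (lag s v) * acov (lag t u)); last by ring.
  apply: (le_trans H); rewrite le_eqVlt; apply/orP; left; apply/eqP.
  congr (28 * _ + _ * (nat_of_bool _)%:R); first by ring.
  by do 6 case: (close_lag r _).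
move=> st tu uv.
have f0 h : 0 <= far_mixing r h by exact: far_mixing_ge0.
have near0 : 0 <= 5 * p * [&& close_lag r (lag s t), close_lag r (lag s u), close_lag r (lag s v),
     close_lag r (lag t u), close_lag r (lag t v) & close_lag r (lag u v)]%:R by rewrite !mulr_ge0.
have a1 h : `|acov h| <= 1 by exact: le_trans (acov_le_hit_prob h) p1.
have tri (m x y z : R) : `|m - x - y - z| <= `|m| + `|x| + `|y| + `|z|.
  by do 2 (apply: le_trans (ler_normB _ _) _; rewrite lerD2r); exact: ler_normB.
have aa (x h h' : _) : `|acov h| <= x -> `|acov h * acov h'| <= x.
  by move=> hx; rewrite normrM; apply: le_trans hx; rewrite ler_piMr.
have mix0 g := mixing_rate_ge0 X g.
have J1 x : (fun w => \prod_(u <- [:: x]) J u w) = J x.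
  by apply/funext => w; rewrite big_seq1.
have J2 x y : (fun w => \prod_(u <- [:: x; y]) J u w) = (fun w => J x w * J y w).
  by apply/funext => w; rewrite big_cons big_seq1.
have J3 x y z : (fun w => \prod_(u <- [:: x; y; z]) J u w) = (fun w => J x w * (J y w * J z w)).
  by apply/funext => w; rewrite !big_cons big_nil mulr1.
have M4 : moment4 s t u v = Ex P (fun w => J s w * (J t w * (J u w * J v w))).
  by congr Ex; apply/funext => w; rewrite !mulrA.
have M4' : moment4 s t u v = Ex P (fun w => J s w * (J t w * J u w) * J v w).
  by congr Ex; apply/funext => w; rewrite !mulrA.
have e16 : 2 ^+ 4 = 16 :> R by rewrite -natrX.
have final g : (r < g)%N -> `|cumulant s t u v| <= 28 * mixing_rate X g ->
    far_mixing r g \in [:: far_mixing r (lag s t); far_mixing r (lag t u); far_mixing r (lag u v)] ->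
    `|cumulant s t u v| <=
  28 * (far_mixing r (lag s t) + far_mixing r (lag u v) + far_mixing r (lag s u) + far_mixing r (lag t v) +
        far_mixing r (lag s v) + far_mixing r (lag t u)) +
  5 * p * [&& close_lag r (lag s t), close_lag r (lag s u), close_lag r (lag s v),
     close_lag r (lag t u), close_lag r (lag t v) & close_lag r (lag u v)]%:R.
  move=> rg /le_trans Q mem; apply: Q; rewrite -[leLHS]addr0; apply: lerD => //.
  apply: ler_wpM2l => //.
  have : far_mixing r g = mixing_rate X g by rewrite /far_mixing rg.
  have := f0 (lag s t); have := f0 (lag u v); have := f0 (lag s u); have := f0 (lag t v).
  have := f0 (lag s v); have := f0 (lag t u).
  by move: mem; rewrite !inE => /or3P[] /eqP ->; lra.
have [tsr|str] := ltnP r (t - s).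
  apply: (final _ tsr); last by rewrite (_ : lag s t = (t - s)%N) ?inE ?eqxx// /lag; lia.
  set g := (t - s)%N.
  have E : `|moment4 s t u v| <= 16 * mixing_rate X g.
    rewrite M4 -e16.
    have := @cov_prodJ s g [:: s] [:: t; u; v]; rewrite J1 J3 /cov Ex_J mul0r subr0; apply.
      by move=> x; rewrite inE => /eqP ->.
    by move=> x; rewrite !inE /g => /or3P[] /eqP ->; lia.
  have c1 : `|acov (lag s t) * acov (lag u v)| <= 4 * mixing_rate X g.
    by apply/aa/mixing_acov_le; rewrite /lag /g; lia.
  have c2 : `|acov (lag s u) * acov (lag t v)| <= 4 * mixing_rate X g.
    by apply/aa/mixing_acov_le; rewrite /lag /g; lia.
  have c3 : `|acov (lag s v) * acov (lag t u)| <= 4 * mixing_rate X g.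
    by apply/aa/mixing_acov_le; rewrite /lag /g; lia.
  by apply: (le_trans (tri _ _ _ _)); lra.
have [vur|ruv] := ltnP r (v - u).
  apply: (final _ vur); last by rewrite (_ : lag u v = (v - u)%N) ?inE ?eqxx ?orbT// /lag; lia.
  set g := (v - u)%N.
  have E : `|moment4 s t u v| <= 16 * mixing_rate X g.
    rewrite M4' -e16.
    have := @cov_prodJ u g [:: s; t; u] [:: v]; rewrite J1 J3 /cov Ex_J mulr0 subr0; apply.
      by move=> x; rewrite !inE => /or3P[] /eqP ->; lia.
    by move=> x; rewrite inE /g => /eqP ->; lia.
  have c1 : `|acov (lag s t) * acov (lag u v)| <= 4 * mixing_rate X g.
    by rewrite mulrC; apply/aa/mixing_acov_le; rewrite /lag /g; lia.
  have c2 : `|acov (lag s u) * acov (lag t v)| <= 4 * mixing_rate X g.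
    by rewrite mulrC; apply/aa/mixing_acov_le; rewrite /lag /g; lia.
  have c3 : `|acov (lag s v) * acov (lag t u)| <= 4 * mixing_rate X g.
    by apply/aa/mixing_acov_le; rewrite /lag /g; lia.
  by apply: (le_trans (tri _ _ _ _)); lra.
have [utr|rtu] := ltnP r (u - t).
  apply: (final _ utr); last by rewrite (_ : lag t u = (u - t)%N) ?inE ?eqxx ?orbT// /lag; lia.
  set g := (u - t)%N.
  have E : `|moment4 s t u v - acov (lag s t) * acov (lag u v)| <= 16 * mixing_rate X g.
    rewrite -e16 -!Ex_JJ.
    have := @cov_prodJ t g [:: s; t] [:: u; v]; rewrite !J2; apply.
      by move=> x; rewrite !inE => /orP[] /eqP ->; lia.
    by move=> x; rewrite !inE /g => /orP[] /eqP ->; lia.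
  have c2 : `|acov (lag s u) * acov (lag t v)| <= 4 * mixing_rate X g.
    by apply/aa/mixing_acov_le; rewrite /lag /g; lia.
  have c3 : `|acov (lag s v) * acov (lag t u)| <= 4 * mixing_rate X g.
    by apply/aa/mixing_acov_le; rewrite /lag /g; lia.
  rewrite /cumulant; apply: (le_trans (ler_normB _ _)).
  apply: (le_trans (lerD (ler_normB _ _) (lexx _))).
  have := mix0 g; lra.
have -> : [&& close_lag r (lag s t), close_lag r (lag s u), close_lag r (lag s v),
     close_lag r (lag t u), close_lag r (lag t v) & close_lag r (lag u v)].
  by rewrite /close_lag /lag; apply/and5P; split; [| | | |apply/andP; split]; lia.
rewrite mulr1 -[leLHS]add0r; apply: lerD.
  by rewrite mulr_ge0// !addr_ge0.
have E : `|moment4 s t u v| <= 2 * p.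
  have J' w : `|J s w * (J t w * (J u w * J v w))| <= \1_(hits X A c s%:Z) w + p.
    rewrite normrM; apply: (@le_trans _ _ `|J s w|).
      by rewrite ler_piMr// !normrM !mulr_ile1// ?mulr_ge0 ?normJ_le1// mulr_ile1 ?normJ_le1.
    apply: (le_trans (ler_normB _ _)); rewrite (ger0_norm p0) lerD2r.
    by rewrite ger0_norm// indicE.
  rewrite M4; apply: (le_trans (normr_Ex _ _)).
    by do 3 (apply: bounded_mfunM; first exact: bounded_J); exact: bounded_J.
  apply: (@le_trans _ _ (Ex P (fun w => \1_(hits X A c s%:Z) w + p))).
    apply: le_Ex => //.
      apply: bounded_mfun_norm.
      by do 3 (apply: bounded_mfunM; first exact: bounded_J); exact: bounded_J.
    by apply: bounded_mfunD; [exact: bounded_indic_hits|exact: bounded_mfun_cst].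
  rewrite ExD; [|exact: bounded_indic_hits|exact: bounded_mfun_cst].
  by rewrite Ex_cst Ex_indic ?pr_hits; [lra|exact: measurable_hits].
have cp h h' : `|acov h * acov h'| <= p by apply/aa/acov_le_hit_prob.
apply: (le_trans (tri _ _ _ _)).
have := cp (lag s t) (lag u v); have := cp (lag s u) (lag t v); have := cp (lag s v) (lag t u).
lra.
Qed.

End FourthMoments.

(** * Variance of quadratic forms *)

Section QuadraticForms.
Context {dT : measure_display} {T : measurableType dT} {R : realType}.
Variables (P : probability T R) (d : nat).
Variable X : int -> {RV P >-> borelType 'rV[R]_d}.
Variable A : set 'rV[\bar R]_d.
Hypothesis mA : (measurable : set (set (borelType 'rV[\bar R]_d))) A.
Hypothesis stat : strictly_stationary X.
Variables (c : R) (n : nat).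

Local Notation p := (pr P (hits X A c 0)).
Local Notation J := (fun (t : nat) (w : T) => centered_hit X A c t%:Z w).
Local Notation acov := (acov X A c).
Local Notation kappa4 := (cumulant X A c).
Local Notation "\S_ s F" := (\sum_(1 <= s < n.+1) F) (at level 41, s name, F at level 41).

Definition qform (W : nat -> nat -> R) (w : T) : R :=
  \S_ s \S_ t (W s t * (J s w * J t w)).

Lemma mul_sum2 (F G : nat -> nat -> R) :
  (\S_ s \S_ t F s t) * (\S_ u \S_ v G u v) = \S_ s \S_ t \S_ u \S_ v (F s t * G u v).
Proof.
rewrite mulr_suml; apply: eq_bigr => s _; rewrite mulr_suml; apply: eq_bigr => t _.
by rewrite mulr_sumr; apply: eq_bigr => u _; rewrite mulr_sumr.
Qed.

Lemma bounded_JJ s t : bounded_mfun (fun w => J s w * J t w).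
Proof. by apply: bounded_mfunM; exact: bounded_centered_hit. Qed.

Lemma bounded_qform W : bounded_mfun (qform W).
Proof.
by apply: bounded_mfun_sum => s; apply: bounded_mfun_sum => t; apply: bounded_mfunZ; exact: bounded_JJ.
Qed.

Lemma Ex_qform W : Ex P (qform W) = \S_ s \S_ t (W s t * acov (lag s t)).
Proof.
rewrite Ex_sum; last by move=> s; apply: bounded_mfun_sum => t; apply: bounded_mfunZ; exact: bounded_JJ.
apply: eq_bigr => s _; rewrite Ex_sum; last by move=> t; apply: bounded_mfunZ; exact: bounded_JJ.
by apply: eq_bigr => t _; rewrite ExZ; [rewrite Ex_JJ|exact: bounded_JJ].
Qed.

Lemma Ex_qform_sqr W : Ex P (fun w => qform W w * qform W w) =
  \S_ s \S_ t \S_ u \S_ v (W s t * W u v * moment4 X A c s t u v).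
Proof.
have E w : qform W w * qform W w =
    \S_ s \S_ t \S_ u \S_ v (W s t * W u v * (J s w * J t w * (J u w * J v w))).
  rewrite /qform mul_sum2; do 4 (apply: eq_bigr => ? _); ring.
under eq_fun do rewrite E.
have b4 s t u v : bounded_mfun (fun w => J s w * J t w * (J u w * J v w)).
  by apply: bounded_mfunM; exact: bounded_JJ.
rewrite Ex_sum; last by move=> s; do 3 (apply: bounded_mfun_sum => ?); exact: bounded_mfunZ.
apply: eq_bigr => s _; rewrite Ex_sum; last by move=> t; do 2 (apply: bounded_mfun_sum => ?); exact: bounded_mfunZ.
apply: eq_bigr => t _; rewrite Ex_sum; last by move=> u; apply: bounded_mfun_sum => ?; exact: bounded_mfunZ.
apply: eq_bigr => u _; rewrite Ex_sum; last by move=> v; exact: bounded_mfunZ.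
by apply: eq_bigr => v _; rewrite ExZ.
Qed.

Lemma Ex_sqr_center (f : T -> R) : bounded_mfun f ->
  Ex P (fun w => (f w - Ex P f) ^+ 2) = Ex P (fun w => f w * f w) - Ex P f * Ex P f.
Proof.
move=> bf; set e := Ex P f.
have sq w : (f w - e) ^+ 2 = f w * f w - (2 * e) * f w + e * e by ring.
under eq_fun do rewrite sq.
have bff : bounded_mfun (fun w => f w * f w) by exact: bounded_mfunM.
have b1 := bounded_mfunZ (2 * e) bf; have b2 := bounded_mfunB bff b1.
have b3 : bounded_mfun (fun _ : T => e * e) by exact: bounded_mfun_cst.
by rewrite ExD// ExB// ExZ// Ex_cst -/e; ring.
Qed.

Lemma Ex_affine_sqr (f : T -> R) (q x : R) : bounded_mfun f ->
  Ex P (fun w => (q * f w - x) ^+ 2) =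
  q ^+ 2 * Ex P (fun w => (f w - Ex P f) ^+ 2) + (q * Ex P f - x) ^+ 2.
Proof.
move=> bf; rewrite Ex_sqr_center//; set e := Ex P f.
have sq w : (q * f w - x) ^+ 2 = (q ^+ 2 * (f w * f w) - (2 * q * x) * f w) + x ^+ 2 by ring.
under eq_fun do rewrite sq.
have b0 := bounded_mfunM bf bf.
have b1 := bounded_mfunZ (q ^+ 2) b0; have b2 := bounded_mfunZ (2 * q * x) bf.
have b3 := bounded_mfunB b1 b2.
have b4 : bounded_mfun (fun _ : T => x ^+ 2) by exact: bounded_mfun_cst.
by rewrite ExD// Ex_cst ExB// !ExZ// -/e; ring.
Qed.

Definition acov_mass : R := `|acov 0| + (\sum_(1 <= h < n) `|acov h|) *+ 2.

Lemma sum_acov_row s : (1 <= s < n.+1)%N -> \S_ t `|acov (lag s t)| <= acov_mass.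
Proof. by move=> sn; apply: (@sum_lag_row R (fun h => `|acov h|)) sn => h; exact: normr_ge0. Qed.

Lemma acov_mass_ge0 : 0 <= acov_mass.
Proof. by rewrite addr_ge0// mulrn_wge0// sumr_ge0. Qed.

Lemma gaussian_part (W : nat -> nat -> R) :
  \S_ s \S_ t \S_ u \S_ v (W s t ^+ 2 * (`|acov (lag s u)| * `|acov (lag t v)|)) <=
  acov_mass ^+ 2 * \S_ s \S_ t W s t ^+ 2.
Proof.
rewrite mulr_sumr; apply: ler_sum_nat => s sn; rewrite mulr_sumr; apply: ler_sum_nat => t tn.
have -> : \S_ u \S_ v (W s t ^+ 2 * (`|acov (lag s u)| * `|acov (lag t v)|)) =
    W s t ^+ 2 * ((\S_ u `|acov (lag s u)|) * (\S_ v `|acov (lag t v)|)).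
  rewrite mulr_suml mulr_sumr; apply: eq_bigr => u _.
  by rewrite mulr_sumr mulr_sumr.
rewrite mulrC; apply: ler_wpM2r; first exact: sqr_ge0.
by rewrite expr2; apply: ler_pM; rewrite ?sumr_ge0//; exact: sum_acov_row.
Qed.

Lemma ler_sum4 (F G : nat -> nat -> nat -> nat -> R) :
  (forall s t u v, F s t u v <= G s t u v) ->
  \S_ s \S_ t \S_ u \S_ v F s t u v <= \S_ s \S_ t \S_ u \S_ v G s t u v.
Proof. by move=> FG; do 4 (apply: ler_sum => ? _). Qed.

Lemma sum4D (F G : nat -> nat -> nat -> nat -> R) :
  \S_ s \S_ t \S_ u \S_ v (F s t u v + G s t u v) =
  \S_ s \S_ t \S_ u \S_ v F s t u v + \S_ s \S_ t \S_ u \S_ v G s t u v.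
Proof.
rewrite -big_split; apply: eq_bigr => s _; rewrite -big_split; apply: eq_bigr => t _.
by rewrite -big_split; apply: eq_bigr => u _; rewrite -big_split.
Qed.

Lemma sum4Z (x : R) (F : nat -> nat -> nat -> nat -> R) :
  \S_ s \S_ t \S_ u \S_ v (x * F s t u v) = x * \S_ s \S_ t \S_ u \S_ v F s t u v.
Proof.
rewrite mulr_sumr; apply: eq_bigr => s _; rewrite mulr_sumr; apply: eq_bigr => t _.
by rewrite mulr_sumr; apply: eq_bigr => u _; rewrite mulr_sumr.
Qed.

Lemma sum4_swap (F : nat -> nat -> nat -> nat -> R) :
  \S_ s \S_ t \S_ u \S_ v F s t u v = \S_ s \S_ t \S_ u \S_ v F u v s t.
Proof.
under eq_bigr do rewrite exchange_big /=.
rewrite exchange_big /=; apply: eq_bigr => u _.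
under eq_bigr do rewrite exchange_big /=.
by rewrite exchange_big.
Qed.

Lemma sum4_swap34 (F : nat -> nat -> nat -> nat -> R) :
  \S_ s \S_ t \S_ u \S_ v F s t u v = \S_ s \S_ t \S_ u \S_ v F s t v u.
Proof. by apply: eq_bigr => s _; apply: eq_bigr => t _; rewrite exchange_big. Qed.

(** By |W W'| <= (W^2 + W'^2) / 2 the two kernel values are decoupled; for a fixed pair
the covariances are then summed freely over the two remaining times. *)
Lemma gaussian_bound (W : nat -> nat -> R) :
  \S_ s \S_ t \S_ u \S_ v (`|W s t| * `|W u v| * (`|acov (lag s u)| * `|acov (lag t v)|)) <=
  acov_mass ^+ 2 * \S_ s \S_ t W s t ^+ 2.
Proof.
pose F s t u v := W s t ^+ 2 * (`|acov (lag s u)| * `|acov (lag t v)|).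
apply: (@le_trans _ _ (\S_ s \S_ t \S_ u \S_ v (2^-1 * (F s t u v + F u v s t)))).
  apply: ler_sum4 => s t u v; rewrite /F (lagC u s) (lagC v t) -mulrDl [leRHS]mulrA ler_wpM2r ?mulr_ge0//.
  have : 0 <= (`|W s t| - `|W u v|) ^+ 2 by exact: sqr_ge0.
  rewrite -(real_normK (num_real (W s t))) -(real_normK (num_real (W u v))); nra.
rewrite sum4Z sum4D -(sum4_swap F); have := gaussian_part W; rewrite -/(F _ _ _ _).
by set Z := \sum_(1 <= s < n.+1) _; rewrite -/F; lra.
Qed.

(** Of the three products of covariances in a fourth moment, the one that pairs the times
as the kernel does sums to the squared mean; the two others are exchanged by swapping
the last two times. *)
Lemma qform_variance (W : nat -> nat -> R) : (forall s t, `|W s t| <= 1) ->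
  (forall s t, W s t = W t s) ->
  Ex P (fun w => (qform W w - Ex P (qform W)) ^+ 2) <=
  (\S_ s \S_ t \S_ u \S_ v `|kappa4 s t u v|) +
  (acov_mass ^+ 2 * \S_ s \S_ t W s t ^+ 2) *+ 2.
Proof.
move=> W1 Wsym; rewrite Ex_sqr_center; last exact: bounded_qform.
rewrite Ex_qform_sqr Ex_qform mul_sum2.
pose G s t u v := `|W s t| * `|W u v| * (`|acov (lag s u)| * `|acov (lag t v)|).
apply: (@le_trans _ _ (\S_ s \S_ t \S_ u \S_ v (`|kappa4 s t u v| + (G s t u v + G s t v u)) +
   \S_ s \S_ t \S_ u \S_ v (W s t * acov (lag s t) * (W u v * acov (lag u v)))
    - \S_ s \S_ t \S_ u \S_ v (W s t * acov (lag s t) * (W u v * acov (lag u v))))).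
  rewrite lerD2r -sum4D; apply: ler_sum4 => s t u v.
  have -> : W s t * W u v * moment4 X A c s t u v =
     W s t * W u v * kappa4 s t u v + W s t * W u v * (acov (lag s u) * acov (lag t v)) +
     W s t * W v u * (acov (lag s v) * acov (lag t u)) +
     W s t * acov (lag s t) * (W u v * acov (lag u v)).
    by rewrite (Wsym v u) /cumulant; ring.
  rewrite lerD2r addrA; apply: lerD; first apply: lerD.
  - apply: le_trans (ler_norm _) _; rewrite !normrM ler_piMl// mulr_ile1//.
  - by apply: le_trans (ler_norm _) _; rewrite !normrM.
  - by apply: le_trans (ler_norm _) _; rewrite !normrM.
rewrite addrK sum4D lerD2l sum4D -(sum4_swap34 G) -mulr2n lerMn2r orFb.
exact: gaussian_bound.
Qed.

Lemma sum_pair (F : nat -> nat -> R) (S2 := n%:R ^+ 2 * \S_ s \S_ t F s t) :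
  (\S_ s \S_ t \S_ u \S_ v F s t = S2) * (\S_ s \S_ t \S_ u \S_ v F s u = S2) *
  (\S_ s \S_ t \S_ u \S_ v F s v = S2) * (\S_ s \S_ t \S_ u \S_ v F t u = S2) *
  (\S_ s \S_ t \S_ u \S_ v F t v = S2) * (\S_ s \S_ t \S_ u \S_ v F u v = S2).
Proof.
have cst (x : R) : \S_ s x = n%:R * x.
  by rewrite big_const_nat subSS subn0 iter_addr_0 mulr_natl.
have E1 : \S_ s \S_ t \S_ u \S_ v F s t = S2.
  rewrite /S2 mulr_sumr; apply: eq_bigr => s _; rewrite mulr_sumr; apply: eq_bigr => t _.
  by rewrite !cst expr2 mulrA.
have E2 : \S_ s \S_ t \S_ u \S_ v F s u = S2.
  rewrite /S2 mulr_sumr; apply: eq_bigr => s _; rewrite cst expr2 -mulrA; congr (_ * _).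
  by rewrite mulr_sumr; apply: eq_bigr => t _; rewrite cst.
have E3 : \S_ s \S_ t \S_ u \S_ v F s v = S2.
  by rewrite -E2 sum4_swap34.
have E4 : \S_ s \S_ t \S_ u \S_ v F t u = S2.
  rewrite cst /S2 expr2 -mulrA; congr (_ * _); rewrite mulr_sumr.
  by apply: eq_bigr => s _; rewrite mulr_sumr; apply: eq_bigr => t _; rewrite cst.
have E5 : \S_ s \S_ t \S_ u \S_ v F t v = S2 by rewrite -E4 sum4_swap34.
have E6 : \S_ s \S_ t \S_ u \S_ v F u v = S2 by rewrite -E1 [RHS]sum4_swap.
by [].
Qed.

(** Each of the six pairs of times leaves n^2 choices for the two others, and every lag
occurs at most 2 n times: 28 * 6 * 2 = 336.  With all lags at most 3 r, each of
three times has at most 6 r + 1 positions relative to the first. *)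
Lemma sum_cumulant_bound r :
  \S_ s \S_ t \S_ u \S_ v `|kappa4 s t u v| <=
  336 * n%:R ^+ 3 * (\sum_(1 <= h < n) far_mixing X r h) +
  5 * p * n%:R * (6 * r%:R + 1) ^+ 3.
Proof.
apply: le_trans (ler_sum4 (cumulant_bound mA stat c r)) _.
rewrite sum4D; apply: lerD.
  rewrite sum4Z !sum4D; rewrite !(sum_pair (fun s t => far_mixing X r (lag s t))).
  set S2 := \S_ s \S_ t _.
  have : S2 <= n%:R * ((\sum_(1 <= h < n) far_mixing X r h) *+ 2).
    apply: (@le_trans _ _ (\S_ s ((\sum_(1 <= h < n) far_mixing X r h) *+ 2))).
      apply: ler_sum_nat => s sn.
      apply: le_trans (sum_lag_row (far_mixing_ge0 X r) sn) _.
      by rewrite {1}/far_mixing ltn0 add0r.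
    by rewrite big_const_nat subSS subn0 iter_addr_0 mulr_natl.
  move/(ler_wpM2l (sqr_ge0 (n%:R : R))); set F := \sum_(1 <= h < n) _.
  move=> h; rewrite (_ : 336 * n%:R ^+ 3 * F = 28 * 6 * (n%:R ^+ 2 * (n%:R * (F *+ 2)))); last by ring.
  by move: h; move: (_ * S2) (_ * (_ *+ 2)) => *; lra.
rewrite sum4Z -[leRHS]mulrA ler_wpM2l//; first by rewrite mulr_ge0// pr_ge0.
pose g h : R := (close_lag r h)%:R.
have row s : (1 <= s < n.+1)%N -> \S_ t g (lag s t) <= 6 * r%:R + 1.
  move=> sn; apply: le_trans (@sum_lag_row R g n s (fun h => ler0n R (close_lag r h)) sn) _.
  rewrite addrC; apply: lerD; last by rewrite /g lern1 leq_b1.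
  rewrite -mulr_natl -natr_sum.
    have : (\sum_(1 <= h < n) close_lag r h <= 3 * r)%N.
      have : (\sum_(1 <= h < n) close_lag r h <= minn n.-1 (3 * r))%N; last by rewrite leq_min => /andP[].
      case: n {s sn} => [|n']; first by rewrite big_geq.
      elim: n' => [|n' IH]; first by rewrite big_geq.
      by rewrite big_nat_recr//= /close_lag; move: IH; rewrite /close_lag; lia.
    by rewrite -(ler_nat R) natrM; lra.
apply: (@le_trans _ _ (\S_ s ((\S_ t g (lag s t)) * ((\S_ u g (lag s u)) * (\S_ v g (lag s v)))))).
  apply: ler_sum => s _; rewrite mulr_suml; apply: ler_sum => t _.
  rewrite mulr_suml mulr_sumr; apply: ler_sum => u _.
  rewrite mulr_sumr mulr_sumr; apply: ler_sum => v _.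
  rewrite /g; case: (close_lag r (lag s t)) => /=; rewrite ?mul0r// mul1r.
  case: (close_lag r (lag s u)) => /=; rewrite ?mul0r// mul1r.
  by case: (close_lag r (lag s v)) => //=; rewrite ler_nat leq_b1.
have -> : n%:R * (6 * r%:R + 1) ^+ 3 = \S_ s ((6 * r%:R + 1) ^+ 3 : R).
  by rewrite big_const_nat subSS subn0 iter_addr_0 mulr_natl.
apply: ler_sum_nat => s sn; rewrite exprS expr2.
have g0 : 0 <= \S_ t g (lag s t) by rewrite sumr_ge0.
by rewrite !ler_pM ?mulr_ge0 ?row.
Qed.

End QuadraticForms.

(** * The Fourier kernel of the weights *)

Section FourierKernel.
Context {R : realType}.
Implicit Types (n s t l : nat) (x y : R).

(** Multiplied by 2 sin(phi/2), the sum telescopes into a difference of two sines whose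
arguments differ by [l] full turns. *)
Lemma sum_cos_period n l (x : R) : (0 < l < n)%N ->
  \sum_(1 <= t < n.+1) cos ((x - t%:R) * (2 * pi * l%:R / n%:R)) = 0.
Proof.
move=> /andP[l0 ln]; have n0 : (0 < n)%N by exact: leq_ltn_trans ln.
have nR : 0 < n%:R :> R by rewrite ltr0n.
set phi := 2 * pi * l%:R / n%:R.
have sphi : 0 < sin (phi / 2).
  apply: sin_gt0_pi; rewrite /phi (_ : 2 * pi * l%:R / n%:R / 2 = pi * (l%:R / n%:R)); last by field; rewrite gt_eqF.
  have pi0 := pi_gt0 R; rewrite mulr_gt0 ?divr_gt0 ?ltr0n//=.
  by rewrite -[ltRHS]mulr1 ltr_pM2l// ltr_pdivrMr// mul1r ltr_nat.
pose f t := sin ((x - t%:R + 2^-1) * phi).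
have step t : 2 * sin (phi / 2) * cos ((x - t%:R) * phi) = f t - f t.+1.
  rewrite /f -(natr1 t).
  rewrite (_ : (x - t%:R + 2^-1) * phi = (x - t%:R) * phi + phi / 2); last by field.
  rewrite (_ : (x - (t%:R + 1) + 2^-1) * phi = (x - t%:R) * phi - phi / 2); last by field.
  by rewrite sinD sinB; ring.
have : 2 * sin (phi / 2) * \sum_(1 <= t < n.+1) cos ((x - t%:R) * phi) = 0.
  rewrite mulr_sumr; under eq_bigr do rewrite step.
  have -> : \sum_(1 <= t < n.+1) (f t - f t.+1) = - \sum_(1 <= t < n.+1) (f t.+1 - f t).
    by rewrite -sumrN; apply: eq_bigr => t _; rewrite opprB.
  rewrite telescope_sumr// /f.
  have := @periodicn R R sin _ (@sinD2pi R) l ((x - n.+1%:R + 2^-1) * phi).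
  rewrite (_ : (x - n.+1%:R + 2^-1) * phi + _ = (x - 1%:R + 2^-1) * phi).
    by move=> ->; rewrite subrr oppr0.
  by rewrite -(natr1 n) -mulr_natl -(mulr_natl pi) /phi; field; rewrite gt_eqF.
by move/eqP; rewrite !mulf_eq0 pnatr_eq0 /= gt_eqF//= => /eqP.
Qed.

Section Weights.
Variables (M n : nat) (wt : 'I_M -> R) (theta0 : R).
Hypothesis wt_ge0 : forall i, 0 <= wt i.
Hypothesis wt_sum1 : \sum_i wt i = 1.
Hypothesis n_gt0 : (0 < n)%N.
Hypothesis Mn : (M <= n)%N.

Definition theta (i : 'I_M) : R := theta0 + 2 * pi * i%:R / n%:R.

Definition kern x : R := \sum_i wt i * cos (x * theta i).

Lemma kernN x : kern (- x) = kern x.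
Proof. by apply: eq_bigr => i _; rewrite mulNr cosN. Qed.

Lemma kern0 : kern 0 = 1.
Proof. by rewrite -wt_sum1; apply: eq_bigr => i _; rewrite mul0r cos0 mulr1. Qed.

Lemma kern_le1 x : `|kern x| <= 1.
Proof.
apply: (le_trans (ler_norm_sum _ _ _)); rewrite -wt_sum1; apply: ler_sum => i _.
by rewrite normrM (ger0_norm (wt_ge0 i)) ler_piMr// cos_max.
Qed.

(** The right side is the squared modulus of sum_i w_i exp(i x theta_i), of which [kern]
is the real part; it involves differences of frequencies only. *)
Lemma kern_sqr_le x : kern x ^+ 2 <=
  \sum_i \sum_k wt i * wt k * cos (x * (theta i - theta k)).
Proof.
have -> : \sum_i \sum_k wt i * wt k * cos (x * (theta i - theta k)) =
    kern x ^+ 2 + (\sum_i wt i * sin (x * theta i)) ^+ 2.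
  rewrite !expr2 /kern !mulr_suml -big_split; apply: eq_bigr => i _ /=.
  rewrite !mulr_sumr -big_split; apply: eq_bigr => k _ /=.
  by rewrite mulrBr cosB; ring.
by rewrite lerDl sqr_ge0.
Qed.

(** As [M <= n], distinct frequencies stay distinct modulo a full turn. *)
Lemma sum_cos_theta (i k : 'I_M) x :
  \sum_(1 <= t < n.+1) cos ((x - t%:R) * (theta i - theta k)) = n%:R * (i == k)%:R.
Proof.
have [<-|ik] := eqVneq i k.
  under eq_bigr do rewrite subrr mulr0 cos0.
  by rewrite big_const_nat subSS subn0 iter_addr_0 mulr1.
rewrite mulr0.
wlog lt : i k ik / (k < i)%N.
  move=> h; have [lt|] := ltnP k i; first exact: h.
  rewrite leq_eqVlt => /predU1P[/val_inj e|lt]; first by rewrite e eqxx in ik.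
  rewrite -[RHS](h k i) 1?eq_sym//; apply: eq_bigr => t _.
  by rewrite -cosN -mulrN opprB.
rewrite -[RHS](@sum_cos_period n (i - k) x); last first.
  by rewrite subn_gt0 lt /=; apply: leq_ltn_trans (leq_subr _ _) (leq_trans (ltn_ord i) Mn).
apply: eq_bigr => t _; congr (cos (_ * _)); rewrite /theta natrB; last exact: ltnW.
by field; rewrite pnatr_eq0 -lt0n.
Qed.

Lemma parseval : \sum_(1 <= s < n.+1) \sum_(1 <= t < n.+1) kern (s%:R - t%:R) ^+ 2 <=
  n%:R ^+ 2 * \sum_i wt i ^+ 2.
Proof.
apply: (@le_trans _ _ (\sum_(1 <= s < n.+1) (n%:R * \sum_i wt i ^+ 2))); last first.
  by rewrite big_const_nat subSS subn0 iter_addr_0 -[leLHS]mulr_natl mulrA expr2.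
apply: ler_sum => s _.
apply: le_trans (ler_sum _ (fun t _ => kern_sqr_le _)) _.
rewrite exchange_big /= mulr_sumr; apply: ler_sum => i _.
rewrite exchange_big /= (bigD1 i)//= [X in _ + X]big1 => [|k ki].
  by rewrite addr0 -mulr_sumr sum_cos_theta eqxx mulr1 expr2 mulrC.
by rewrite -mulr_sumr sum_cos_theta eq_sym (negbTE ki) !mulr0.
Qed.

(** [kern] is a weighted mean of cosines at frequencies close to [lam]. *)
Lemma kern_approx x lam delta e : (forall i, `|theta i - lam| <= delta) ->
  (forall y, `|y - lam| <= delta -> `|cos (x * y) - cos (x * lam)| <= e) ->
  `|kern x - cos (x * lam)| <= e.
Proof.
move=> hd he.
rewrite -[cos (x * lam)]mul1r -wt_sum1 mulr_suml -sumrB.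
apply: (le_trans (ler_norm_sum _ _ _)).
rewrite -[e]mul1r -wt_sum1 mulr_suml; apply: ler_sum => i _.
by rewrite -mulrBr normrM (ger0_norm (wt_ge0 i)) ler_wpM2l// he.
Qed.

End Weights.

Lemma cabs_sum_cexpi n (x : nat -> R) (th : R) :
  cabs (\sum_(1 <= t < n.+1) (x t)%:C%C * cexpi (- (t%:R * th))) ^+ 2 =
  \sum_(1 <= s < n.+1) \sum_(1 <= t < n.+1) x s * x t * cos ((s%:R - t%:R) * th).
Proof.
have -> : \sum_(1 <= t < n.+1) (x t)%:C%C * cexpi (- (t%:R * th)) =
    ((\sum_(1 <= t < n.+1) x t * cos (t%:R * th)) +i*
     (- \sum_(1 <= t < n.+1) x t * sin (t%:R * th)))%C.
  elim: (index_iota _ _) => [|t L IH]; first by rewrite !big_nil oppr0.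
  rewrite !big_cons IH /cexpi cosN sinN; simpc.
  by congr (_ +i* _)%C; rewrite ?mul0r ?subr0 ?addr0//; ring.
rewrite /cabs /Normc.normc sqr_sqrtr ?addr_ge0 ?sqr_ge0// sqrrN !expr2 !mulr_suml -big_split.
apply: eq_bigr => s _ /=; rewrite !mulr_sumr -big_split; apply: eq_bigr => t _ /=.
by rewrite mulrBl cosB; ring.
Qed.

Lemma fourier_freq0_bounds n (lam : R) : (0 < n)%N ->
  lam <= fourier_freq0 n lam <= lam + 2 * pi / n%:R.
Proof.
move=> n0; have nR : 0 < n%:R :> R by rewrite ltr0n.
have pi0 := pi_gt0 R.
rewrite /fourier_freq0; set S := [set x | _].
pose j := Num.ceil (lam * n%:R / (2 * pi)).
have jS : S (2 * pi * j%:~R / n%:R).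
  split; last by exists j.
  rewrite ler_pdivlMr// mulrC [2 * pi * _]mulrC -ler_pdivrMr ?mulr_gt0// mulrC.
  exact: ceil_ge.
have lb : lbound S lam by move=> x [].
apply/andP; split; first by apply: lb_le_inf => //; exists (2 * pi * j%:~R / n%:R).
apply: (@le_trans _ _ (2 * pi * j%:~R / n%:R)); first by apply: ge_inf => //; exists lam.
have jlt : j%:~R - 1 < lam * n%:R / (2 * pi).
  by have /andP[+ _] := ceil_itv (lam * n%:R / (2 * pi)); rewrite intrB.
have E q : 0 < q -> lam + 2 * q / n%:R = 2 * q / n%:R * (lam * n%:R / (2 * q) + 1).
  by move=> q0; field; rewrite !gt_eqF.
rewrite (E _ pi0) [leLHS]mulrAC ler_pM2l ?divr_gt0 ?mulr_gt0// -lerBlDr.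
exact: ltW.
Qed.

End FourierKernel.

(** * Asymptotics of the covariances *)

Section PartialSums.
Context {R : realType}.
Implicit Types (F : nat -> R).

Lemma sum_nat_trunc_lt F k n N : (forall h, 0 <= F h) ->
  \sum_(k <= h < n) (if (h < N)%N then F h else 0) <= \sum_(k <= h < N) F h.
Proof.
move=> F0; have [nN|Nn] := leqP n N.
  apply: (@le_trans _ _ (\sum_(k <= h < n) F h)).
    by apply: ler_sum => h _; case: ifP.
  have [kn|nk] := leqP k n; last by rewrite big_geq ?sumr_ge0// ltnW.
  by rewrite (big_cat_nat kn nN)/= lerDl sumr_ge0.
have [kN|Nk] := leqP k N.
  rewrite (big_cat_nat kN (ltnW Nn))/= [X in _ + X]big_nat [X in _ + X]big1 ?addr0.
    by apply: ler_sum => h _; case: ifP.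
  by move=> h /andP[Nh _]; rewrite ltnNge Nh.
rewrite big_nat big1 ?sumr_ge0// => h /andP[kh _].
by rewrite ltnNge (leq_trans (ltnW Nk) kh).
Qed.

Lemma sum_nat_trunc_ge F k n N : (forall h, 0 <= F h) ->
  \sum_(k <= h < n) (if (N <= h)%N then F h else 0) <= \sum_(N <= h < n) F h.
Proof.
move=> F0; have [kN|Nk] := leqP k N; last first.
  apply: (@le_trans _ _ (\sum_(k <= h < n) F h)).
    by apply: ler_sum => h _; case: ifP.
  have [kn|nk] := leqP k n; last by rewrite big_geq ?sumr_ge0// ltnW.
  by rewrite (big_cat_nat (ltnW Nk) kn)/= lerDr sumr_ge0.
have [nN|Nn] := leqP n N.
  rewrite big_nat big1 ?sumr_ge0// => h /andP[_ hn].
  by rewrite leqNgt (leq_trans hn nN).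
rewrite (big_cat_nat kN (ltnW Nn))/= [X in X + _]big_nat [X in X + _]big1 ?add0r.
  by apply: ler_sum => h _; case: ifP.
by move=> h /andP[_ hN]; rewrite leqNgt hN.
Qed.

Lemma sum_nat_split_le F (j k n : nat) : (forall h, 0 <= F h) -> (j <= k)%N ->
  \sum_(j <= h < n) F h <= \sum_(j <= h < k) F h + \sum_(k <= h < n) F h.
Proof.
move=> F0 jk; have [kn|nk] := leqP k n; first by rewrite -(big_cat_nat jk kn).
apply: (@le_trans _ _ (\sum_(j <= h < k) F h)); last by rewrite lerDl sumr_ge0.
have [jn|nj] := leqP j n; last by rewrite big_geq ?sumr_ge0// ltnW.
by rewrite (big_cat_nat jn (ltnW nk))/= lerDl sumr_ge0.
Qed.

Lemma limn_esup_lt (u : nat -> \bar R) (x : \bar R) : (limn_esup u < x)%E ->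
  \forall n \near \oo, (u n < x)%E.
Proof.
move=> /ereal_inf_lt[_ [V Voo <-] ltx]; apply: filterS Voo => n Vn.
by apply: le_lt_trans ltx; apply: ereal_sup_ubound; exists n.
Qed.

Lemma cvg_sqr_center (u : nat -> R) (l : R) : u n @[n --> \oo] --> l ->
  (u n - l) ^+ 2 @[n --> \oo] --> (0 : R).
Proof.
move=> ul; have h : u n - l @[n --> \oo] --> (0 : R).
  by rewrite -(subrr l); apply: cvgB => //; exact: cvg_cst.
by under eq_fun do rewrite expr2; rewrite -(mulr0 0); exact: cvgM.
Qed.

Lemma cvg_sum_seq (s : seq nat) (u : nat -> nat -> R) (l : nat -> R) :
  (forall h, u h n @[n --> \oo] --> l h) ->
  \sum_(h <- s) u h n @[n --> \oo] --> \sum_(h <- s) l h.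
Proof.
move=> ul; elim: s => [|h s IH].
  by under eq_fun do rewrite big_nil; rewrite big_nil; exact: cvg_cst.
by under eq_fun do rewrite big_cons; rewrite big_cons; apply: cvgD.
Qed.

End PartialSums.

Section Asymptotics.
Context {dT : measure_display} {T : measurableType dT} {R : realType}.
Variables (P : probability T R) (d : nat).
Variable X : int -> {RV P >-> borelType 'rV[R]_d}.
Variables (alpha : R) (a : nat -> R).
Variable mu : forall h : nat, {measure set (borelType 'M[\bar R]_(h.+1, d)) -> \bar R}.
Variable A : set 'rV[\bar R]_d.
Variables m r : nat -> nat.
Hypothesis stat : strictly_stationary X.
Hypothesis rv : regularly_varying X alpha a mu.
Hypothesis mA : (measurable : set (set (borelType 'rV[\bar R]_d))) A.
Hypothesis A_away : bounded_away0 A.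
Hypothesis A_cont : continuity_set (mu 0%N) A.
Hypothesis AA_cont : forall h : nat, (1 <= h)%N ->
  continuity_set (mu h) [set x | A (row ord0 x) /\ A (row ord_max x)].
Hypothesis cM : condition_M X a m r.

Local Notation tau := (tail_mass mu A).
Local Notation p n := (pr P (hits X A (a (m n)) 0)).
Local Notation gam n := (acov X A (a (m n))).
Local Notation M n := ((m n)%:R : R).

Lemma m_pinfty : M n @[n --> \oo] --> +oo.
Proof.
apply/cvgryPge => x.
have : \forall n \near \oo, (Num.truncn x < m n)%N.
  have h : \forall k \near \oo, (Num.truncn x < k)%N by exact: nbhs_infty_gt.
  exact: (M_m_infty cM h).
apply: filterS => n /= h.
by apply: le_trans (ltW (truncnS_gt _)) _; rewrite ler_nat.
Qed.

Lemma hit_prob_cvg : M n * p n @[n --> \oo] --> tau 0%N.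
Proof.
have := joint_hits_cvg (h := 0%N) rv mA A_away A_cont AA_cont (M_m_infty cM).
by under eq_fun do rewrite /joint_hits setIid.
Qed.

Lemma p_cvg0 : p n @[n --> \oo] --> (0 : R).
Proof.
have h : (M n)^-1 * (M n * p n) @[n --> \oo] --> 0 * tau 0%N.
  by apply: cvgM hit_prob_cvg; apply/gtr0_cvgV0; [exact: cvgry_gt m_pinfty 0|exact: m_pinfty].
rewrite mul0r in h; apply: cvg_trans h; apply: near_eq_cvg.
apply: filterS (cvgry_gt m_pinfty 0) => n m0.
by rewrite mulrA mulVf ?mul1r// gt_eqF.
Qed.

(** The product of the means is negligible: m p^2 = (m p) p, and p -> 0. *)
Lemma acov_cvg h : M n * gam n h @[n --> \oo] --> tau h.
Proof.
have E n : M n * gam n h = M n * pr P (joint_hits X A h (a (m n))) - (M n * p n) * p n.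
  by rewrite /acov hit_all_cons hit_all1 /joint_hits; ring.
under eq_fun do rewrite E.
rewrite -[tau h]subr0 -(mulr0 (tau 0%N)).
apply: cvgB; last exact: cvgM hit_prob_cvg p_cvg0.
exact: (joint_hits_cvg (h := h) rv mA A_away A_cont AA_cont (M_m_infty cM)).
Qed.

(** A neighbourhood of the origin misses [A], so a hit forces one coordinate, hence the
norm, above a fixed multiple of the level. *)
Lemma hits_exceeds : exists2 e : R, 0 < e & forall x t, 0 < x ->
  hits X A x t `<=` exceeds X t (e * x).
Proof.
have [e e0 eA] := (bounded_away0P A).1 A_away.
exists (e / 2) => [|x t x0 w Aw]; first by rewrite divr_gt0.
rewrite /exceeds /= ltNge; apply/negP => le; apply: (eA _ _ Aw); split=> // i j.
rewrite !mxE /ball /= /ereal_ball contract0 sub0r normrN /=.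
set y := (X t w : 'rV[R]_d) ord0 j.
have yle : `|y| <= e / 2 * x.
  apply: le_trans le; rewrite /enorm -sqrtr_sqr ler_wsqrtr// (bigD1 j)//= -/y lerDl.
  by rewrite sumr_ge0// => *; rewrite sqr_ge0.
rewrite (ord1 i) -/y normrM normfV (gtr0_norm (_ : 0 < 1 + _)); last by rewrite ltr_pwDl.
rewrite ltr_pdivrMr ?ltr_pwDl//.
have h : `|x^-1 * y| <= e / 2.
  by rewrite normrM normfV (gtr0_norm x0) mulrC ler_pdivrMr.
apply: (le_lt_trans h); apply: (@lt_le_trans _ _ e); first by lra.
by rewrite ler_peMr ?(ltW e0)// lerDl.
Qed.

(** Up to lag r_n the covariance is at most the joint probability plus p^2: the former is
controlled by anti-clustering, the latter sums to (r_n / m) (m p)^2 up to a negligible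
term.  Beyond r_n mixing takes over. *)
Lemma acov_tail (eta : R) : 0 < eta -> exists k0, forall k, (k0 <= k)%N ->
  \forall n \near \oo, M n * \sum_(k <= h < n) `|gam n h| <= eta.
Proof.
move=> eta0; have [e e0 he] := hits_exceeds.
have e30 : 0 < eta / 3 by rewrite divr_gt0.
have [k0 _ Hk0] : \forall k \near \oo, (limn_esup (fun n => ((m n)%:R%:E * \sum_(k <= h < (r n).+1)
      P (exceeds X h%:Z (e * a (m n)) `&` exceeds X 0 (e * a (m n))))%E) < (eta / 3)%:E)%E.
  have lt0 : (0%E < (eta / 3)%:E)%E by rewrite lte_fin.
  exact: (M_anticlustering cM e0 (open_ereal_lt' lt0)).
exists k0 => k k0k; have {k0 Hk0 k0k} /limn_esup_lt H1 := Hk0 k k0k.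
have H2 : \forall n \near \oo, M n * \sum_(r n <= h < n) mixing_rate X h < eta / 12.
  have e12 : (0%E < (eta / 12)%:E)%E by rewrite lte_fin divr_gt0.
  have : \forall n \near \oo, ((m n)%:R%:E * \sum_(r n <= h <oo) (mixing_rate X h)%:E < (eta / 12)%:E)%E.
    exact: (M_mixing_sum cM (open_ereal_lt' e12)).
  apply: filterS => n /= h.
  rewrite -lte_fin; apply: le_lt_trans h; rewrite EFinM lee_wpmul2l ?lee_fin//.
  rewrite -sumEFin; apply: nneseries_lim_ge => j _ _; rewrite lee_fin; exact: mixing_rate_ge0.
have H3 : \forall n \near \oo, ((r n).+1%:R / M n) * (M n * p n) ^+ 2 < eta / 3.
  have h : ((r n)%:R / M n + (M n)^-1) * ((M n * p n) * (M n * p n)) @[n --> \oo] -->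
      ((0 + 0) * (tau 0%N * tau 0%N) : R).
    apply: cvgM; last by apply: cvgM; exact: hit_prob_cvg.
    apply: cvgD; first exact: (M_r_m cM).
    by apply/gtr0_cvgV0; [exact: cvgry_gt m_pinfty 0|exact: m_pinfty].
  rewrite addr0 mul0r in h; apply: filterS (cvgr_lt _ h _ e30) => n.
  move=> hn; rewrite (_ : (r n).+1%:R / M n = (r n)%:R / M n + (M n)^-1) ?expr2//.
  by rewrite -(natr1 (r n)) mulrDl mul1r.
have am0 : \forall n \near \oo, 0 < a (m n).
  have h : a (m n) @[n --> \oo] --> +oo by exact: (cvg_comp _ _ (M_m_infty cM) (rv_a_pinfty rv)).
  exact: cvgry_gt h 0.
apply: filterS (filterI (filterI H1 H2) (filterI H3 (filterI am0 (cvgry_gt m_pinfty 0)))).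
move=> n [[h1 h2] [h3 [an0 mn0]]].
pose PJ h := pr P (joint_hits X A h (a (m n))).
have PJ0 h : 0 <= PJ h by exact: pr_ge0.
have xi0 h := mixing_rate_ge0 X h.
have bound : \sum_(k <= h < n) `|gam n h| <=
    \sum_(k <= h < (r n).+1) PJ h + (r n).+1%:R * p n ^+ 2 +
    4 * \sum_(r n <= h < n) mixing_rate X h.
  apply: (@le_trans _ _ (\sum_(k <= h < n) ((if (h < (r n).+1)%N then PJ h + p n ^+ 2 else 0) +
      4 * (if (r n <= h)%N then mixing_rate X h else 0)))).
    apply: ler_sum => h _; case: ifPn => [hr|].
      apply: (@le_trans _ _ (PJ h + p n ^+ 2)); first exact: acov_le_joint.
      by rewrite lerDl mulr_ge0//; case: ifP.
    rewrite -leqNgt => /ltnW ->; rewrite add0r; exact: mixing_acov_le.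
  rewrite big_split /= -mulr_sumr; apply: lerD; last first.
    by apply: ler_wpM2l => //; exact: sum_nat_trunc_ge.
  have F0 h : 0 <= PJ h + p n ^+ 2 by rewrite addr_ge0 ?sqr_ge0.
  apply: le_trans (sum_nat_trunc_lt k n (r n).+1 F0) _.
  rewrite big_split /= lerD2l big_const_nat iter_addr_0 -[leLHS]mulr_natl.
  by rewrite ler_wpM2r ?sqr_ge0// ler_nat leq_subr.
have joint : M n * \sum_(k <= h < (r n).+1) PJ h <= eta / 3.
  rewrite -lee_fin; apply: le_trans (ltW h1).
  rewrite EFinM lee_wpmul2l ?lee_fin// -sumEFin; apply: lee_sum => h _.
  rewrite /PJ /pr fineK ?fin_num_measure//; last exact: measurable_joint_hits.
  apply: le_measure; rewrite ?inE; [exact: measurable_joint_hits|by apply: measurableI; exact: measurable_exceeds|].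
  by move=> w [hh h0]; split; exact: he an0 _ _.
apply: (le_trans (ler_wpM2l (ltW mn0) bound)).
rewrite !mulrDr; have -> : M n * ((r n).+1%:R * p n ^+ 2) = (r n).+1%:R / M n * (M n * p n) ^+ 2.
  by field; rewrite gt_eqF.
have -> : M n * (4 * \sum_(r n <= h < n) mixing_rate X h) = 4 * (M n * \sum_(r n <= h < n) mixing_rate X h).
  by ring.
move: joint h3 h2; move: (M n * _) (_ * _ ^+ 2) (M n * _) => *; lra.
Qed.

Lemma acov_mass_bounded : exists C, \forall n \near \oo,
  M n * acov_mass X A (a (m n)) n <= C.
Proof.
have [k0 H] := acov_tail ltr01.
pose k := maxn 1 k0; have {}H := H k (leq_maxr _ _).
have c1 : M n * (`|gam n 0| + (\sum_(1 <= h < k) `|gam n h|) *+ 2) @[n --> \oo] -->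
    `|tau 0%N| + (\sum_(1 <= h < k) `|tau h|) *+ 2.
  have E n : M n * (`|gam n 0| + (\sum_(1 <= h < k) `|gam n h|) *+ 2) =
     `|M n * gam n 0| + (\sum_(1 <= h < k) `|M n * gam n h|) *+ 2.
    rewrite mulrDr mulrnAr mulr_sumr normrM ger0_norm//; congr (_ + _ *+ 2).
    by apply: eq_bigr => h _; rewrite normrM ger0_norm.
  under eq_fun do rewrite E.
  rewrite !mulr2n; apply: cvgD; first by apply: cvg_norm; exact: acov_cvg.
  by apply: cvgD; apply: cvg_sum_seq => h; apply: cvg_norm; exact: acov_cvg.
set L := (X in _ --> X) in c1.
exists (L + 1 + 2); have L1 : L < L + 1 by rewrite ltrDl.
apply: filterS2 H (cvgr_lt _ c1 _ L1) => n h1 h2.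
rewrite /acov_mass.
apply: (@le_trans _ _ (M n * (`|gam n 0| + (\sum_(1 <= h < k) `|gam n h|) *+ 2) +
   (M n * \sum_(k <= h < n) `|gam n h|) *+ 2)); last first.
  by rewrite mulr2n in h2 *; lra.
rewrite -mulrnAr -mulrDr ler_wpM2l// -addrA lerD2l -mulrnDl lerMn2r orFb.
by apply: sum_nat_split_le => //; exact: leq_maxl.
Qed.

End Asymptotics.

(** * Real sequences and symmetric sums in the complex field *)

Section ComplexReal.
Context {R : realType}.

Lemma cabs_realB (x y : R) : cabs (x%:C%C - y%:C%C) = `|x - y|.
Proof. by rewrite /cabs /Normc.normc /= subrr expr0n addr0 sqrtr_sqr. Qed.

Lemma cvg_real_complex (u : nat -> R) (l : R) : u n @[n --> \oo] --> l ->
  ((u n)%:C%C : R[i]^o) @[n --> \oo] --> (l%:C%C : R[i]^o).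
Proof.
move=> ul; apply/cvgrPdist_lt => e e0.
have e_real : e = (complex.Re e)%:C%C.
  by move: e0; rewrite ltcE /= => /andP[/eqP + _]; case: e => x y /= ->.
have Re0 : 0 < complex.Re e by move: e0; rewrite e_real ltcR.
have /cvgrPdist_lt/(_ _ Re0) := ul; apply: filterS => n h.
by rewrite e_real -rmorphB /= normc_def /= expr0n addr0 sqrtr_sqr ltcR.
Qed.

Lemma sym_sumS (V : nmodType) N (F : int -> V) :
  sym_sum N.+1 F = sym_sum N F + (F N.+1%:Z + F (- N.+1%:Z)).
Proof.
rewrite /sym_sum doubleS big_ord_recl big_ord_recr /= addrC -addrA; congr (_ + _).
  by apply: eq_bigr => i _; congr F; rewrite /bump /=; lia.
by congr (F _ + F _); rewrite /bump /=; lia.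
Qed.

(** The terms at [h] and [- h] are conjugate, so the sum is real. *)
Lemma sym_sum_cos N (rho : nat -> R) (lam : R) :
  sym_sum N (fun h : int => (rho `|h|%N)%:C%C * cexpi (- (h%:~R * lam))) =
  (2 * series (fun h => rho h * cos (h%:R * lam)) N.+1 - rho 0%N)%:C%C.
Proof.
have pair (c x : R) : c%:C%C * cexpi (- x) + c%:C%C * cexpi x = (2 * (c * cos x))%:C%C.
  rewrite /cexpi cosN sinN; simpc; congr (_ +i* _)%C; ring.
elim: N => [|N IH].
  have z0 : 0%N%:Z - 0%N%:Z = 0%N%:Z by [].
  rewrite /sym_sum big_ord1 /= z0 /= mul0r oppr0 /cexpi cos0 sin0.
  rewrite /series /= big_nat1 mul0r cos0 mulr1; simpc.
  by congr (_ +i* _)%C; ring.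
rewrite sym_sumS IH abszN /= intrN mulNr opprK pair /series /= [in RHS]big_nat_recr//=.
by rewrite -rmorphD /= mulrDr; congr (_%:C)%C; ring.
Qed.

End ComplexReal.

(** * The smoothed periodogram and the number of hits *)

Section SmoothedPeriodogram.
Context {dT : measure_display} {T : measurableType dT} {R : realType}.
Variables (P : probability T R) (d : nat).
Variable X : int -> {RV P >-> borelType 'rV[R]_d}.
Variables (alpha : R) (a : nat -> R).
Variable mu : forall h : nat, {measure set (borelType 'M[\bar R]_(h.+1, d)) -> \bar R}.
Variable A : set 'rV[\bar R]_d.
Variables (m r s : nat -> nat) (wt : nat -> int -> R) (lambda : R).
Hypothesis stat : strictly_stationary X.
Hypothesis alpha_gt0 : 0 < alpha.
Hypothesis rv : regularly_varying X alpha a mu.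
Hypothesis mA : (measurable : set (set (borelType 'rV[\bar R]_d))) A.
Hypothesis A_away : bounded_away0 A.
Hypothesis A_cont : continuity_set (mu 0%N) A.
Hypothesis AA_cont : forall h : nat, (1 <= h)%N ->
  continuity_set (mu h) [set x | A (row ord0 x) /\ A (row ord_max x)].
Hypothesis A_gt0 : (0 < mu 0%N A)%E.
Hypothesis cM : condition_M X a m r.
Hypothesis cM2 : condition_M2 X m r.
Hypothesis rho_summable : (\sum_(1 <= h <oo) (extremogram X A h)%:E < +oo)%E.
Hypothesis s_small : (s n)%:R / n%:R @[n --> \oo] --> (0 : R).
Hypothesis wt_ge0 : forall (n : nat) (j : int), (`|j| <= s n)%N -> 0 <= wt n j.
Hypothesis wt_sum1 : forall n : nat, sym_sum (s n) (wt n) = 1.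
Hypothesis wt_sqr : sym_sum (s n) (fun j => wt n j ^+ 2) @[n --> \oo] --> (0 : R).

Local Notation tau := (tail_mass mu A).
Local Notation p n := (pr P (hits X A (a (m n)) 0)).
Local Notation gam n := (acov X A (a (m n))).
Local Notation M n := ((m n)%:R : R).

Let gam_cvg := acov_cvg rv mA A_away A_cont AA_cont cM.
Let p_cvg := hit_prob_cvg rv mA A_away A_cont AA_cont cM.
Let gam_tail := acov_tail stat rv mA A_away A_cont AA_cont cM.
Let gam_bounded := acov_mass_bounded stat rv mA A_away A_cont AA_cont cM.
Let tau0_gt0 := tail_mass0_gt0 rv mA A_away A_cont AA_cont A_gt0.
Let extE h : extremogram X A h = tau h / tau 0%N :=
  extremogramE alpha_gt0 rv mA A_away A_cont AA_cont A_gt0 h.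

Definition lag_weight n (i : 'I_((s n).*2.+1)) : R := wt n (i%:Z - (s n)%:Z).
(** The frequency of index [- s n], from which the ordinals indexing the window count
upwards. *)
Definition lowest_freq n : R := fourier_freq0 n lambda - 2 * pi * (s n)%:R / n%:R.
Definition smoothing_kernel n : R -> R := kern n (@lag_weight n) (lowest_freq n).
Definition smoothing_form n : nat -> nat -> R := fun t u => smoothing_kernel n (t%:R - u%:R).

Local Notation K n := (smoothing_kernel n).
Local Notation Z n := (qform X A (a (m n)) n (smoothing_form n)).

Lemma lag_weight_ge0 n i : 0 <= @lag_weight n i.
Proof. by apply: wt_ge0; have := ltn_ord i; lia. Qed.

Lemma lag_weight_sum1 n : \sum_i @lag_weight n i = 1.
Proof. by rewrite -(wt_sum1 n). Qed.

Lemma theta_fourier n i : theta n (lowest_freq n) i =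
  fourier_freq n lambda ((i : 'I_((s n).*2.+1))%:Z - (s n)%:Z).
Proof. by rewrite /theta /fourier_freq /lowest_freq intrB /=; ring. Qed.

Lemma smoothed_periodogramE n w :
  smoothed_periodogram X A a m n s wt lambda w = M n / n%:R * Z n w.
Proof.
rewrite /smoothed_periodogram /sym_sum /periodogram.
under eq_bigr do rewrite cabs_sum_cexpi mulrCA.
rewrite -mulr_sumr; congr (_ * _).
under eq_bigr do rewrite mulr_sumr.
rewrite exchange_big /=; apply: eq_bigr => t _.
under eq_bigr do rewrite mulr_sumr.
rewrite exchange_big /=; apply: eq_bigr => u _.
rewrite /smoothing_form /smoothing_kernel /kern mulr_suml; apply: eq_bigr => i _.
by rewrite theta_fourier /lag_weight /ind_centered /ind /centered_hit; ring.
Qed.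

Lemma bandwidth_lt : \forall n \near \oo, ((s n).*2.+1 <= n)%N.
Proof.
have q : (0 : R) < 1 / 4 by rewrite divr_gt0.
apply: filterS2 (cvgr_lt _ s_small _ q) (nbhs_infty_ge 2) => n h n2.
have n0 : 0 < (n%:R : R) by rewrite ltr0n; exact: leq_trans n2.
move: h; rewrite ltr_pdivrMr// => h.
have : ((4 * s n)%:R : R) < n%:R by rewrite natrM; lra.
by rewrite ltr_nat; move: n2; rewrite /=; lia.
Qed.

Lemma smoothing_form_le1 n t u : `|smoothing_form n t u| <= 1.
Proof. by apply: kern_le1; [exact: lag_weight_ge0|exact: lag_weight_sum1]. Qed.

Lemma smoothing_formC n t u : smoothing_form n t u = smoothing_form n u t.
Proof. by rewrite /smoothing_form -opprB /smoothing_kernel kernN. Qed.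

(** The three terms of the bound are the far cumulants, the near cumulants and the
products of covariances; [condition_M2] and the vanishing of the sum of squared
weights make each of them tend to 0. *)
Lemma smoothed_variance_cvg0 :
  (M n / n%:R) ^+ 2 * Ex P (fun w => (Z n w - Ex P (Z n)) ^+ 2) @[n --> \oo] --> (0 : R).
Proof.
have [C HC] := gam_bounded.
(* 1715 = 5 * 7^3, from 6 r + 1 <= 7 r for r >= 1. *)
pose B n : R := 336 * (M n ^+ 2 * n%:R * \sum_((r n).+1 <= h < n.+1) mixing_rate X h) +
  1715 * ((M n * p n) * (M n * (r n)%:R ^+ 3 / n%:R)) +
  2 * C ^+ 2 * sym_sum (s n) (fun j => wt n j ^+ 2).
have B0 : B n @[n --> \oo] --> (0 : R).
  have -> : 0 = 336 * 0 + 1715 * (tau 0%N * 0) + 2 * C ^+ 2 * 0 :> R by ring.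
  apply: cvgD; first apply: cvgD.
  - by apply: cvgMr; exact: (M2_mixing cM2).
  - by apply: cvgMr; apply: cvgM; [exact: p_cvg|exact: (M2_m_r cM2)].
  - by apply: cvgMr; exact: wt_sqr.
have r1 : \forall n \near \oo, (0 < r n)%N.
  have h : \forall k \near \oo, (0 < k)%N by exact: nbhs_infty_gt.
  exact: (M_r_infty cM h).
apply: (squeeze_cvgr _ (cvg_cst 0) B0).
apply: filterS (filterI (filterI HC bandwidth_lt) (filterI r1 (nbhs_infty_gt 0))).
move=> n [[hC hs] [hr n0]].
have nR : 0 < (n%:R : R) by rewrite ltr0n.
have p0 : 0 <= p n by exact: pr_ge0.
have xi0 h := mixing_rate_ge0 X h.
apply/andP; split; first by rewrite mulr_ge0 ?sqr_ge0// Ex_ge0// => w; exact: sqr_ge0.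
have V := qform_variance mA stat (a (m n)) n (@smoothing_form_le1 n) (@smoothing_formC n).
have Cum := sum_cumulant_bound mA stat (a (m n)) n (r n).
have S := parseval (@lag_weight n) (lowest_freq n) n0 hs.
rewrite -/(smoothing_kernel n) in S.
have F : \sum_(1 <= h < n) far_mixing X (r n) h <= \sum_((r n).+1 <= h < n.+1) mixing_rate X h.
  apply: (@le_trans _ _ (\sum_((r n).+1 <= h < n) mixing_rate X h)).
    exact: (sum_nat_trunc_ge 1 n (r n).+1 xi0).
  have [rn|nr] := leqP (r n).+1 n; last by rewrite big_geq ?sumr_ge0// ltnW.
  by rewrite [leRHS]big_nat_recr//= lerDl.
have mass0 := acov_mass_ge0 X A (a (m n)) n.
set mass := acov_mass X A (a (m n)) n in V hC mass0.
rewrite /B; clear B B0; set w2 := sym_sum (s n) (fun j => wt n j ^+ 2).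
have {}S : \sum_(1 <= t < n.+1) \sum_(1 <= u < n.+1) smoothing_form n t u ^+ 2 <= n%:R ^+ 2 * w2 by exact: S.
set G := \sum_((r n).+1 <= h < n.+1) mixing_rate X h in F *.
set SW := \sum_(1 <= t < n.+1) \sum_(1 <= u < n.+1) smoothing_form n t u ^+ 2 in V S.
have cum := le_trans V (lerD Cum (lexx _)).
apply: (@le_trans _ _ ((M n / n%:R) ^+ 2 * (336 * n%:R ^+ 3 * G +
    5 * p n * n%:R * (343 * (r n)%:R ^+ 3) + (mass ^+ 2 * (n%:R ^+ 2 * w2)) *+ 2))).
  apply: ler_wpM2l; first exact: sqr_ge0.
  apply: (le_trans cum); apply: lerD; first apply: lerD.
  - by apply: ler_wpM2l => //; rewrite mulr_ge0 ?exprn_ge0.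
  - apply: ler_wpM2l; first by rewrite !mulr_ge0.
    rewrite (_ : 343 * (r n)%:R ^+ 3 = (7 * (r n)%:R) ^+ 3 :> R); last by ring.
    have : 1 <= (r n)%:R :> R by rewrite ler1n.
    by move=> h; apply: lerXn2r; rewrite ?nnegrE; lra.
  - by rewrite lerMn2r orFb; apply: ler_wpM2l => //; exact: sqr_ge0.
have -> : (M n / n%:R) ^+ 2 * (336 * n%:R ^+ 3 * G +
    5 * p n * n%:R * (343 * (r n)%:R ^+ 3) + (mass ^+ 2 * (n%:R ^+ 2 * w2)) *+ 2) =
   336 * (M n ^+ 2 * n%:R * G) + 1715 * ((M n * p n) * (M n * (r n)%:R ^+ 3 / n%:R)) +
   2 * (M n * mass) ^+ 2 * w2.
  by field; rewrite gt_eqF.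
rewrite lerD2l; apply: ler_wpM2r; first exact: sumr_ge0 (fun _ _ => sqr_ge0 _).
rewrite ler_pM2l//; apply: lerXn2r => //; rewrite nnegrE.
  by rewrite mulr_ge0.
by apply: le_trans hC; rewrite mulr_ge0.
Qed.

Lemma bandwidth_cvg0 : 2 * pi / n%:R + 2 * pi * ((s n)%:R / n%:R) @[n --> \oo] --> (0 : R).
Proof.
have -> : 0 = 2 * pi * 0 + 2 * pi * 0 :> R by rewrite mulr0 addr0.
apply: cvgD; last by apply: cvgMr; exact: s_small.
apply: cvgMr; apply/gtr0_cvgV0; last exact: cvgr_idn.
by apply: filterS (nbhs_infty_gt 0) => n n0; rewrite ltr0n.
Qed.

(** The first multiple of 2 pi / n above [lambda] is within 2 pi / n of it, and the
window extends by [s n] such steps on both sides. *)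
Lemma theta_near n i : (0 < n)%N ->
  `|theta n (lowest_freq n) (i : 'I_((s n).*2.+1)) - lambda| <=
  2 * pi / n%:R + 2 * pi * ((s n)%:R / n%:R).
Proof.
move=> n0; have nR : 0 < (n%:R : R) by rewrite ltr0n.
have /andP[lo hi] := fourier_freq0_bounds lambda n0.
have pi0 := pi_gt0 R.
have -> : theta n (lowest_freq n) i - lambda =
   (fourier_freq0 n lambda - lambda) + 2 * pi * ((i%:R - (s n)%:R) / n%:R).
  by rewrite /theta /lowest_freq; ring.
apply: (le_trans (ler_normD _ _)); apply: lerD.
  by rewrite ger0_norm ?subr_ge0// lerBlDl.
rewrite normrM gtr0_norm ?mulr_gt0// ler_pM2l ?mulr_gt0// normrM normfV (gtr0_norm nR).
rewrite ler_pM2r ?invr_gt0// ler_norml; apply/andP; split.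
  by rewrite lerBrDl subrr.
have : (i%:R : R) <= ((s n).*2)%:R by rewrite ler_nat -ltnS.
have -> : ((s n).*2)%:R = 2 * (s n)%:R :> R by rewrite -mul2n natrM.
lra.
Qed.

Lemma smoothing_kernel_cvg (h : nat) : K n h%:R @[n --> \oo] --> cos (h%:R * lambda).
Proof.
apply/cvgrPdist_le => e e0.
have [del /= del0 Hdel] : exists2 del : R, 0 < del &
    forall y, `|h%:R * lambda - y| < del -> `|cos (h%:R * lambda) - cos y| < e.
  have /cvgrPdist_lt/(_ e e0) := @continuous_cos R (h%:R * lambda).
  by move=> /nbhs_ballP[del /= del0 Hdel]; exists del.
have d0 : 0 < del / h.+1%:R by rewrite divr_gt0.
apply: filterS2 (cvgr_lt _ bandwidth_cvg0 _ d0) (nbhs_infty_gt 0) => n hn n0.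
rewrite distrC; apply: (kern_approx (@lag_weight_ge0 n) (@lag_weight_sum1 n)).
  by move=> i; exact: theta_near.
move=> y hy; rewrite distrC; apply: ltW; apply: Hdel.
rewrite -mulrBr distrC in hy *; rewrite normrM normr_nat.
move: (le_lt_trans hy hn); rewrite ltr_pdivlMr// => hy'.
apply: le_lt_trans hy'; rewrite mulrC distrC ler_wpM2l// ler_nat //.
Qed.

Lemma tau_summable : cvgn (series tau).
Proof.
have tau0 h : 0 <= tau h by exact: tail_mass_ge0.
have t00 := tau0_gt0.
apply: nondecreasing_is_cvgn; first by apply: nondecreasing_series => h _ _.
have ext0 (h : nat) : (0 <= (extremogram X A h)%:E)%E by rewrite lee_fin extE divr_ge0.
have fS := rho_summable; set S := (\sum_(1 <= h <oo) (extremogram X A h)%:E)%E in fS.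
have S0 : (0 <= S)%E by apply: nneseries_ge0.
have Sfin : S \is a fin_num by rewrite ge0_fin_numE.
exists (tau 0%N + tau 0%N * fine S) => _ [n _ <-]; rewrite /series /=.
apply: (@le_trans _ _ (\sum_(0 <= h < n.+1) tau h)).
  by rewrite [leRHS]big_nat_recr//= lerDl.
rewrite big_ltn// lerD2l.
have -> : \sum_(1 <= h < n.+1) tau h = tau 0%N * \sum_(1 <= h < n.+1) extremogram X A h.
  rewrite mulr_sumr; apply: eq_bigr => h _; rewrite extE; field; rewrite gt_eqF//.
apply: ler_wpM2l => //; rewrite -lee_fin fineK// -sumEFin.
by apply: nneseries_lim_ge => h _ _.
Qed.

Let u h : R := tau h * cos (h%:R * lambda).

Lemma tau_cos_summable : cvgn (series u).
Proof.
apply: normed_cvg; apply: series_le_cvg tau_summable.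
- by move=> h; exact: normr_ge0.
- by move=> h; exact: tail_mass_ge0.
- move=> h /=; rewrite /u normrM ger0_norm ?tail_mass_ge0// ler_piMr ?tail_mass_ge0//.
  exact: cos_max.
Qed.

Definition spectral_limit : R := 2 * limn (series u) - tau 0%N.

Lemma spectral_densityE :
  spectral_density X A lambda = (spectral_limit / tau 0%N)%:C%C.
Proof.
have t0 := tau0_gt0.
have haus : hausdorff_space R[i]^o by exact: norm_hausdorff.
rewrite /spectral_density; under eq_fun do rewrite sym_sum_cos.
apply: (cvg_lim haus); apply: cvg_real_complex.
have E N : 2 * series (fun h => extremogram X A h * cos (h%:R * lambda)) N.+1 - extremogram X A 0 =
    (2 * series u N.+1 - tau 0%N) / tau 0%N.
  rewrite mulrBl -mulrA /series /= mulr_suml extE; congr (2 * _ - _).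
  by apply: eq_bigr => h _; rewrite extE /u; ring.
under eq_fun do rewrite E.
apply: cvgMl; apply: cvgB; last exact: cvg_cst.
by apply: cvgMr; rewrite (cvg_shiftS (series u)); exact: tau_cos_summable.
Qed.

Lemma meanE n : (0 < n)%N -> M n / n%:R * Ex P (Z n) =
  M n * gam n 0 + 2 * \sum_(1 <= h < n) (1 - h%:R / n%:R) * (M n * gam n h) * K n h%:R.
Proof.
move=> n0; have nR : 0 < (n%:R : R) by rewrite ltr0n.
rewrite Ex_qform//.
have E t v : smoothing_form n t v * gam n (lag t v) = K n (lag t v)%:R * gam n (lag t v).
  congr (_ * _); wlog tv : t v / (t <= v)%N.
    by move=> H; have [/H//|/ltnW/H] := leqP t v; rewrite smoothing_formC lagC.
  rewrite smoothing_formC /smoothing_form -natrB//; congr (K n _%:R).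
  by rewrite /lag; lia.
under eq_bigr do under eq_bigr do rewrite E.
rewrite (@sum_lag_square R (fun h => K n h%:R * gam n h)).
rewrite /smoothing_kernel kern0; last exact: lag_weight_sum1.
rewrite mul1r mulrDr; congr (_ + _); first by field; rewrite gt_eqF.
rewrite -[X in _ * X]mulr_natl mulrCA; congr (2 * _); rewrite mulr_sumr.
apply: eq_bigr => h _; field; rewrite gt_eqF//.
Qed.

(** Cut at a lag [k] beyond which both the covariances and the limit series are small;
the finitely many remaining terms converge one by one. *)
Lemma mean_cvg : M n / n%:R * Ex P (Z n) @[n --> \oo] --> spectral_limit.
Proof.
apply/cvgrPdist_le => e e0.
have e8 : 0 < e / 8 by rewrite divr_gt0.
have [k0 Hk0] := gam_tail e8.
have [k1 _ Hk1] : \forall k \near \oo, `|limn (series u) - series u k| <= e / 8.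
  by have /cvgrPdist_le/(_ _ e8) := tau_cos_summable.
pose k := maxn 1 (maxn k0 k1).
have k_1 : (1 <= k)%N by exact: leq_maxl.
have {}Hk1 := Hk1 k (leq_trans (leq_maxr _ _) (leq_maxr _ _)).
have {}Hk0 := Hk0 k (leq_trans (leq_maxl _ _) (leq_maxr _ _)).
pose D n := M n * gam n 0 + 2 * \sum_(1 <= h < k) (1 - h%:R / n%:R) * (M n * gam n h) * K n h%:R.
have Dk : D n @[n --> \oo] --> 2 * series u k - tau 0%N.
  have -> : 2 * series u k - tau 0%N = tau 0%N + 2 * \sum_(1 <= h < k) (1 - h%:R * 0) * tau h * cos (h%:R * lambda).
    rewrite /series /= big_ltn// /u mul0r cos0.
    have -> : \sum_(1 <= h < k) (1 - h%:R * 0) * tau h * cos (h%:R * lambda) =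
        \sum_(1 <= h < k) tau h * cos (h%:R * lambda).
      by apply: eq_bigr => h _; rewrite mulr0 subr0 mul1r.
    by ring.
  apply: cvgD; first exact: gam_cvg.
  apply: cvgMr; apply: cvg_sum_seq => h; apply: cvgM; last exact: smoothing_kernel_cvg.
  apply: cvgM; last exact: gam_cvg.
  apply: cvgB; first exact: cvg_cst.
  apply: cvgMr; apply/gtr0_cvgV0; last exact: cvgr_idn.
  by apply: filterS (nbhs_infty_gt 0) => n n0; rewrite ltr0n.
have e4 : 0 < e / 4 by rewrite divr_gt0.
have /cvgrPdist_le/(_ _ e4) HD := Dk.
apply: filterS (filterI (filterI Hk0 HD) (nbhs_infty_ge k)) => n [[h1 h2] /= kn].
have n0 : (0 < n)%N by exact: leq_trans kn.
have nR : 0 < (n%:R : R) by rewrite ltr0n.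
have h3 : `|M n / n%:R * Ex P (Z n) - D n| <= 2 * (e / 8).
  rewrite meanE// /D opprD addrACA subrr add0r -mulrBr normrM ger0_norm// ler_pM2l//.
  rewrite (big_cat_nat k_1 kn)/= addrAC subrr add0r.
  apply: (le_trans (ler_norm_sum _ _ _)); apply: le_trans h1; rewrite mulr_sumr.
  apply: ler_sum_nat => h /andP[_ hn].
  have q1 : h%:R / n%:R <= 1 :> R by rewrite ler_pdivrMr// mul1r ler_nat ltnW.
  have q0 : 0 <= h%:R / n%:R :> R by rewrite divr_ge0.
  have kle : `|K n h%:R| <= 1.
    by apply: kern_le1; [exact: lag_weight_ge0|exact: lag_weight_sum1].
  rewrite !normrM ger0_norm ?subr_ge0// (ger0_norm (ler0n _ (m n))).
  have b0 : 0 <= M n * `|gam n h| by rewrite mulr_ge0.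
  apply: (@le_trans _ _ (1 * (M n * `|gam n h|) * 1)); last by rewrite mulr1 mul1r.
  apply: ler_pM => //; first by rewrite mulr_ge0// subr_ge0.
  by apply: ler_wpM2r => //; lra.
have -> : spectral_limit - M n / n%:R * Ex P (Z n) =
   2 * (limn (series u) - series u k) + (2 * series u k - tau 0%N - D n) - (M n / n%:R * Ex P (Z n) - D n).
  by rewrite /spectral_limit; ring.
apply: (le_trans (ler_normB _ _)).
apply: (le_trans (lerD (ler_normD _ _) (lexx _))).
by rewrite normrM ger0_norm//; lra.
Qed.

Lemma bounded_smoothed n : bounded_mfun (smoothed_periodogram X A a m n s wt lambda).
Proof.
rewrite (_ : smoothed_periodogram _ _ _ _ _ _ _ _ = fun w => M n / n%:R * Z n w).
  by apply: bounded_mfunZ; exact: bounded_qform.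
by apply/funext => w; exact: smoothed_periodogramE.
Qed.

Lemma smoothed_L2 : Ex P (fun w =>
    (smoothed_periodogram X A a m n s wt lambda w - spectral_limit) ^+ 2) @[n --> \oo] --> (0 : R).
Proof.
have h : (M n / n%:R) ^+ 2 * Ex P (fun w => (Z n w - Ex P (Z n)) ^+ 2) +
    (M n / n%:R * Ex P (Z n) - spectral_limit) ^+ 2 @[n --> \oo] --> (0 : R).
  rewrite -[X in _ --> X]addr0; apply: cvgD; first exact: smoothed_variance_cvg0.
  by apply: cvg_sqr_center; exact: mean_cvg.
suff E n : Ex P (fun w => (smoothed_periodogram X A a m n s wt lambda w - spectral_limit) ^+ 2) =
    (M n / n%:R) ^+ 2 * Ex P (fun w => (Z n w - Ex P (Z n)) ^+ 2) +
    (M n / n%:R * Ex P (Z n) - spectral_limit) ^+ 2 by under eq_fun do rewrite E.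
rewrite -Ex_affine_sqr; last exact: bounded_qform.
by congr (Ex P _); apply/funext => w; rewrite smoothed_periodogramE.
Qed.

Lemma PhatE n w : (0 < n)%N -> Phat X A a m n w =
  M n / n%:R * (\sum_(1 <= t < n.+1) centered_hit X A (a (m n)) t%:Z w) + M n * p n.
Proof.
move=> n0.
have -> : \sum_(1 <= t < n.+1) centered_hit X A (a (m n)) t%:Z w =
    \sum_(1 <= t < n.+1) ind X A a m n t%:Z w - n%:R * p n.
  by rewrite /centered_hit sumrB [X in _ - X]big_const_nat subSS subn0 iter_addr_0 mulr_natl.
by rewrite /Phat; field; rewrite pnatr_eq0 -lt0n.
Qed.

Lemma bounded_Phat n : bounded_mfun (Phat X A a m n).
Proof.
by apply: bounded_mfunZ; apply: bounded_mfun_sum => t; exact: bounded_indic_hits.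
Qed.

(** The centred sum is the quadratic form with constant kernel 1, so its mean square is
at most n times the total mass of the covariances. *)
Lemma Phat_L2 : Ex P (fun w => (Phat X A a m n w - tau 0%N) ^+ 2) @[n --> \oo] --> (0 : R).
Proof.
have [C HC] := gam_bounded.
have h : (M n / n%:R) * C + (M n * p n - tau 0%N) ^+ 2 @[n --> \oo] --> (0 : R).
  rewrite -[X in _ --> X]addr0; apply: cvgD; last by apply: cvg_sqr_center; exact: p_cvg.
  by rewrite -(mul0r C); apply: cvgMl; exact: (M_m_n cM).
apply: (squeeze_cvgr _ (cvg_cst 0) h).
apply: filterS (filterI HC (nbhs_infty_gt 0)) => n [hC n0].
apply/andP; split; first by apply: Ex_ge0 => w; exact: sqr_ge0.
pose f w := \sum_(1 <= t < n.+1) centered_hit X A (a (m n)) t%:Z w.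
have bf : bounded_mfun f by apply: bounded_mfun_sum => t; exact: bounded_centered_hit.
have Ef : Ex P f = 0.
  by rewrite Ex_sum => [|t]; [rewrite big1// => t _; exact: Ex_J|exact: bounded_centered_hit].
have -> : Ex P (fun w => (Phat X A a m n w - tau 0%N) ^+ 2) =
    Ex P (fun w => (M n / n%:R * f w - (tau 0%N - M n * p n)) ^+ 2).
  by congr (Ex P _); apply/funext => w; rewrite PhatE// opprB addrA.
rewrite Ex_affine_sqr// Ef mulr0 sub0r sqrrN.
rewrite -[X in _ <= _ + X]sqrrN opprB lerD2r.
under [X in Ex P X]eq_fun do rewrite subr0.
have -> : Ex P (fun w => f w ^+ 2) = Ex P (qform X A (a (m n)) n (fun _ _ => 1)).
  congr (Ex P _); apply/funext => w; rewrite expr2 /f mulr_suml; apply: eq_bigr => t _.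
  by rewrite mulr_sumr; apply: eq_bigr => v _; rewrite mul1r.
have q0 : 0 <= M n / n%:R by rewrite divr_ge0.
have nR : 0 < (n%:R : R) by rewrite ltr0n.
rewrite Ex_qform// expr2 -mulrA ler_wpM2l//.
apply: le_trans hC; rewrite -mulrA ler_wpM2l// ler_pdivrMl//.
apply: (@le_trans _ _ (\sum_(1 <= t < n.+1) acov_mass X A (a (m n)) n)); last first.
  by rewrite big_const_nat subSS subn0 iter_addr_0 mulr_natl.
apply: ler_sum_nat => t tn; apply: le_trans (sum_acov_row _ _ _ tn).
by apply: ler_sum => v _; rewrite mul1r ler_norm.
Qed.

End SmoothedPeriodogram.

(** * From mean square to probability *)

Section FromMeanSquare.
Context {dT : measure_display} {T : measurableType dT} {R : realType}.
Variable P : probability T R.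
Implicit Types f g : T -> R.

Lemma measurable_gt f x : measurable_fun setT f -> measurable [set w | x < f w].
Proof.
move=> /(_ measurableT `]x, +oo[%classic (measurable_itv _)); rewrite setTI.
by congr measurable; apply/seteqP; split=> w; rewrite /= in_itv /= andbT.
Qed.

Lemma measurable_gt_norm f x : bounded_mfun f -> measurable [set w | x < `|f w|].
Proof. by move=> /bounded_mfun_norm[mf _]; exact: measurable_gt. Qed.

Lemma chebyshev_Ex f delta : bounded_mfun f -> 0 < delta ->
  pr P [set w | delta < `|f w|] <= Ex P (fun w => f w ^+ 2) / delta ^+ 2.
Proof.
move=> bf d0; rewrite ler_pdivlMr ?exprn_gt0// mulrC.
have mS := measurable_gt_norm delta bf.
have bI := bounded_mfun_indic mS.
rewrite -Ex_indic// -ExZ//; apply: le_Ex; [exact: bounded_mfunZ|exact: bounded_mfunX|].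
move=> w; rewrite indicE; case: (boolP (w \in _)) => [/set_mem /= h|_].
  by rewrite mulr1 -[leRHS](real_normK (num_real _)) lerXn2r ?nnegrE ?normr_ge0// ltW.
by rewrite mulr0 sqr_ge0.
Qed.

Lemma cvg_L2_real (f : nat -> T -> R) (c : R) : (forall n, bounded_mfun (f n)) ->
  Ex P (fun w => (f n w - c) ^+ 2) @[n --> \oo] --> (0 : R) ->
  cvg_L2 P (fun n w => (f n w)%:C%C) c%:C%C.
Proof.
move=> bf h; rewrite /cvg_L2.
have E n : (\int[P]_w (cabs ((f n w)%:C%C - c%:C%C) ^+ 2)%:E)%E =
    (Ex P (fun w => (f n w - c) ^+ 2))%:E.
  under eq_integral do rewrite cabs_realB real_normK ?num_real//.
  rewrite /Ex /Rintegral fineK//; apply: integrable_fin_num => //.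
  apply: bounded_mfun_integrable; apply: bounded_mfunX; apply: bounded_mfunB => //.
  exact: bounded_mfun_cst.
under eq_fun do rewrite E.
by apply: cvg_EFin; [exact: nearW|].
Qed.

(** Off the events where [f n] or [g n] deviates from its limit by more than [delta],
[g n] is at least [tau / 2] and the ratio deviates by at most
2 delta (1 + |x|) / tau. *)
Lemma ratio_cvg_in_probability (f g : nat -> T -> R) (tau x : R) : 0 < tau ->
  (forall n, bounded_mfun (f n)) -> (forall n, bounded_mfun (g n)) ->
  Ex P (fun w => (f n w - tau * x) ^+ 2) @[n --> \oo] --> (0 : R) ->
  Ex P (fun w => (g n w - tau) ^+ 2) @[n --> \oo] --> (0 : R) ->
  cvg_in_probability P (fun n w => (f n w / g n w)%:C%C) x%:C%C.
Proof.
move=> tau0 bf bg fL2 gL2 eps eps0.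
pose delta := Num.min (tau / 2) (eps * tau / (2 * (1 + `|x|))).
have x1 : 0 < 1 + `|x| by rewrite ltr_pwDl.
have d0 : 0 < delta by rewrite lt_min !divr_gt0 ?mulr_gt0.
have d1 : delta <= tau / 2 by rewrite ge_min lexx.
have d2 : delta * (1 + `|x|) <= eps * (tau / 2).
  have : delta <= eps * tau / (2 * (1 + `|x|)) by rewrite ge_min lexx orbT.
  by rewrite ler_pdivlMr ?mulr_gt0// => h; lra.
pose D n := [set w | eps < cabs ((f n w / g n w)%:C%C - x%:C%C)].
pose F n := [set w | delta < `|f n w - tau * x|].
pose G n := [set w | delta < `|g n w - tau|].
have bfx n : bounded_mfun (fun w => f n w - tau * x) by apply: bounded_mfunB => //; exact: bounded_mfun_cst.
have bgx n : bounded_mfun (fun w => g n w - tau) by apply: bounded_mfunB => //; exact: bounded_mfun_cst.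
have mF n : measurable (F n) by exact: (measurable_gt_norm delta (bfx n)).
have mG n : measurable (G n) by exact: (measurable_gt_norm delta (bgx n)).
have DE n w : D n w = (eps < `|f n w / g n w - x|) :> Prop.
  by rewrite /D /mkset cabs_realB.
have mD n : measurable (D n).
  have m0 : measurable [set w | 0 < `|g n w|] by exact: measurable_gt_norm.
  have m1 : measurable [set w | 0 < `|f n w - x * g n w| - eps * `|g n w|].
    have b : bounded_mfun (fun w => `|f n w - x * g n w| - eps * `|g n w|).
      apply: bounded_mfunB; last by apply: bounded_mfunZ; exact: bounded_mfun_norm.
      by apply: bounded_mfun_norm; apply: bounded_mfunB => //; exact: bounded_mfunZ.
    exact: measurable_gt b.1.
  (* Clearing the denominator expresses the event without division; where [g n] vanishes,
     the quotient is 0. *)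
  rewrite (_ : D n = ([set w | 0 < `|g n w|] `&` [set w | 0 < `|f n w - x * g n w| - eps * `|g n w|])
     `|` (~` [set w | 0 < `|g n w|] `&` (if eps < `|x| then setT else set0))).
    apply: measurableU; apply: measurableI => //; first exact: measurableC.
    by case: ifP.
  have key w : g n w != 0 -> (eps < `|f n w / g n w - x|) = (0 < `|f n w - x * g n w| - eps * `|g n w|).
    move=> g0; rewrite subr_gt0 -[RHS](@ltr_pM2r _ `|g n w|^-1) ?invr_gt0 ?normr_gt0//.
    rewrite -mulrA divff ?normr_eq0// mulr1 -normfV -normrM; congr (_ < `|_|); field; exact: g0.
  apply/seteqP; split=> w; rewrite DE /= normr_gt0.
    have [g0|g0] := eqVneq (g n w) 0; last by rewrite key//; left.
    by rewrite g0 invr0 mulr0 sub0r normrN => h; right; rewrite h.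
  move=> [[g0 h]|[/negP]]; first by rewrite key.
  by rewrite negbK => /eqP ->; rewrite invr0 mulr0 sub0r normrN; case: ifP.
have sub n : D n `<=` F n `|` G n.
  move=> w; rewrite DE => h; apply: contrapT => /not_orP[/negP + /negP].
  rewrite /F /G /= -!leNgt => hf hg; move: h; apply/negP; rewrite -leNgt.
  have g0 : tau / 2 <= g n w by move: hg; rewrite ler_norml => /andP[]; lra.
  have gp : 0 < g n w by apply: lt_le_trans g0; rewrite divr_gt0.
  have -> : f n w / g n w - x = ((f n w - tau * x) - x * (g n w - tau)) / g n w.
    by field; rewrite gt_eqF.
  rewrite normrM normfV (gtr0_norm gp) ler_pdivrMr//.
  apply: (le_trans (ler_normB _ _)).
  apply: (@le_trans _ _ (delta * (1 + `|x|))).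
    by rewrite [leRHS]mulrDr mulr1; apply: lerD => //; rewrite normrM mulrC ler_wpM2r.
  by apply: (le_trans d2); rewrite ler_wpM2l// ltW.
have lim : (Ex P (fun w => (f n w - tau * x) ^+ 2) + Ex P (fun w => (g n w - tau) ^+ 2)) / delta ^+ 2
    @[n --> \oo] --> (0 : R).
  by rewrite -(mul0r (delta ^+ 2)^-1); apply: cvgMl; rewrite -[X in _ --> X]addr0; apply: cvgD.
have prD : pr P (D n) @[n --> \oo] --> (0 : R).
  apply: (squeeze_cvgr _ (cvg_cst 0) lim); apply: nearW => n.
  rewrite pr_ge0 /= mulrDl.
  apply: le_trans (lerD (chebyshev_Ex (bfx n) d0) (chebyshev_Ex (bgx n) d0)).
  rewrite -lee_fin EFinD /pr !fineK ?fin_num_measure//; [|exact: mG|exact: mF].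
  apply: (@le_trans _ _ (P (F n `|` G n))).
    by apply: le_measure; rewrite ?inE//; exact: measurableU.
  by apply: measureU2; [exact: mF|exact: mG].
have E i : P [set w | eps < cabs ((f i w / g i w)%:C%C - x%:C%C)] = (pr P (D i))%:E.
  by rewrite /pr fineK ?fin_num_measure.
under eq_fun do rewrite E.
by apply: cvg_EFin; [exact: nearW|].
Qed.

End FromMeanSquare.

Theorem theorem5p1
    (dT : measure_display) (T : measurableType dT) (R : realType)
    (P : probability T R) (d : nat)
    (X : int -> {RV P >-> borelType 'rV[R]_d})
    (alpha : R) (a : nat -> R)
    (mu : forall h : nat,
       {measure set (borelType 'M[\bar R]_(h.+1, d)) -> \bar R})
    (A : set 'rV[\bar R]_d) (m r s : nat -> nat) (wt : nat -> int -> R)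
    (lambda : R) :
  strictly_stationary X ->
  0 < alpha ->
  regularly_varying X alpha a mu ->
  (measurable : set (set (borelType 'rV[\bar R]_d))) A ->
  bounded_away0 A ->
  continuity_set (mu 0%N) A ->
  (forall h : nat, (1 <= h)%N ->
     continuity_set (mu h) [set x | A (row ord0 x)] /\
     continuity_set (mu h) [set x | A (row ord0 x) /\ A (row ord_max x)]) ->
  (0 < mu 0%N A)%E ->
  condition_M X a m r ->
  condition_M1 X m r ->
  condition_M2 X m r ->
  (\sum_(1 <= h <oo) (extremogram X A h)%:E < +oo)%E ->
  s n @[n --> \oo] --> \oo ->
  (s n)%:R / n%:R @[n --> \oo] --> (0 : R) ->
  (forall (n : nat) (j : int), (`|j| <= s n)%N -> 0 <= wt n j) ->
  (forall n : nat, sym_sum (s n) (wt n) = 1) ->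
  sym_sum (s n) (fun j => wt n j ^+ 2) @[n --> \oo] --> (0 : R) ->
  0 < lambda -> lambda < pi ->
  cvg_L2 P (fun n w => (smoothed_periodogram X A a m n s wt lambda w)%:C%C)
    ((fine (mu 0%N A))%:C%C * spectral_density X A lambda) /\
  cvg_in_probability P
    (fun n w =>
       (smoothed_periodogram X A a m n s wt lambda w / Phat X A a m n w)%:C%C)
    (spectral_density X A lambda).

Proof.
move=> stat alpha0 rv mA A0 Ac AAc A_gt0 cM _ cM2 rho_sum _ s_small wt0 wt1 wt2 _ _.
have {}AAc h h1 := (AAc h h1).2.
have tau0E := tail_mass0 rv mA A0 Ac AAc.
have tau0 := tail_mass0_gt0 rv mA A0 Ac AAc A_gt0.
have L2 := smoothed_L2 lambda stat alpha0 rv mA A0 Ac AAc A_gt0 cM cM2 rho_sum s_small wt0 wt1 wt2.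
have specE := spectral_densityE lambda alpha0 rv mA A0 Ac AAc A_gt0 rho_sum.
set F := spectral_limit mu A lambda in L2 specE.
have bZ n : bounded_mfun (smoothed_periodogram X A a m n s wt lambda) by exact: bounded_smoothed.
have FE : tail_mass mu A 0 * (F / tail_mass mu A 0) = F by rewrite mulrC divfK ?gt_eqF.
split.
  rewrite -tau0E specE -rmorphM /= FE; exact: cvg_L2_real.
rewrite specE; apply: (ratio_cvg_in_probability tau0) => //.
- by move=> n; exact: bounded_Phat.
- by rewrite FE.
- exact: Phat_L2 stat rv mA A0 Ac AAc cM.
Qed.
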